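(* Let $0<\beta<1$ be given and let $c$ be a positive number less than $\sqrt{\min(1/2,\,1-\beta)}$. If $T$ is sufficiently large, then there exists a $t$ with $T^{\beta}\le t\le T$ such that \[ \left|\zeta\Big(\frac12+it\Big)\right| \ge \exp\left(c\sqrt{\frac{\log T\,\log\log\log T}{\log\log T}}\right). \]
   Context: $\zeta$ denotes the Riemann zeta function. *)

(* Defs.v *)
From Stdlib Require Import Reals.
From Coquelicot Require Import Coquelicot.
Open Scope R_scope.

Definition Cexp (z : C) : C :=
  (RtoC (exp (Re z)) * (cos (Im z), sin (Im z)))%C.

(* n^(-s) = exp(-s log n) with the real logarithm; only used for n >= 1. *)
Definition dirichlet_term (s : C) (n : nat) : C :=
  Cexp (- s * RtoC (ln (INR n)))%C.

(* The Riemann zeta function as the analytic continuation to C \ {1} of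
   sum_{n >= 1} n^(-s), Re s > 1.  By the identity theorem the predicate
   determines zeta at every s <> 1; the value at the pole s = 1 is left
   unconstrained. *)
Definition is_riemann_zeta (zeta : C -> C) : Prop :=
  (forall s : C, s <> RtoC 1 ->
     @ex_derive C_AbsRing C_NormedModule zeta s) /\
  (forall s : C, 1 < Re s ->
     @is_series C_AbsRing C_NormedModule
       (fun n : nat => dirichlet_term s (S n)) (zeta s)).

(* Main.v *)
Require Import Defs.
From Stdlib Require Import Reals ZArith Lra Lia ClassicalEpsilon FunctionalExtensionality.
From Coquelicot Require Import Coquelicot.
From HB Require Import structures.
From mathcomp Require Import all_boot zify.
Delimit Scope R_scope with R.
Open Scope R_scope.

(** The proof is by resonance, with a pair of resonators. Suppose |zeta(1/2 + it)| < V for all t in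
    [T^beta, T]. Take two polynomials R1, R2 with nonnegative l2-normalised coefficients at the
    frequencies log m, for m in sets M1, M2 of at most N = T^kappa integers, where kappa < min(1/2,
    1 - beta). Integrate zeta(1/2 + it) conj(R1) R2 against a Gaussian of width tau = T / log T
    times (1 - exp(-t^2/(2 U^2)))^k with U = T^(beta + eps). The last factor makes the range below
    T^beta negligible, the Gaussian the range beyond T. The integral is O(V tau), since |R1 R2| <=
    (|R1|^2 + |R2|^2)/2 and the frequencies, binned on a grid of step 1/tau, are almost orthogonal.
    When zeta is opened into the terms n^(-s), the resonating triples m2 = n m1 contribute
    positively, and coefficients proportional to m^(-1/2) give V >> S / sqrt(h1 h2), where S sums
    1/m2 over the pairs m1 | m2 and h1, h2 sum 1/m over M1 and M2 ([resonance], [resonance_sets]).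

    Zeta is replaced by the Euler--Maclaurin sum [em_sum], which equals zeta(s) + 1/(1-s) up to
    O((1+t) X^(-1/2)) on the critical line ([em_rem_half]). That estimate is elementary for Re s > 1
    and is moved to the left by the maximum principle, because zeta is given only as a holomorphic
    continuation. Paired with e^(i lam t), [em_sum] becomes the sum of a Gaussian bump in log u over
    the integers minus its integral ([kern_eq]); this is bounded by total variation ([kern_abs]) and
    bounded below by the sum with a small loss ([kern_lower]). The losses are harmless when N^2 <=
    tau and N U <= tau, which is where kappa < 1/2 and kappa < 1 - beta come from.

    It remains to make S / sqrt(h1 h2) large. For a block of primes let M1 be the products of J - i
    distinct primes of the block and M2 the products of J. Summing S over supersets of the smaller
    set or over subsets of the larger one and taking the geometric mean gives a gain near e^i with
    i^2 close to J times the sum of 1/p ([block_link], [block_interval]). Gains and sizes multiply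
    over disjoint blocks ([resonator_mul]). With y = log N, D = log y and about (log D)/d blocks
    between y exp(D^d) and y exp(D^(1-d)), Mertens' estimates yield a gain exp((1 - o(1)) sqrt(y log
    D / D)) as d tends to 0 ([gcd_resonator]); y = kappa log T with kappa > c^2 finishes the
    proof. *)

(** * Complex continuity and differentiability in difference-quotient form *)

Definition ccont (f : C -> C) (z : C) :=
  forall e, 0 < e -> exists d, 0 < d /\
    forall w, Cmod (w - z) < d -> Cmod (f w - f z) < e.

Definition cdiff (f : C -> C) (z : C) :=
  exists q : C -> C, (forall w, f w - f z = q w * (w - z))%C /\ ccont q z.

Lemma Cmod_pos (z : C) : z <> RtoC 0 -> 0 < Cmod z.
Proof. by move=> H; exact: (proj1 (Cmod_gt_0 z) H). Qed.

Lemma Cmod_sub_pos (w z : C) : w <> z -> 0 < Cmod (w - z).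
Proof. by move=> H; apply: Cmod_pos; apply: Cminus_eq_contra. Qed.

Lemma ccont_const a z : ccont (fun _ => a) z.
Proof.
move=> e He; exists 1; split; first lra.
by move=> w _; replace (a - a)%C with (RtoC 0) by ring; rewrite Cmod_0.
Qed.

Lemma ccont_id z : ccont (fun w => w) z.
Proof. by move=> e He; exists e. Qed.

Lemma ccont_plus f g z : ccont f z -> ccont g z -> ccont (fun w => f w + g w)%C z.
Proof.
move=> Hf Hg e He.
have [d1 [Hd1 H1]] := Hf (e / 2) ltac:(lra).
have [d2 [Hd2 H2]] := Hg (e / 2) ltac:(lra).
exists (Rmin d1 d2); split; first exact: Rmin_glb_lt.
move=> w Hw.
have B1 := H1 w (Rlt_le_trans _ _ _ Hw (Rmin_l _ _)).
have B2 := H2 w (Rlt_le_trans _ _ _ Hw (Rmin_r _ _)).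
replace (f w + g w - (f z + g z))%C with ((f w - f z) + (g w - g z))%C by ring.
have := Cmod_triangle (f w - f z) (g w - g z); lra.
Qed.

Lemma ccont_mult f g z : ccont f z -> ccont g z -> ccont (fun w => f w * g w)%C z.
Proof.
move=> Hf Hg e He.
set K := (1 + Cmod (f z) + Cmod (g z)).
have HfK := Cmod_ge_0 (f z). have HgK := Cmod_ge_0 (g z).
have HK : 1 <= K by rewrite /K; lra.
have Hmin : 0 < Rmin 1 (e / (2 * K)).
  apply: Rmin_glb_lt; first lra. apply: Rdiv_lt_0_compat; lra.
have [d1 [Hd1 H1]] := Hf _ Hmin.
have [d2 [Hd2 H2]] := Hg _ Hmin.
exists (Rmin d1 d2); split; first exact: Rmin_glb_lt.
move=> w Hw.
have B1 := H1 w (Rlt_le_trans _ _ _ Hw (Rmin_l _ _)).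
have B2 := H2 w (Rlt_le_trans _ _ _ Hw (Rmin_r _ _)).
replace (f w * g w - f z * g z)%C with
  ((f w - f z) * (g w - g z) + f z * (g w - g z) + (f w - f z) * g z)%C by ring.
have T1 := Cmod_triangle ((f w - f z) * (g w - g z) + f z * (g w - g z)) ((f w - f z) * g z).
have T2 := Cmod_triangle ((f w - f z) * (g w - g z)) (f z * (g w - g z)).
rewrite !Cmod_mult in T1 T2.
have M1 := Rmin_l 1 (e / (2 * K)). have M2 := Rmin_r 1 (e / (2 * K)).
set m := Rmin 1 (e / (2 * K)) in B1 B2 M1 M2 Hmin.
have P1 := Cmod_ge_0 (f w - f z). have P2 := Cmod_ge_0 (g w - g z).
have Hm : m * (2 * K) <= e.
  have -> : e = e / (2 * K) * (2 * K) by field; lra.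
  apply: Rmult_le_compat_r; lra.
set x := Cmod (f w - f z) in B1 P1 T1 T2 *. set y := Cmod (g w - g z) in B2 P2 T1 T2 *.
have : x * y <= m by nra.
have : Cmod (f z) * y <= Cmod (f z) * m by nra.
have : x * Cmod (g z) <= m * Cmod (g z) by nra.
rewrite /K in Hm HK. nra.
Qed.

Lemma ccont_comp f g z : ccont g z -> ccont f (g z) -> ccont (fun w => f (g w)) z.
Proof.
move=> Hg Hf e He; have [d [Hd H]] := Hf e He.
by have [d' [Hd' H']] := Hg d Hd; exists d'; split => // w /H' /H.
Qed.

Lemma ccont_inv (z : C) : z <> RtoC 0 -> ccont Cinv z.
Proof.
move=> Hz e He.
have Hm := Cmod_pos z Hz.
exists (Rmin (Cmod z / 2) (e * (Cmod z * Cmod z) / 2)); split.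
  apply: Rmin_glb_lt; first lra.
  by have := Rmult_lt_0_compat _ _ He (Rmult_lt_0_compat _ _ Hm Hm); lra.
move=> w Hw.
have B1 := Rlt_le_trans _ _ _ Hw (Rmin_l _ _).
have B2 := Rlt_le_trans _ _ _ Hw (Rmin_r _ _).
have Hw2 : Cmod z / 2 < Cmod w.
  have := Cmod_triangle w (z - w).
  replace (w + (z - w))%C with z by ring.
  rewrite -(Cmod_opp (z - w)). replace (- (z - w))%C with (w - z)%C by ring. lra.
have Hw0 : w <> 0%C by move=> E; rewrite E Cmod_0 in Hw2; lra.
replace (/ w - / z)%C with (- ((w - z) * / (w * z)))%C by (field; split; assumption).
rewrite Cmod_opp Cmod_mult Cmod_inv; last exact: (Cmult_neq_0 _ _ Hw0 Hz).
rewrite Cmod_mult.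
have Hp : 0 < Cmod w * Cmod z by apply: Rmult_lt_0_compat; lra.
apply: (Rmult_lt_reg_r (Cmod w * Cmod z)) => //.
rewrite Rmult_assoc Rinv_l; last lra.
rewrite Rmult_1_r; apply: (Rlt_le_trans _ _ _ B2).
have : 0 <= e * Cmod z * (Cmod w - Cmod z / 2) by apply: Rmult_le_pos; nra.
lra.
Qed.

Lemma cdiff_ccont f z : cdiff f z -> ccont f z.
Proof.
move=> [q [Hq Hc]] e He.
have Hm : ccont (fun w => q w * (w + - z))%C z.
  by apply: ccont_mult => //; apply: ccont_plus; [exact: ccont_id|exact: ccont_const].
have [d [Hd H]] := Hm e He.
exists d; split=> // w Hw; rewrite Hq; move: (H w Hw).
by replace (q w * (w + - z) - q z * (z + - z))%C with (q w * (w - z))%C by ring.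
Qed.

Lemma cdiff_const a z : cdiff (fun _ => a) z.
Proof. by exists (fun _ => 0%C); split; [move=> w; ring|exact: ccont_const]. Qed.

Lemma cdiff_id z : cdiff (fun w => w) z.
Proof. by exists (fun _ => 1%C); split; [move=> w; ring|exact: ccont_const]. Qed.

Lemma cdiff_plus f g z : cdiff f z -> cdiff g z -> cdiff (fun w => f w + g w)%C z.
Proof.
move=> [q [Hq Hc]] [q' [Hq' Hc']]; exists (fun w => q w + q' w)%C; split.
  move=> w; replace (f w + g w - (f z + g z))%C with ((f w - f z) + (g w - g z))%C by ring.
  rewrite Hq Hq'; ring.
exact: ccont_plus.
Qed.

Lemma cdiff_mult f g z : cdiff f z -> cdiff g z -> cdiff (fun w => f w * g w)%C z.
Proof.
move=> [q [Hq Hc]] [q' [Hq' Hc']].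
exists (fun w => q w * (g z + q' w * (w + - z)) + f z * q' w)%C; split.
  move=> w.
  have -> : f w = (f z + q w * (w - z))%C by rewrite -Hq; ring.
  have -> : g w = (g z + q' w * (w - z))%C by rewrite -Hq'; ring.
  ring.
apply: ccont_plus; apply: ccont_mult => //; last exact: ccont_const.
apply: ccont_plus; first exact: ccont_const.
apply: ccont_mult => //; apply: ccont_plus; [exact: ccont_id|exact: ccont_const].
Qed.

Lemma cdiff_comp f g z : cdiff g z -> cdiff f (g z) -> cdiff (fun w => f (g w)) z.
Proof.
move=> Hg; have Hgc := cdiff_ccont _ _ Hg; case: Hg => [q [Hq Hc]] [q' [Hq' Hc']].
exists (fun w => q' (g w) * q w)%C; split.
  by move=> w; rewrite Hq' Hq; ring.
by apply: ccont_mult => //; apply: ccont_comp.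
Qed.

Lemma ccont_ext_near f g z d : 0 < d ->
  (forall w, Cmod (w - z) < d -> f w = g w) -> ccont f z -> ccont g z.
Proof.
move=> Hd E H e He; have [d' [Hd' H']] := H e He.
exists (Rmin d d'); split; first exact: Rmin_glb_lt.
move=> w Hw; have B1 := Rlt_le_trans _ _ _ Hw (Rmin_l _ _).
have B2 := Rlt_le_trans _ _ _ Hw (Rmin_r _ _).
rewrite -!E //; first exact: H'.
by replace (z - z)%C with (RtoC 0) by ring; rewrite Cmod_0.
Qed.

(* Caratheodory's form of differentiability makes the chain and product rules algebraic. *)
Lemma cdiff_intro f z q d : 0 < d ->
  (forall w, Cmod (w - z) < d -> f w - f z = q w * (w - z))%C -> ccont q z -> cdiff f z.
Proof.
move=> Hd E Hq.
exists (fun w => if Ceq_dec w z then q z else (f w - f z) / (w - z))%C; split.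
  move=> w; case: Ceq_dec => /= [E0|Hw]; first by rewrite E0; ring.
  by field; apply: Cminus_eq_contra.
apply: (ccont_ext_near q _ _ d) => // w Hw; case: Ceq_dec => /= [E0|Hne]; first by rewrite E0.
by rewrite E //; field; apply: Cminus_eq_contra.
Qed.

Lemma cdiff_inv (z : C) : z <> RtoC 0 -> cdiff Cinv z.
Proof.
move=> Hz; have Hm := Cmod_pos z Hz.
apply: (cdiff_intro _ _ (fun w => - / z * / w)%C (Cmod z)) => //.
  move=> w Hw.
  have Hw0 : w <> 0%C.
    move=> E; move: Hw; rewrite E; replace (0 - z)%C with (- z)%C by ring; rewrite Cmod_opp; lra.
  by field.
by apply: ccont_mult; [exact: ccont_const|exact: ccont_inv].
Qed.

Lemma cdiff_pow f z n : cdiff f z -> cdiff (fun w => Cpow (f w) n) z.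
Proof.
move=> H; elim: n => [|n IH] /=; first exact: cdiff_const.
exact: cdiff_mult.
Qed.

Lemma ex_derive_cdiff (f : C -> C) (z : C) :
  @ex_derive C_AbsRing C_NormedModule f z -> cdiff f z.
Proof.
move=> [l Hl].
have H := proj2 Hl z (fun P H => H).
exists (fun w => if Ceq_dec w z then l else (f w - f z) / (w - z))%C; split.
  move=> w; case: Ceq_dec => /= [E0|Hw]; first by rewrite E0; ring.
  by field; apply: Cminus_eq_contra.
move=> e He.
have He2 : 0 < e / 2 by lra.
have [d Hd] := H (mkposreal _ He2).
exists d; split; first exact: cond_pos.
move=> w Hw.
case: (Ceq_dec z z) => /= [_|//]; case: Ceq_dec => /= [E|Hne].
  by replace (l - l)%C with (RtoC 0) by ring; rewrite Cmod_0.
have Hm := Cmod_sub_pos w z Hne.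
have Hb : Cmod (f w - f z - l * (w - z)) <= e / 2 * Cmod (w - z).
  have -> : (f w - f z - l * (w - z))%C = (f w - f z - (w - z) * l)%C by ring.
  exact: (Hd w Hw).
replace ((f w - f z) / (w - z) - l)%C with ((f w - f z - l * (w - z)) * / (w - z))%C; last first.
  by field; apply: Cminus_eq_contra.
rewrite Cmod_mult Cmod_inv; last exact: Cminus_eq_contra.
apply: (Rmult_lt_reg_r (Cmod (w - z))) => //.
rewrite Rmult_assoc Rinv_l; nra.
Qed.

(** * Mean value inequality for plane curves and the complex exponential *)

(** Project the curve onto the direction of its chord: the real mean value theorem for the
    projection and Cauchy--Schwarz give the bound. *)
Lemma cmvt (u v u' v' : R -> R) a b M : a <= b ->
  (forall t, a <= t <= b -> is_derive u t (u' t)) ->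
  (forall t, a <= t <= b -> is_derive v t (v' t)) ->
  (forall t, a <= t <= b -> Cmod (u' t, v' t) <= M) ->
  Cmod (u b - u a, v b - v a) <= M * (b - a).
Proof.
move=> Hab Hu Hv HM.
set p := u b - u a; set q := v b - v a.
have [Hz|Hz] := Req_dec (Cmod (p, q)) 0.
  rewrite Hz. have := HM a ltac:(lra). have := Cmod_ge_0 (u' a, v' a). nra.
have Hp : 0 < Cmod (p, q) by have := Cmod_ge_0 (p, q); lra.
have [c [Hc Hc2]] : exists c, a <= c <= b /\
   (p * u b + q * v b) - (p * u a + q * v a) = (p * u' c + q * v' c) * (b - a).
  have D : forall t, a <= t <= b ->
     is_derive (fun t => p * u t + q * v t) t (p * u' t + q * v' t).
    move=> t Ht; apply: (is_derive_plus (V := R_NormedModule)); apply: is_derive_scal; auto.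
  have El : Rmin a b = a by rewrite Rmin_left.
  have Er : Rmax a b = b by rewrite Rmax_right.
  have [|x Hx|c [Hc E]] := MVT_gen (fun t => p * u t + q * v t) a b (fun t => p * u' t + q * v' t).
  - by move=> x Hx; apply: D; lra.
  - apply/continuity_pt_filterlim; apply: (ex_derive_continuous (V := R_NormedModule)).
    by exists (p * u' x + q * v' x); apply: D; lra.
  by exists c; split => //; lra.
have E : Cmod (p, q) * Cmod (p, q) = (p * u' c + q * v' c) * (b - a).
  rewrite -Hc2 /Cmod sqrt_sqrt /=; last nra. rewrite /p /q; ring.
have CS : p * u' c + q * v' c <= Cmod (p, q) * Cmod (u' c, v' c).
  have := re_le_Cmod ((p, - q) * (u' c, v' c)).
  rewrite Cmod_mult /Re /=.
  have -> : Cmod (p, - q) = Cmod (p, q) by rewrite /Cmod /=; congr sqrt; ring.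
  have := Rle_abs (p * u' c - - q * v' c). lra.
have := HM c Hc. have Hm := Cmod_ge_0 (u' c, v' c) => HMc.
apply: (Rmult_le_reg_l (Cmod (p, q))) => //.
rewrite E.
have : (p * u' c + q * v' c) * (b - a) <= Cmod (p, q) * Cmod (u' c, v' c) * (b - a).
  apply: Rmult_le_compat_r; lra.
have : Cmod (p, q) * Cmod (u' c, v' c) * (b - a) <= Cmod (p, q) * (M * (b - a)).
  rewrite Rmult_assoc; apply: Rmult_le_compat_l; first lra. apply: Rmult_le_compat_r; lra.
lra.
Qed.

Lemma Cexp_plus a b : Cexp (a + b) = (Cexp a * Cexp b)%C.
Proof.
rewrite /Cexp; case: a => a1 a2; case: b => b1 b2.
rewrite /Re /Im /= exp_plus cos_plus sin_plus.
by apply: injective_projections => /=; ring.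
Qed.

Lemma Cmod_Cexp z : Cmod (Cexp z) = exp (Re z).
Proof.
rewrite /Cexp Cmod_mult Cmod_R Rabs_pos_eq; last exact: Rlt_le (exp_pos _).
have -> : Cmod (cos (Im z), sin (Im z)) = 1; last ring.
rewrite /Cmod /=.
have := sin2_cos2 (Im z); rewrite /Rsqr => H.
by rewrite (_ : _ + _ = 1) ?sqrt_1 //; nra.
Qed.

Lemma Cexp_0 : Cexp 0 = 1%C.
Proof.
rewrite /Cexp /Re /Im /= exp_0 cos_0 sin_0.
by apply: injective_projections => /=; ring.
Qed.

Lemma Cexp_lip h : Cmod h <= 1 -> Cmod (Cexp h - 1) <= 3 * Cmod h.
Proof.
case: h => x y Hh.
have H := cmvt (fun t => exp (t * x) * cos (t * y)) (fun t => exp (t * x) * sin (t * y))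
  (fun t => exp (t * x) * (x * cos (t * y) - y * sin (t * y)))
  (fun t => exp (t * x) * (x * sin (t * y) + y * cos (t * y))) 0 1 (3 * Cmod (x, y)).
move: H; rewrite !Rmult_1_l !Rmult_0_l exp_0 cos_0 sin_0 => H.
have -> : (Cexp (x, y) - 1)%C = (exp x * cos y - 1 * 1, exp x * sin y - 1 * 0).
  by rewrite /Cexp /Re /Im; apply: injective_projections => /=; ring.
have -> : 3 * Cmod (x, y) = 3 * Cmod (x, y) * (1 - 0) by ring.
apply: H; first lra.
- by move=> t _; auto_derive => //; ring.
- by move=> t _; auto_derive => //; ring.
move=> t Ht.
have -> : (exp (t * x) * (x * cos (t * y) - y * sin (t * y)),
   exp (t * x) * (x * sin (t * y) + y * cos (t * y))) = (Cexp (t * x, t * y)%R * (x, y))%C.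
  by rewrite /Cexp /Re /Im; apply: injective_projections => /=; ring.
rewrite Cmod_mult Cmod_Cexp /Re /=.
apply: Rmult_le_compat_r; first exact: Cmod_ge_0.
have Hx : Rabs x <= 1.
  have := re_le_Cmod (x, y); rewrite /Re /=; lra.
have {}Hx : -1 <= x <= 1 by move: Hx; rewrite /Rabs; case: Rcase_abs; lra.
have : exp (t * x) <= exp 1.
  have [E|E] := Rle_lt_or_eq_dec (t * x) 1 ltac:(nra).
    exact/Rlt_le/exp_increasing.
  by rewrite E; lra.
have := exp_le_3; lra.
Qed.

(** Along the segment from 0 to h the derivative of exp(th) - th is (exp(th) - 1) h, which
    [Cexp_lip] already makes quadratic in h. *)
Lemma Cexp_quad h : Cmod h <= 1 -> Cmod (Cexp h - 1 - h) <= 3 * (Cmod h * Cmod h).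
Proof.
case: h => x y Hh.
have H := cmvt (fun t => exp (t * x) * cos (t * y) - t * x) (fun t => exp (t * x) * sin (t * y) - t * y)
  (fun t => exp (t * x) * (x * cos (t * y) - y * sin (t * y)) - x)
  (fun t => exp (t * x) * (x * sin (t * y) + y * cos (t * y)) - y) 0 1 (3 * (Cmod (x, y) * Cmod (x, y))).
move: H; rewrite !Rmult_1_l !Rmult_0_l exp_0 cos_0 sin_0 => H.
have -> : (Cexp (x, y) - 1 - (x, y))%C = (exp x * cos y - x - (1 * 1 - 0), exp x * sin y - y - (1 * 0 - 0)).
  by rewrite /Cexp /Re /Im; apply: injective_projections => /=; ring.
have -> : 3 * (Cmod (x, y) * Cmod (x, y)) = 3 * (Cmod (x, y) * Cmod (x, y)) * (1 - 0) by ring.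
apply: H; first lra.
- by move=> t _; auto_derive => //; ring.
- by move=> t _; auto_derive => //; ring.
move=> t Ht.
have -> : (exp (t * x) * (x * cos (t * y) - y * sin (t * y)) - x,
   exp (t * x) * (x * sin (t * y) + y * cos (t * y)) - y) = ((Cexp (t * x, t * y)%R - 1) * (x, y))%C.
  by rewrite /Cexp /Re /Im; apply: injective_projections => /=; ring.
rewrite Cmod_mult -Rmult_assoc.
apply: Rmult_le_compat_r; first exact: Cmod_ge_0.
have E : Cmod ((t * x, t * y) : C) = t * Cmod (x, y).
  have -> : ((t * x, t * y) : C) = (RtoC t * (x, y))%C.
    by apply: injective_projections => /=; ring.
  by rewrite Cmod_mult Cmod_R Rabs_pos_eq //; lra.
have Hp := Cmod_ge_0 (x, y).
apply: Rle_trans (Cexp_lip _ _) _; rewrite E; nra.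
Qed.

Lemma cdiff_Cexp z : cdiff Cexp z.
Proof.
set q := fun w : C => if Ceq_dec w z then Cexp z else ((Cexp w - Cexp z) / (w - z))%C.
apply: (cdiff_intro _ _ q 1); first lra.
  move=> w _; rewrite /q; case: Ceq_dec => /= [E0|Hne]; first by rewrite E0; ring.
  by field; apply: Cminus_eq_contra.
move=> e He.
set K := Cmod (Cexp z).
have HK : 0 < K by rewrite /K Cmod_Cexp; exact: exp_pos.
exists (Rmin 1 (e / (3 * K))); split.
  apply: Rmin_glb_lt; first lra. apply: Rdiv_lt_0_compat; lra.
move=> w Hw.
have B1 := Rlt_le_trans _ _ _ Hw (Rmin_l _ _).
have B2 := Rlt_le_trans _ _ _ Hw (Rmin_r _ _).
rewrite /q; case: (Ceq_dec z z) => /= [_|//]; case: Ceq_dec => /= [E|Hne].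
  by replace (Cexp z - Cexp z)%C with (RtoC 0) by ring; rewrite Cmod_0.
have Hm := Cmod_sub_pos w z Hne.
have -> : Cexp w = (Cexp z * Cexp (w - z))%C by rewrite -Cexp_plus; congr Cexp; ring.
have -> : ((Cexp z * Cexp (w - z) - Cexp z) / (w - z) - Cexp z =
   Cexp z * (Cexp (w - z) - 1 - (w - z)) * / (w - z))%C.
  by field; apply: Cminus_eq_contra.
rewrite Cmod_mult Cmod_inv; last exact: Cminus_eq_contra.
apply: (Rmult_lt_reg_r (Cmod (w - z))) => //.
rewrite Rmult_assoc Rinv_l; last lra. rewrite Rmult_1_r (Cmod_mult (Cexp z)) -/K.
have Q := Cexp_quad (w - z) ltac:(lra).
have : Cmod (w - z) * (3 * K) < e.
  have -> : e = e / (3 * K) * (3 * K) by field; lra.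
  apply: Rmult_lt_compat_r; lra.
move=> H1.
have H2 := Rmult_le_compat_l _ _ _ (Rlt_le _ _ HK) Q.
have H3 := Rmult_lt_compat_r _ _ _ Hm H1.
lra.
Qed.

(** * Contour integrals over rectangles, Goursat's theorem, maximum principle *)

Definition is_CI (f : R -> C) (a b : R) (I : C) :=
  is_RInt (fun x => Re (f x)) a b (Re I) /\ is_RInt (fun x => Im (f x)) a b (Im I).

Definition CI (f : R -> C) (a b : R) : C :=
  (RInt (fun x => Re (f x)) a b, RInt (fun x => Im (f x)) a b).

Lemma is_CI_unique f a b I : is_CI f a b I -> CI f a b = I.
Proof.
move=> [H1 H2]; rewrite /CI (is_RInt_unique _ _ _ _ H1) (is_RInt_unique _ _ _ _ H2).
by case: I {H1 H2}.
Qed.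

Lemma im_le_Cmod c : Rabs (Im c) <= Cmod c.
Proof. by apply: Rle_trans (Rmax_Cmod c); exact: Rmax_r. Qed.

Lemma ccont_Re (g : R -> C) (f : C -> C) x : ccont f (g x) ->
  (forall e, 0 < e -> exists d, 0 < d /\ forall y, Rabs (y - x) < d -> Cmod (g y - g x) < e) ->
  continuous (fun x => Re (f (g x))) x /\ continuous (fun x => Im (f (g x))) x.
Proof.
move=> Hf Hg.
have K : forall e, 0 < e -> exists d, 0 < d /\ forall y, Rabs (y - x) < d ->
   Cmod (f (g y) - f (g x)) < e.
  move=> e /Hf [d [/Hg [d' [Hd' H']] H]]; exists d'; split=> // y /H'; exact: H.
split; apply/filterlim_locally => e; have [d [Hd H]] := K e (cond_pos e);
  exists (mkposreal d Hd) => y Hy; have Hy2 := H y Hy.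
- have := re_le_Cmod (f (g y) - f (g x))%C => H2.
  exact: Rle_lt_trans H2 Hy2.
have := im_le_Cmod (f (g y) - f (g x))%C => H2.
exact: Rle_lt_trans H2 Hy2.
Qed.

Lemma is_CI_curve (g : R -> C) (f : C -> C) a b : a <= b ->
  (forall x, a <= x <= b -> ccont f (g x)) ->
  (forall x e, 0 < e -> exists d, 0 < d /\ forall y, Rabs (y - x) < d -> Cmod (g y - g x) < e) ->
  is_CI (fun x => f (g x)) a b (CI (fun x => f (g x)) a b).
Proof.
move=> Hab Hf Hg.
have E : forall x, Rmin a b <= x <= Rmax a b -> ccont f (g x).
  by move=> x; rewrite Rmin_left ?Rmax_right //; exact: Hf.
split; rewrite /CI /=; apply: RInt_correct; apply: ex_RInt_continuous => x Hx;
  by have [H1 H2] := ccont_Re g f x (E x Hx) (Hg x).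
Qed.

Lemma hline_cont (c x e : R) : 0 < e -> exists d, 0 < d /\
  forall y, Rabs (y - x) < d -> Cmod (((y, c) : C) - (x, c)) < e.
Proof.
move=> He; exists e; split => // y Hy.
have -> : (((y, c) : C) - (x, c))%C = RtoC (y - x) by apply: injective_projections => /=; ring.
by rewrite Cmod_R.
Qed.

Lemma vline_cont (c x e : R) : 0 < e -> exists d, 0 < d /\
  forall y, Rabs (y - x) < d -> Cmod (((c, y) : C) - (c, x)) < e.
Proof.
move=> He; exists e; split => // y Hy.
have -> : (((c, y) : C) - (c, x))%C = (Ci * RtoC (y - x))%C by apply: injective_projections => /=; ring.
by rewrite Cmod_mult Cmod_Ci Cmod_R; lra.
Qed.

Lemma is_CI_plus f g a b I J : is_CI f a b I -> is_CI g a b J ->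
  is_CI (fun x => f x + g x)%C a b (I + J)%C.
Proof.
move=> [H1 H2] [H3 H4]; split; rewrite /Re /Im /=.
  exact: (is_RInt_plus (V := R_NormedModule) _ _ _ _ _ _ H1 H3).
exact: (is_RInt_plus (V := R_NormedModule) _ _ _ _ _ _ H2 H4).
Qed.

Lemma is_CI_scal k f a b I : is_CI f a b I -> is_CI (fun x => k * f x)%C a b (k * I)%C.
Proof.
move=> [H1 H2]; split; rewrite /Re /Im /=.
  apply: (is_RInt_minus (V := R_NormedModule));
  exact: (is_RInt_scal (V := R_NormedModule)).
apply: (is_RInt_plus (V := R_NormedModule));
  exact: (is_RInt_scal (V := R_NormedModule)).
Qed.

Lemma is_CI_Chasles f a b c I J : is_CI f a b I -> is_CI f b c J -> is_CI f a c (I + J)%C.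
Proof.
move=> [H1 H2] [H3 H4]; split; rewrite /Re /Im /=.
  exact: (is_RInt_Chasles (V := R_NormedModule) _ _ _ _ _ _ H1 H3).
exact: (is_RInt_Chasles (V := R_NormedModule) _ _ _ _ _ _ H2 H4).
Qed.

Lemma is_CI_ext f g a b I : a <= b -> (forall x, a <= x <= b -> f x = g x) -> is_CI f a b I -> is_CI g a b I.
Proof.
move=> Hab E [H1 H2]; split; [apply: is_RInt_ext H1|apply: is_RInt_ext H2] => x;
 rewrite Rmin_left ?Rmax_right // => Hx; rewrite E //; lra.
Qed.

(** Pairing the integral I with its own conjugate turns |I|^2 into one real integral, so splitting
    into real and imaginary parts costs no constant. *)
Lemma is_CI_norm f a b I M : a <= b -> is_CI f a b I ->
  (forall x, a <= x <= b -> Cmod (f x) <= M) -> Cmod I <= M * (b - a).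
Proof.
move=> Hab [H1 H2] HM.
have [Hz|Hz] := Req_dec (Cmod I) 0.
  have := HM a ltac:(lra); have := Cmod_ge_0 (f a); rewrite Hz; nra.
have Hp : 0 < Cmod I by have := Cmod_ge_0 I; lra.
have H : is_RInt (fun x => Re I * Re (f x) + Im I * Im (f x)) a b (Re I * Re I + Im I * Im I).
  by apply: (is_RInt_plus (V := R_NormedModule)); exact: (is_RInt_scal (V := R_NormedModule)).
have Hc : is_RInt (fun _ => Cmod I * M) a b ((b - a) * (Cmod I * M)).
  exact: (is_RInt_const (V := R_NormedModule)).
have L := is_RInt_le _ _ _ _ _ _ Hab H Hc.
apply: (Rmult_le_reg_l (Cmod I)) => //.
have E : Cmod I * Cmod I = Re I * Re I + Im I * Im I.
  have := Cmod2_alt I; rewrite /= !Rmult_1_r //.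
rewrite E; apply: Rle_trans (L _) _; last lra.
move=> x Hx.
have R1 := re_le_Cmod (Cconj I * f x).
rewrite Cmod_mult Cmod_conj in R1.
move: R1 (Rle_abs (Re (Cconj I * f x))).
have -> : Re (Cconj I * f x) = Re I * Re (f x) + Im I * Im (f x).
  by rewrite /Re /Im /Cconj /=; ring.
have := Rmult_le_compat_l _ _ _ (Rlt_le _ _ Hp) (HM x ltac:(lra)); lra.
Qed.

Definition rint f a b c d : C :=
  (CI (fun x => f (x, c)) a b + Ci * CI (fun y => f (b, y)) c d
   - CI (fun x => f (x, d)) a b - Ci * CI (fun y => f (a, y)) c d)%C.

Definition rcont f a b c d := forall x y, a <= x <= b -> c <= y <= d -> ccont f (x, y).

Section Rect.
Variables (f : C -> C) (a b c d : R).
Hypotheses (Hab : a <= b) (Hcd : c <= d) (Hf : rcont f a b c d).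

Lemma is_CI_h y : c <= y <= d -> is_CI (fun x => f (x, y)) a b (CI (fun x => f (x, y)) a b).
Proof.
move=> Hy; apply: (is_CI_curve (fun x => (x, y))) => //; first by move=> x Hx; apply: Hf.
exact: hline_cont.
Qed.

Lemma is_CI_v x : a <= x <= b -> is_CI (fun y => f (x, y)) c d (CI (fun y => f (x, y)) c d).
Proof.
move=> Hx; apply: (is_CI_curve (fun y => (x, y))) => //; first by move=> y Hy; apply: Hf.
exact: vline_cont.
Qed.

Lemma rint_norm M : (forall x y, a <= x <= b -> c <= y <= d -> Cmod (f (x, y)) <= M) ->
  Cmod (rint f a b c d) <= 2 * M * ((b - a) + (d - c)).
Proof.
move=> HM; rewrite /rint.
set I1 := CI _ a b; set I2 := CI _ c d; set I3 := CI _ a b; set I4 := CI _ c d.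
have B1 : Cmod I1 <= M * (b - a).
  by apply: (is_CI_norm _ _ _ _ _ Hab (is_CI_h c ltac:(lra))) => x Hx; apply: HM; lra.
have B3 : Cmod I3 <= M * (b - a).
  by apply: (is_CI_norm _ _ _ _ _ Hab (is_CI_h d ltac:(lra))) => x Hx; apply: HM; lra.
have B2 : Cmod I2 <= M * (d - c).
  by apply: (is_CI_norm _ _ _ _ _ Hcd (is_CI_v b ltac:(lra))) => x Hx; apply: HM; lra.
have B4 : Cmod I4 <= M * (d - c).
  by apply: (is_CI_norm _ _ _ _ _ Hcd (is_CI_v a ltac:(lra))) => x Hx; apply: HM; lra.
have T1 := Cmod_triangle (I1 + Ci * I2 - I3) (- (Ci * I4)).
have T2 := Cmod_triangle (I1 + Ci * I2) (- I3).
have T3 := Cmod_triangle I1 (Ci * I2).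
rewrite !Cmod_opp !Cmod_mult !Cmod_Ci in T1 T2 T3.
rewrite /Cminus in T1 T2 T3 *; lra.
Qed.
End Rect.

Lemma rcont_sub f a b c d a' b' c' d' : a <= a' -> b' <= b -> c <= c' -> d' <= d ->
  rcont f a b c d -> rcont f a' b' c' d'.
Proof. by move=> H1 H2 H3 H4 H x y Hx Hy; apply: H; lra. Qed.

Lemma rint_split_x f a m b c d : a <= m <= b -> c <= d -> rcont f a b c d ->
  (rint f a b c d = rint f a m c d + rint f m b c d)%C.
Proof.
move=> [H1 H2] Hcd Hf.
have Hl : rcont f a m c d by apply: rcont_sub Hf; lra.
have Hr : rcont f m b c d by apply: rcont_sub Hf; lra.
have E y : c <= y <= d -> CI (fun x => f (x, y)) a b = (CI (fun x => f (x, y)) a m + CI (fun x => f (x, y)) m b)%C.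
  move=> Hy; apply: is_CI_unique; apply: is_CI_Chasles.
    exact: (is_CI_h _ _ _ _ _ H1 Hl).
  exact: (is_CI_h _ _ _ _ _ H2 Hr).
rewrite /rint (E c) ?(E d); try lra. ring.
Qed.

Lemma rint_split_y f a b c m d : c <= m <= d -> a <= b -> rcont f a b c d ->
  (rint f a b c d = rint f a b c m + rint f a b m d)%C.
Proof.
move=> [H1 H2] Hab Hf.
have Hl : rcont f a b c m by apply: rcont_sub Hf; lra.
have Hr : rcont f a b m d by apply: rcont_sub Hf; lra.
have E x : a <= x <= b -> CI (fun y => f (x, y)) c d = (CI (fun y => f (x, y)) c m + CI (fun y => f (x, y)) m d)%C.
  move=> Hx; apply: is_CI_unique; apply: is_CI_Chasles.
    exact: (is_CI_v _ _ _ _ _ H1 Hl).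
  exact: (is_CI_v _ _ _ _ _ H2 Hr).
rewrite /rint (E a) ?(E b); try lra. ring.
Qed.

Lemma rint_plus f g a b c d : a <= b -> c <= d -> rcont f a b c d -> rcont g a b c d ->
  rint (fun z => f z + g z)%C a b c d = (rint f a b c d + rint g a b c d)%C.
Proof.
move=> H1 H2 Hf Hg; rewrite /rint.
have Eh y : c <= y <= d -> CI (fun x => f (x, y) + g (x, y))%C a b = (CI (fun x => f (x, y)) a b + CI (fun x => g (x, y)) a b)%C.
  move=> Hy; apply: is_CI_unique; apply: is_CI_plus.
    exact: (is_CI_h _ _ _ _ _ H1 Hf).
  exact: (is_CI_h _ _ _ _ _ H1 Hg).
have Ev x : a <= x <= b -> CI (fun y => f (x, y) + g (x, y))%C c d = (CI (fun y => f (x, y)) c d + CI (fun y => g (x, y)) c d)%C.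
  move=> Hx; apply: is_CI_unique; apply: is_CI_plus.
    exact: (is_CI_v _ _ _ _ _ H2 Hf).
  exact: (is_CI_v _ _ _ _ _ H2 Hg).
rewrite (Eh c) ?(Eh d) ?(Ev a) ?(Ev b); try lra. ring.
Qed.

(** The explicit case of Cauchy's theorem by which the first-order part of f drops out in
    [goursat]. *)
Lemma rint_affine p q a b c d : a <= b -> c <= d ->
  rint (fun z => p + q * z)%C a b c d = 0%C.
Proof.
move=> H1 H2; rewrite /rint.
have Eh y : CI (fun x => p + q * (x, y))%C a b = (p * (RtoC (b - a)) + q * ((b^2/2 - a^2/2)%R, (y * (b - a))%R))%C.
  apply: is_CI_unique; apply: is_CI_plus.
    split; rewrite /Re /Im /= ?Rmult_0_r ?Rminus_0_r ?Rplus_0_l.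
      by rewrite Rmult_comm; exact: (is_RInt_const (V := R_NormedModule)).
    by rewrite Rmult_comm; exact: (is_RInt_const (V := R_NormedModule)).
  apply: is_CI_scal; split; rewrite /Re /Im /=.
    apply: (is_RInt_derive (V := R_CompleteNormedModule) (fun x => x ^ 2 / 2)) => x _.
      by auto_derive => //; field.
    exact: continuous_id.
  by rewrite Rmult_comm; exact: (is_RInt_const (V := R_NormedModule)).
have Ev x : CI (fun y => p + q * (x, y))%C c d = (p * (RtoC (d - c)) + q * ((x * (d - c))%R, (d^2/2 - c^2/2)%R))%C.
  apply: is_CI_unique; apply: is_CI_plus.
    split; rewrite /Re /Im /= ?Rmult_0_r ?Rminus_0_r ?Rplus_0_l.
      by rewrite Rmult_comm; exact: (is_RInt_const (V := R_NormedModule)).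
    by rewrite Rmult_comm; exact: (is_RInt_const (V := R_NormedModule)).
  apply: is_CI_scal; split; rewrite /Re /Im /=.
    by rewrite Rmult_comm; exact: (is_RInt_const (V := R_NormedModule)).
  apply: (is_RInt_derive (V := R_CompleteNormedModule) (fun x => x ^ 2 / 2)) => y _.
    by auto_derive => //; field.
  exact: continuous_id.
rewrite !Eh !Ev; clear; case: p => p1 p2; case: q => q1 q2.
by apply: injective_projections => /=; field.
Qed.

(** Bisection: some quarter of a rectangle carries at least a quarter of the boundary integral. The
    nested quarters shrink to a point z0; there, after subtraction of the affine approximation, the
    integral is o(side^2), against the lower bound I0 / 4^n. *)
Lemma goursat f a b c d : a <= b -> c <= d ->
  (forall x y, a <= x <= b -> c <= y <= d -> cdiff f (x, y)) -> rint f a b c d = 0%C.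
Proof.
move=> Hab Hcd Hd.
have Hf : rcont f a b c d by move=> x y Hx Hy; apply: cdiff_ccont; apply: Hd.
set w := b - a; set h := d - c.
set I0 := Cmod (rint f a b c d).
apply: Cmod_eq_0; rewrite -/I0.
have [//|Hne] := Req_dec I0 0.
have HI : 0 < I0 by have := Cmod_ge_0 (rint f a b c d); rewrite -/I0; lra.
exfalso.
have Hw : 0 <= w by rewrite /w; lra.
have Hh : 0 <= h by rewrite /h; lra.
have P2 n : 0 < / 2 ^ n by apply: Rinv_0_lt_compat; apply: pow_lt; lra.
have P2S n : / 2 ^ n = 2 * / 2 ^ n.+1 by rewrite /=; field; apply: pow_nonzero; lra.
pose P n (p : R * R) := a <= fst p /\ fst p + w * / 2 ^ n <= b /\
  c <= snd p /\ snd p + h * / 2 ^ n <= d /\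
  I0 * (/ 2 ^ n * / 2 ^ n) <=
    Cmod (rint f (fst p) (fst p + w * / 2 ^ n) (snd p) (snd p + h * / 2 ^ n)).
have Hstep n p : P n p -> exists p', P n.+1 p' /\
   fst p <= fst p' /\ fst p' + w * / 2 ^ n.+1 <= fst p + w * / 2 ^ n /\
   snd p <= snd p' /\ snd p' + h * / 2 ^ n.+1 <= snd p + h * / 2 ^ n.
  case: p => x y; rewrite /P /= -/(2 ^ n.+1) => -[A1 [A2 [A3 [A4 A5]]]].
  have := P2 n.+1; move: A2 A4 A5; rewrite (P2S n); set k := / 2 ^ n.+1 => A2 A4 A5 Hk.
  have Hwk : 0 <= w * k by apply: Rmult_le_pos; lra.
  have Hhk : 0 <= h * k by apply: Rmult_le_pos; lra.
  have C0 : rcont f x (x + w * (2 * k)) y (y + h * (2 * k)) by apply: rcont_sub Hf; lra.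
  have E : (rint f x (x + w * (2 * k)) y (y + h * (2 * k)) =
      (rint f x (x + w * k) y (y + h * k) + rint f x (x + w * k) (y + h * k) (y + h * k + h * k)) +
      (rint f (x + w * k) (x + w * k + w * k) y (y + h * k) +
       rint f (x + w * k) (x + w * k + w * k) (y + h * k) (y + h * k + h * k)))%C.
    have Ex : x + w * (2 * k) = x + w * k + w * k by ring.
    have Ey : y + h * (2 * k) = y + h * k + h * k by ring.
    rewrite Ex Ey in C0 *.
    rewrite (rint_split_x f x (x + w * k)) //; try lra.
    rewrite (rint_split_y f x _ y (y + h * k)) //; try lra; last by apply: rcont_sub C0; lra.
    rewrite (rint_split_y f (x + w * k) _ y (y + h * k)) //; try lra; last by apply: rcont_sub C0; lra.
  move: A5; rewrite E.
  set r1 := rint f x _ y _; set r2 := rint f x _ _ _; set r3 := rint f _ _ y _; set r4 := rint _ _ _ _ _.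
  move=> A5.
  have T1 := Cmod_triangle (r1 + r2) (r3 + r4).
  have T2 := Cmod_triangle r1 r2. have T3 := Cmod_triangle r3 r4.
  have [B1|B1] := Rle_dec (I0 * (k * k)) (Cmod r1).
    by exists (x, y) => /=; rewrite -/k; repeat split; try lra.
  have [B2|B2] := Rle_dec (I0 * (k * k)) (Cmod r2).
    by exists (x, y + h * k) => /=; rewrite -/k; repeat split; try lra.
  have [B3|B3] := Rle_dec (I0 * (k * k)) (Cmod r3).
    by exists (x + w * k, y) => /=; rewrite -/k; repeat split; try lra.
  have [B4|B4] := Rle_dec (I0 * (k * k)) (Cmod r4).
    by exists (x + w * k, y + h * k) => /=; rewrite -/k; repeat split; try lra.
  exfalso; lra.
have H0 : P O (a, c).
  rewrite /P /= Rinv_1 !Rmult_1_r.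
  have -> : a + w = b by rewrite /w; ring. have -> : c + h = d by rewrite /h; ring.
  by rewrite -/I0; repeat split; lra.
(* Dependent choice: each corner is stored with its proof of [P], from which the next quarter is
   selected. *)
pose sq := fix sq (n : nat) : {p | P n p} := match n with
  | O => exist _ (a, c) H0
  | S m => let (p, Hp) := sq m in
      let (p', H') := constructive_indefinite_description _ (Hstep m p Hp) in
      exist _ p' (proj1 H') end.
pose X n := fst (proj1_sig (sq n)); pose Y n := snd (proj1_sig (sq n)).
have HP n : P n (X n, Y n) by rewrite /X /Y; case: (sq n) => -[x y].
have HS n : X n <= X n.+1 /\ X n.+1 + w * / 2 ^ n.+1 <= X n + w * / 2 ^ n /\
   Y n <= Y n.+1 /\ Y n.+1 + h * / 2 ^ n.+1 <= Y n + h * / 2 ^ n.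
  rewrite /X /Y [sq n.+1]/=; case: (sq n) => p Hp /=.
  by case: constructive_indefinite_description => p' [? ?].
clearbody X Y; clear sq.
have nest (Z : nat -> R) (l : R) : 0 <= l ->
   (forall n, Z n <= Z n.+1 /\ Z n.+1 + l * / 2 ^ n.+1 <= Z n + l * / 2 ^ n) ->
   exists z, forall n, Z n <= z <= Z n + l * / 2 ^ n.
  move=> Hl HZ.
  have mono n k : Z n <= Z (n + k)%N /\ Z (n + k)%N + l * / 2 ^ (n + k) <= Z n + l * / 2 ^ n.
    elim: k => [|k [IH1 IH2]]; first by rewrite addn0; lra.
    rewrite addnS; have := HZ (n + k)%N; lra.
  have le n m : Z m <= Z n + l * / 2 ^ n.
    have Hp j : 0 <= l * / 2 ^ j by apply: Rmult_le_pos => //; have := P2 j; lra.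
    case: (leqP n m) => H.
      have := mono n (m - n)%N; rewrite subnKC //; have := Hp m; lra.
    have := mono m (n - m)%N; rewrite subnKC 1?ltnW //; have := Hp n; lra.
  have Hb : bound (fun z => exists n, z = Z n).
    by exists (Z 0%N + l * / 2 ^ 0) => _ [m ->]; exact: (le 0%N m).
  have [z [Hz1 Hz2]] := completeness _ Hb (ex_intro _ (Z 0%N) (ex_intro _ 0%N erefl)).
  exists z => n; split; first by apply: Hz1; exists n.
  by apply: Hz2 => _ [m ->].
have [x0 Hx0] := nest X w Hw (fun n => conj (proj1 (HS n)) (proj1 (proj2 (HS n)))).
have [y0 Hy0] := nest Y h Hh (fun n => proj2 (proj2 (HS n))).
have Hin : a <= x0 <= b /\ c <= y0 <= d.
  have := HP O; rewrite /P /=; have := Hx0 O; have := Hy0 O; rewrite /=; lra.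
have [q [Hq Hqc]] := Hd x0 y0 (proj1 Hin) (proj2 Hin).
set z0 := ((x0, y0) : C) in Hq Hqc.
set S := w + h + 1.
have HSp : 0 < S by rewrite /S; lra.
(* With this tolerance the bound from [rint_norm] is half of I0 k^2, the lower bound recorded in
   [P]. *)
have He : 0 < I0 / (4 * (S * S)).
  apply: Rdiv_lt_0_compat => //; nra.
set e := I0 / (4 * (S * S)) in He.
have [dl [Hdl Hdl2]] := Hqc e He.
have [n Hn] : exists n, S * / 2 ^ n < dl.
  have H2 : Rabs (/ 2) < 1 by rewrite Rabs_pos_eq; lra.
  have [N HN] := pow_lt_1_zero (/ 2) H2 (dl / S) ltac:(apply: Rdiv_lt_0_compat; lra).
  exists N; have := HN N (le_n N); rewrite pow_inv Rabs_pos_eq; last by have := P2 N; lra.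
  move=> H; have -> : dl = S * (dl / S) by field; lra.
  by apply: Rmult_lt_compat_l.
have := HP n; rewrite /P /=; set k := / 2 ^ n in Hn *.
have Hk : 0 < k by exact: P2.
have := Hx0 n; have := Hy0 n; rewrite -/k => Hyn Hxn [A1 [A2 [A3 [A4 A5]]]].
have Hwk : 0 <= w * k by apply: Rmult_le_pos; lra.
have Hhk : 0 <= h * k by apply: Rmult_le_pos; lra.
have HC : rcont f (X n) (X n + w * k) (Y n) (Y n + h * k) by apply: rcont_sub Hf; lra.
pose g := fun z => (f z - (f z0 - q z0 * z0 + q z0 * z))%C.
have Caff p r z : ccont (fun z => p + r * z)%C z.
  by apply: ccont_plus; [exact: ccont_const|apply: ccont_mult; [exact: ccont_const|exact: ccont_id]].
have HCg : rcont g (X n) (X n + w * k) (Y n) (Y n + h * k).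
  move=> x y Hx Hy; rewrite /g /Cminus; apply: ccont_plus; first exact: HC.
  have := Caff (- (f z0 - q z0 * z0))%C (- q z0)%C (x, y).
  apply: (ccont_ext_near _ _ _ 1); first lra.
  by move=> z _; ring.
have Ef : f = (fun z => g z + ((f z0 - q z0 * z0) + q z0 * z))%C.
  by apply: functional_extensionality => z; rewrite /g; ring.
have E : rint f (X n) (X n + w * k) (Y n) (Y n + h * k) =
   rint g (X n) (X n + w * k) (Y n) (Y n + h * k).
  rewrite {1}Ef rint_plus; try lra; last 2 first.
  - exact: HCg.
  - by move=> x y _ _; exact: Caff.
  by rewrite rint_affine; [ring|lra|lra].
have Hg : forall x y, X n <= x <= X n + w * k -> Y n <= y <= Y n + h * k ->
   Cmod (g (x, y)) <= e * (S * k).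
  move=> x y Hx Hy.
  have -> : g (x, y) = ((q (x, y) - q z0) * ((x, y) - z0))%C.
    rewrite /g; have -> : f (x, y) = (f z0 + q (x, y) * ((x, y) - z0))%C by rewrite -Hq; ring.
    ring.
  have D : Cmod ((x, y) - z0) <= S * k.
    have -> : ((x, y) - z0)%C = (RtoC (x - x0) + Ci * RtoC (y - y0))%C.
      by apply: injective_projections => /=; ring.
    apply: Rle_trans (Cmod_triangle _ _) _.
    rewrite Cmod_mult Cmod_Ci !Cmod_R.
    have : Rabs (x - x0) <= w * k by apply: Rabs_le; lra.
    have : Rabs (y - y0) <= h * k by apply: Rabs_le; lra.
    rewrite /S; lra.
  rewrite Cmod_mult; apply: Rmult_le_compat; try exact: Cmod_ge_0; last exact: D.
  by apply: Rlt_le; apply: Hdl2; lra.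
have := rint_norm g (X n) (X n + w * k) (Y n) (Y n + h * k) ltac:(lra) ltac:(lra) HCg _ Hg.
rewrite -E => B.
have HSk : (X n + w * k - X n + (Y n + h * k - Y n)) <= S * k by rewrite /S; lra.
have HeS : 0 < e * (S * k) by apply: Rmult_lt_0_compat => //; apply: Rmult_lt_0_compat.
have B2 := Rmult_le_compat_l (2 * (e * (S * k))) _ _ ltac:(lra) HSk.
have Ee : 2 * (e * (S * k)) * (S * k) = I0 * (k * k) / 2 by rewrite /e; field; lra.
have : 0 < I0 * (k * k) by apply: Rmult_lt_0_compat => //; apply: Rmult_lt_0_compat.
lra.
Qed.

(** Goursat for w -> f(z + exp w) on a rectangle of height 2 pi: the horizontal sides cancel by
    periodicity, so the means over the circles of radii r and r0 agree, and for small r0 the mean is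
    close to f(z). *)
Lemma circle_max f z r K : 0 < r ->
  (forall w, Cmod (w - z) <= r -> cdiff f w) ->
  (forall th, 0 <= th <= 2 * PI -> Cmod (f (z + RtoC r * Cexp (Ci * RtoC th))%C) <= K) ->
  Cmod (f z) <= K.
Proof.
move=> Hr Hd HK.
apply: le_epsilon => e He.
have [d [Hd0 Hdl]] := cdiff_ccont f z (Hd z ltac:(replace (z - z)%C with (RtoC 0) by ring; rewrite Cmod_0; lra)) e He.
set r0 := Rmin r d / 2.
have Hm : 0 < Rmin r d by apply: Rmin_glb_lt.
have Hr0 : 0 < r0 by rewrite /r0; lra.
have Hr0r : r0 < r by have := Rmin_l r d; rewrite /r0; lra.
have Hr0d : r0 < d by have := Rmin_r r d; rewrite /r0; lra.
pose F := fun w => f (z + Cexp w)%C.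
have Hln : ln r0 <= ln r by apply/Rlt_le/ln_increasing.
have HPI := PI_RGT_0.
have FD x y : x <= ln r -> cdiff F (x, y).
  move=> Hx; apply: (cdiff_comp f (fun w => z + Cexp w)%C).
    by apply: cdiff_plus; [exact: cdiff_const|exact: cdiff_Cexp].
  apply: Hd; replace (z + Cexp (x, y) - z)%C with (Cexp (x, y)) by ring.
  rewrite Cmod_Cexp /Re /=; rewrite -[r]exp_ln //.
  by have [H|->] := Rle_lt_or_eq_dec _ _ Hx; [apply/Rlt_le/exp_increasing|lra].
have G := goursat F (ln r0) (ln r) 0 (2 * PI) Hln ltac:(lra) (fun x y Hx _ => FD x y (proj2 Hx)).
have per x : F (x, 0) = F (x, 2 * PI).
  by rewrite /F /Cexp /Re /Im /= cos_2PI sin_2PI cos_0 sin_0.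
have E : CI (fun y => F (ln r, y)) 0 (2 * PI) = CI (fun y => F (ln r0, y)) 0 (2 * PI).
  move: G; rewrite /rint.
  have -> : (fun x => F (x, 2 * PI)) = (fun x => F (x, 0)) by apply: functional_extensionality => x; rewrite per.
  set A := CI _ 0 _; set B := CI _ (ln r0) _; set D := CI _ 0 _ => G.
  have : (Ci * (A - D) = 0)%C by rewrite -G; ring.
  move=> H; have : (- Ci * (Ci * (A - D)) = 0)%C by rewrite H; ring.
  replace (- Ci * (Ci * (A - D)))%C with (A - D)%C; last first.
    by apply: injective_projections => /=; ring.
  by move=> HAD; apply: (proj2 (Ceq_minus A D)) HAD.
have pol x y : (z + Cexp (ln x, y))%C = (z + RtoC (exp (ln x)) * Cexp (Ci * RtoC y))%C.
  congr (_ + _)%C; rewrite /Cexp /Re /Im /=.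
  have -> : 0 * y - 1 * 0 = 0 by ring. have -> : 0 * 0 + 1 * y = y by ring.
  rewrite exp_0; ring.
have CV x : x <= ln r -> is_CI (fun y => F (x, y)) 0 (2 * PI) (CI (fun y => F (x, y)) 0 (2 * PI)).
  move=> Hx; apply: (is_CI_curve (fun y => (x, y)) F); first lra.
    by move=> y _; apply: cdiff_ccont; exact: FD.
  exact: vline_cont.
have B1 : Cmod (CI (fun y => F (ln r, y)) 0 (2 * PI)) <= K * (2 * PI - 0).
  apply: is_CI_norm (CV (ln r) ltac:(lra)) _; first lra.
  by move=> y Hy; rewrite /F pol exp_ln //; exact: HK.
have HCf : is_CI (fun _ => - f z)%C 0 (2 * PI) (RtoC (2 * PI) * (- f z))%C.
  split; rewrite /Re /Im /=.
    replace (2 * PI * - fst (f z) - 0 * - snd (f z)) with ((2 * PI - 0) * (- fst (f z))) by ring.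
    exact: (is_RInt_const (V := R_NormedModule)).
  replace (2 * PI * - snd (f z) + 0 * - fst (f z)) with ((2 * PI - 0) * (- snd (f z))) by ring.
  exact: (is_RInt_const (V := R_NormedModule)).
have H2PI : 0 <= 2 * PI by lra.
have B2 := is_CI_norm _ _ _ _ e H2PI (is_CI_plus _ _ _ _ _ _ (CV (ln r0) ltac:(lra)) HCf).
have {}B2 : Cmod (CI (fun y => F (ln r0, y)) 0 (2 * PI) + RtoC (2 * PI) * (- f z)) <= e * (2 * PI - 0).
  apply: B2 => y _.
  replace (F (ln r0, y) + - f z)%C with (F (ln r0, y) - f z)%C by ring.
  apply: Rlt_le; apply: Hdl.
  replace (z + Cexp (ln r0, y) - z)%C with (Cexp (ln r0, y)) by ring.
  by rewrite Cmod_Cexp /Re /= exp_ln.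
rewrite -E in B2.
set I := CI _ _ _ in B1 B2.
have := Cmod_triangle I (- (I + RtoC (2 * PI) * (- f z))).
rewrite Cmod_opp.
replace (I + - (I + RtoC (2 * PI) * - f z))%C with (RtoC (2 * PI) * f z)%C by ring.
rewrite Cmod_mult Cmod_R Rabs_pos_eq; last lra.
move=> T; apply: (Rmult_le_reg_l (2 * PI)); first lra.
lra.
Qed.

(** * Euler--Maclaurin approximation of zeta and its continuation to the critical line *)

Definition cpow (u : R) (w : C) : C := Cexp (w * RtoC (ln u)).

Definition is_cder (f : R -> C) (t : R) (l : C) :=
  is_derive (fun u => Re (f u)) t (Re l) /\ is_derive (fun u => Im (f u)) t (Im l).

Lemma is_cder_mvt f f' a b M : a <= b -> (forall t, a <= t <= b -> is_cder f t (f' t)) ->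
  (forall t, a <= t <= b -> Cmod (f' t) <= M) -> Cmod (f b - f a) <= M * (b - a).
Proof.
move=> Hab H HM.
have := cmvt (fun u => Re (f u)) (fun u => Im (f u)) (fun u => Re (f' u)) (fun u => Im (f' u)) a b M Hab
  (fun t Ht => proj1 (H t Ht)) (fun t Ht => proj2 (H t Ht)).
have -> : (Re (f b) - Re (f a), Im (f b) - Im (f a)) = (f b - f a)%C by [].
apply=> t Ht; have := HM t Ht; by case: (f' t).
Qed.

Lemma is_cder_const c t : is_cder (fun _ => c) t 0%C.
Proof. by split; exact: is_derive_const. Qed.

Lemma is_cder_plus f g t l m : is_cder f t l -> is_cder g t m -> is_cder (fun u => f u + g u)%C t (l + m)%C.
Proof.
by move=> [H1 H2] [H3 H4]; split; apply: (is_derive_plus (V := R_NormedModule)).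
Qed.

Lemma is_cder_scal k f t l : is_cder f t l -> is_cder (fun u => k * f u)%C t (k * l)%C.
Proof.
move=> [H1 H2]; split; rewrite /Re /Im /=.
  by apply: (is_derive_minus (V := R_NormedModule)); apply: is_derive_scal.
by apply: (is_derive_plus (V := R_NormedModule)); apply: is_derive_scal.
Qed.

Lemma is_cder_RtoC t : is_cder (fun u => RtoC u) t 1%C.
Proof. by split; rewrite /Re /Im /=; [exact: is_derive_id|exact: is_derive_const]. Qed.

Lemma is_cder_cpow w t : 0 < t -> is_cder (fun u => cpow u w) t (w * cpow t w * RtoC (/ t))%C.
Proof.
move=> Ht; case: w => a b; rewrite /cpow /Cexp /Re /Im; split.
  apply: (is_derive_ext (fun u => exp (a * ln u) * cos (b * ln u))).
    by move=> u /=; rewrite !Rmult_0_r !Rminus_0_r Rplus_0_l Rmult_0_l Rminus_0_r.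
  auto_derive; first by [].
  rewrite /= !Rmult_0_r !Rminus_0_r !Rplus_0_l !Rmult_0_l. field; lra.
apply: (is_derive_ext (fun u => exp (a * ln u) * sin (b * ln u))).
  by move=> u /=; rewrite !Rmult_0_r !Rminus_0_r Rplus_0_l Rmult_0_l Rplus_0_r.
auto_derive; first by [].
rewrite /= !Rmult_0_r !Rminus_0_r !Rplus_0_l !Rmult_0_l. field; lra.
Qed.

Lemma Cmod_cpow u w : Cmod (cpow u w) = exp (Re w * ln u).
Proof. by rewrite /cpow Cmod_Cexp /Re /Im /=; f_equal; ring. Qed.

Lemma cpow_plus u v w : cpow u (v + w) = (cpow u v * cpow u w)%C.
Proof. by rewrite /cpow -Cexp_plus; f_equal; ring. Qed.

Lemma cpow_1 u : 0 < u -> cpow u 1%C = RtoC u.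
Proof.
move=> Hu; rewrite /cpow /Cexp /Re /Im /= !Rmult_0_l Rmult_1_l Rmult_0_r Rminus_0_r Rplus_0_r exp_ln //.
by rewrite cos_0 sin_0; apply: injective_projections => /=; ring.
Qed.

Lemma cpow_base1 w : cpow 1 w = 1%C.
Proof. by rewrite /cpow ln_1 Cmult_0_r Cexp_0. Qed.

Lemma dirichlet_cpow s n : dirichlet_term s n = cpow (INR n) (- s)%C.
Proof. by []. Qed.

(* The n-th Euler--Maclaurin defect [n^(-s) - int_n^(n+1) u^(-s) du]. *)
Definition em_term (s : C) (n : nat) : C :=
  (dirichlet_term s n - (cpow (INR n.+1) (1 - s) - cpow (INR n) (1 - s)) / (1 - s))%C.

Lemma ne1_sub (s : C) : s <> RtoC 1 -> (1 - s)%C <> RtoC 0.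
Proof. by move=> H; apply: Cminus_eq_contra => E; apply: H. Qed.

(** The defect is the integral over [n, n+1] of n^(-s) - u^(-s), and the integrand is at most |s|
    n^(-Re s - 1) by the mean value inequality. Instead of forming the integral, the inequality is
    used a second time, on u n^(-s) - u^(1-s)/(1-s). *)
Lemma em_term_bound s n : (0 < n)%N -> s <> RtoC 1 -> 0 < Re s ->
  Cmod (em_term s n) <= Cmod s * (exp (- Re s * ln (INR n)) * / INR n).
Proof.
move=> Hn Hs1 Hs.
have Hn0 : 0 < INR n by apply: lt_0_INR; lia.
have Hs1' := ne1_sub s Hs1.
set K := Cmod s * _.
have HK : 0 <= K.
  apply: Rmult_le_pos; first exact: Cmod_ge_0.
  apply: Rmult_le_pos; [exact/Rlt_le/exp_pos|exact/Rlt_le/Rinv_0_lt_compat].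
have St u : INR n <= u <= INR n.+1 -> Cmod (cpow u (- s) - cpow (INR n) (- s)) <= K.
  rewrite S_INR => Hu.
  apply: Rle_trans (is_cder_mvt (fun u => cpow u (- s)) (fun t => - s * cpow t (- s) * RtoC (/ t))%C (INR n) u K _ _ _) _.
  - lra.
  - by move=> t Ht; apply: is_cder_cpow; lra.
  - move=> t Ht; rewrite Cmod_mult (Cmod_mult (- s)) Cmod_opp Cmod_cpow Cmod_R /K Rmult_assoc.
    apply: Rmult_le_compat_l; first exact: Cmod_ge_0.
    have Ht0 : 0 < t by lra.
    rewrite Rabs_pos_eq; last exact/Rlt_le/Rinv_0_lt_compat.
    apply: Rmult_le_compat.
    + exact/Rlt_le/exp_pos.
    + exact/Rlt_le/Rinv_0_lt_compat.
    + have -> : Re (- s) = - Re s by [].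
      have L : ln (INR n) <= ln t by apply: ln_le; lra.
      have [E|E] := Rle_lt_or_eq_dec (- Re s * ln t) (- Re s * ln (INR n)) ltac:(nra).
        exact/Rlt_le/exp_increasing.
      by rewrite E; lra.
    + by apply: Rinv_le_contravar; lra.
  - nra.
have := is_cder_mvt (fun u => RtoC u * cpow (INR n) (- s) + (- / (1 - s)) * cpow u (1 - s))%C
  (fun u => cpow (INR n) (- s) - cpow u (- s))%C (INR n) (INR n.+1) K.
have -> : em_term s n = ((RtoC (INR n.+1) * cpow (INR n) (- s) + (- / (1 - s)) * cpow (INR n.+1) (1 - s)) -
   (RtoC (INR n) * cpow (INR n) (- s) + (- / (1 - s)) * cpow (INR n) (1 - s)))%C.
  rewrite /em_term dirichlet_cpow S_INR RtoC_plus; field; exact: Hs1'.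
rewrite S_INR => H.
have EK : K = K * (INR n + 1 - INR n) by ring.
rewrite [X in _ <= X]EK.
apply: H; first lra.
- move=> t Ht.
  have -> : (cpow (INR n) (- s) - cpow t (- s))%C =
     (cpow (INR n) (- s) * 1 + (- / (1 - s)) * ((1 - s) * cpow t (1 - s) * RtoC (/ t)))%C.
    have -> : cpow t (1 - s) = (RtoC t * cpow t (- s))%C.
      rewrite -(cpow_1 t) ?cpow_plus -?cpow_plus //; lra.
    rewrite RtoC_inv; last lra.
    field; split => //; move=> E; have := RtoC_inj _ _ E; lra.
  apply: is_cder_plus.
    have H1 := is_cder_scal (cpow (INR n) (- s)) _ _ _ (is_cder_RtoC t).
    by case: H1 => H2 H3; split; [apply: is_derive_ext H2|apply: is_derive_ext H3] => u; rewrite Cmult_comm.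
  by apply: is_cder_scal; apply: is_cder_cpow; lra.
move=> t Ht; have := St t; rewrite S_INR => /(_ Ht).
by rewrite -Cmod_opp; congr (Cmod _ <= _); ring.
Qed.

(** Comparison with the integral of u^(-sg-1) over the preceding unit interval, in telescoping
    form. *)
Lemma power_tail sg n : 0 < sg -> (0 < n)%N ->
  exp (- sg * ln (INR n.+1)) * / INR n.+1 <=
  / sg * (exp (- sg * ln (INR n)) - exp (- sg * ln (INR n.+1))).
Proof.
move=> Hs Hn.
have Hn0 : 0 < INR n by apply: lt_0_INR; lia.
have Hd t : 0 < t -> is_derive (fun u => - / sg * exp (- sg * ln u)) t (exp (- sg * ln t) * / t).
  by move=> Ht; auto_derive => //; field; lra.
have El : Rmin (INR n) (INR n.+1) = INR n by rewrite Rmin_left // S_INR; lra.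
have Er : Rmax (INR n) (INR n.+1) = INR n.+1 by rewrite Rmax_right // S_INR; lra.
have [|x Hx|c [Hc E]] := MVT_gen (fun u => - / sg * exp (- sg * ln u)) (INR n) (INR n.+1) (fun t => exp (- sg * ln t) * / t).
- by move=> x Hx; apply: Hd; lra.
- apply/continuity_pt_filterlim; apply: (ex_derive_continuous (V := R_NormedModule)).
  by eexists; apply: Hd; lra.
rewrite El Er in Hc.
have Ed : INR n.+1 - INR n = 1 by rewrite S_INR; ring.
rewrite Ed Rmult_1_r in E.
have -> : / sg * (exp (- sg * ln (INR n)) - exp (- sg * ln (INR n.+1))) = exp (- sg * ln c) * / c by rewrite -E; ring.
have Hc0 : 0 < c by lra.
apply: Rmult_le_compat.
+ exact/Rlt_le/exp_pos.
+ by apply/Rlt_le/Rinv_0_lt_compat; lra.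
+ have L : ln c <= ln (INR n.+1) by apply: ln_le; lra.
  have [E2|E2] := Rle_lt_or_eq_dec (- sg * ln (INR n.+1)) (- sg * ln c) ltac:(nra).
    exact/Rlt_le/exp_increasing.
  by rewrite E2; lra.
by apply: Rinv_le_contravar; lra.
Qed.

Fixpoint em_sum (s : C) (X : nat) : C :=
  match X with O => 0%C | S Y => (em_sum s Y + em_term s Y.+1)%C end.

Lemma em_sum_tail s X Y : (0 < X)%N -> (X <= Y)%N -> s <> RtoC 1 -> 0 < Re s ->
  Cmod (em_sum s Y - em_sum s X) <=
  Cmod s / Re s * (exp (- Re s * ln (INR X)) - exp (- Re s * ln (INR Y))).
Proof.
move=> HX HXY Hs1 Hs.
have -> : Y = (X + (Y - X))%N by rewrite subnKC.
elim: (Y - X)%N => [|k IH].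
  rewrite addn0; replace (em_sum s X - em_sum s X)%C with (RtoC 0) by ring.
  rewrite Cmod_0; lra.
rewrite addnS /=.
replace (em_sum s (X + k) + em_term s (X + k).+1 - em_sum s X)%C with
  ((em_sum s (X + k) - em_sum s X) + em_term s (X + k).+1)%C by ring.
apply: Rle_trans (Cmod_triangle _ _) _.
have B := em_term_bound s (X + k).+1 isT Hs1 Hs.
have T := power_tail (Re s) (X + k) Hs ltac:(lia).
have := Rmult_le_compat_l _ _ _ (Cmod_ge_0 s) T.
rewrite -/(INR (X + k).+1) /Rdiv in IH B T *. lra.
Qed.

Lemma em_sum_tail_le s X Y : (0 < X)%N -> (X <= Y)%N -> s <> RtoC 1 -> 0 < Re s ->
  Cmod (em_sum s Y - em_sum s X) <= Cmod s / Re s * exp (- Re s * ln (INR X)).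
Proof.
move=> HX HXY Hs1 Hs; apply: Rle_trans (em_sum_tail s X Y HX HXY Hs1 Hs) _.
apply: Rmult_le_compat_l.
  by apply: Rmult_le_pos; [exact: Cmod_ge_0|apply/Rlt_le/Rinv_0_lt_compat].
have := exp_pos (- Re s * ln (INR Y)); lra.
Qed.

(** Uniform in the length X; this is the trivial bound used at ordinates where nothing is assumed
    about zeta. *)
Lemma em_sum_bound s X : s <> RtoC 1 -> 0 < Re s ->
  Cmod (em_sum s X) <= Cmod s * (1 + / Re s).
Proof.
move=> Hs1 Hs.
have HC := Cmod_ge_0 s. have HI := Rinv_0_lt_compat _ Hs.
have B1 : Cmod (em_sum s 1) <= Cmod s.
  rewrite /= Cplus_0_l; have := em_term_bound s 1 isT Hs1 Hs.
  rewrite /= ln_1 Rmult_0_r exp_0; lra.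
case: X => [|X]; first by rewrite /= Cmod_0; nra.
have := em_sum_tail_le s 1 X.+1 isT isT Hs1 Hs.
rewrite [INR 1]/= ln_1 Rmult_0_r exp_0 Rmult_1_r /Rdiv => B2.
have := Cmod_triangle (em_sum s X.+1 - em_sum s 1) (em_sum s 1).
replace (em_sum s X.+1 - em_sum s 1 + em_sum s 1)%C with (em_sum s X.+1) by ring.
lra.
Qed.

(** [sum_n] runs over the indices 0..X, hence over n = 1..X+1, so the last term is taken back. *)
Lemma em_sumE s X : s <> RtoC 1 ->
  em_sum s X = (sum_n (fun n => dirichlet_term s n.+1) X - dirichlet_term s X.+1
     - (cpow (INR X.+1) (1 - s) - 1) / (1 - s))%C.
Proof.
move=> Hs; elim: X => [|X IH].
  rewrite sum_O [INR 1]/= cpow_base1 /=. field. exact: ne1_sub.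
rewrite sum_Sn [em_sum _ _]/= IH /em_term.
rewrite /plus /=. field. exact: ne1_sub.
Qed.

Lemma cdiff_cpow u (g : C -> C) s : cdiff g s -> cdiff (fun s => cpow u (g s)) s.
Proof.
move=> Hg; apply: (cdiff_comp Cexp (fun s => g s * RtoC (ln u))%C); last exact: cdiff_Cexp.
by apply: cdiff_mult => //; exact: cdiff_const.
Qed.

Lemma cdiff_opp f s : cdiff f s -> cdiff (fun s => - f s)%C s.
Proof.
move=> Hf; have := cdiff_mult (fun _ => RtoC (-1)) f s (cdiff_const _ s) Hf.
congr cdiff; apply: functional_extensionality => w.
by apply: injective_projections => /=; ring.
Qed.

Lemma cdiff_minus f g s : cdiff f s -> cdiff g s -> cdiff (fun s => f s - g s)%C s.
Proof. by move=> Hf Hg; apply: cdiff_plus => //; exact: cdiff_opp. Qed.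

Lemma cdiff_1sub s : cdiff (fun s => 1 - s)%C s.
Proof. by apply: cdiff_minus; [exact: cdiff_const|exact: cdiff_id]. Qed.

Lemma cdiff_inv1 s : s <> RtoC 1 -> cdiff (fun s => / (1 - s))%C s.
Proof.
move=> Hs; apply: (cdiff_comp Cinv (fun s => 1 - s)%C); first exact: cdiff_1sub.
by apply: cdiff_inv; exact: ne1_sub.
Qed.

Lemma cdiff_em_sum X s : s <> RtoC 1 -> cdiff (fun s => em_sum s X) s.
Proof.
move=> Hs; elim: X => [|X IH] /=; first exact: cdiff_const.
apply: cdiff_plus => //; rewrite /em_term; apply: cdiff_minus.
  by apply: (cdiff_cpow _ (fun s => - s)%C); apply: cdiff_opp; exact: cdiff_id.
apply: cdiff_mult; last exact: cdiff_inv1.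
by apply: cdiff_minus; apply: cdiff_cpow; exact: cdiff_1sub.
Qed.

(** zeta(s) + 1/(1-s) is zeta with its pole removed, the limit of [em_sum s X] as X grows. *)
Definition em_rem (zeta : C -> C) (X : nat) (s : C) : C := (zeta s + / (1 - s) - em_sum s X)%C.

(** The tail estimate on a quarter plane. It is proved where the series converges and then carried
    leftwards in strips by [em_ok_step]. *)
Definition em_ok zeta (a b : R) := forall s, a < Re s -> 1 / 2 <= Re s -> b < Im s ->
  forall X, (0 < X)%N -> Cmod (em_rem zeta X s) <= Cmod s / Re s * exp (- Re s * ln (INR X)).

Lemma Im_ne1 s : 0 < Im s -> s <> RtoC 1.
Proof. by move=> H E; move: H; rewrite E /Im /=; lra. Qed.

Lemma exp_le_compat x y : x <= y -> exp x <= exp y.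
Proof. by move=> H; have [H2|->] := Rle_lt_or_eq_dec _ _ H; [apply/Rlt_le/exp_increasing|lra]. Qed.

Lemma ex_ln_large (A : R) (X : nat) : exists Y, (X <= Y)%N /\ A <= ln (INR Y).
Proof.
have [n Hn] := INR_unbounded (exp A).
exists (maxn X n); split; first exact: leq_maxl.
rewrite -{1}(ln_exp A); apply: ln_le; first exact: exp_pos.
have : INR n <= INR (maxn X n) by apply: le_INR; have := leq_maxr X n; lia.
lra.
Qed.

(** For Re s > 1 both the tail of the series and Y^(1-s) tend to 0, so the remainder at a large Y is
    arbitrarily small; the passage from X to Y is [em_sum_tail_le]. *)
Lemma em_ok_base zeta : is_riemann_zeta zeta -> em_ok zeta 1 0.
Proof.
move=> [_ Hz] s Hs1 Hs2 Him X HX.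
have Hne := Im_ne1 s Him.
apply: le_epsilon => e He.
have HN : 0 < Cmod (1 - s) by apply: Cmod_pos; exact: ne1_sub.
have Hser := Hz s Hs1.
have [N HNs] := proj1 (filterlim_locally _ _) Hser (mkposreal (e / 8) ltac:(lra)).
set K := 1 + / Cmod (1 - s).
have HK : 0 < K by have := Rinv_0_lt_compat _ HN; rewrite /K; lra.
have [Y [HY1 HY2]] := ex_ln_large (ln (4 * K / e) / (Re s - 1)) (maxn X N).
have HXY : (X <= Y)%N by apply: leq_trans HY1; exact: leq_maxl.
have HNY : (N <= Y)%coq_nat by have := leq_trans (leq_maxr X N) HY1; lia.
have HY0 : 0 < INR Y by apply: lt_0_INR; lia.
have B1 : Cmod (zeta s - sum_n (fun n => dirichlet_term s n.+1) Y) <= e / 4.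
  have [Hb1 Hb2] := HNs Y HNY.
  set S := sum_n _ Y.
  have {}Hb1 : Rabs (Re S - Re (zeta s)) < e / 8 by exact: Hb1.
  have {}Hb2 : Rabs (Im S - Im (zeta s)) < e / 8 by exact: Hb2.
  have -> : (zeta s - S)%C = (RtoC (Re (zeta s) - Re S) + Ci * RtoC (Im (zeta s) - Im S))%C.
    by apply: injective_projections; rewrite /Re /Im /=; ring.
  apply: Rle_trans (Cmod_triangle _ _) _; rewrite Cmod_mult Cmod_Ci !Cmod_R.
  rewrite Rabs_minus_sym (Rabs_minus_sym (Im _)); lra.
set L := ln (INR Y.+1).
have HL : ln (4 * K / e) <= (Re s - 1) * L.
  have : ln (INR Y) <= L by apply: ln_le => //; rewrite S_INR; lra.
  move=> HL; have := Rmult_le_compat_l (Re s - 1) _ _ ltac:(lra) (Rle_trans _ _ _ HY2 HL).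
  by have -> : (Re s - 1) * (ln (4 * K / e) / (Re s - 1)) = ln (4 * K / e) by set q := ln _; field; lra.
have HL0 : 0 <= L by rewrite /L -ln_1; apply: ln_le; [lra|rewrite S_INR; lra].
have B2 : exp ((1 - Re s) * L) * K <= e / 4.
  have -> : e / 4 = exp (- ln (4 * K / e)) * K.
    rewrite exp_Ropp exp_ln; first by field; split; lra.
    by apply: Rdiv_lt_0_compat; lra.
  by apply: Rmult_le_compat_r; [lra|apply: exp_le_compat; lra].
have B3 : Cmod (em_rem zeta Y s) <= e / 2.
  have -> : em_rem zeta Y s = ((zeta s - sum_n (fun n => dirichlet_term s n.+1) Y) +
     (dirichlet_term s Y.+1 + cpow (INR Y.+1) (1 - s) * / (1 - s)))%C.
    rewrite /em_rem em_sumE //; field; exact: ne1_sub.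
  apply: Rle_trans (Cmod_triangle _ _) _.
  have := Cmod_triangle (dirichlet_term s Y.+1) (cpow (INR Y.+1) (1 - s) * / (1 - s)).
  rewrite (Cmod_mult (cpow _ _)) Cmod_inv; last exact: ne1_sub.
  rewrite dirichlet_cpow !Cmod_cpow -/L.
  have -> : Re (1 - s) = 1 - Re s by [].
  have -> : Re (- s) = - Re s by [].
  have : exp (- Re s * L) <= exp ((1 - Re s) * L) by apply: exp_le_compat; nra.
  rewrite /K in B2. lra.
have := em_sum_tail_le s X Y HX HXY Hne ltac:(lra).
have := Cmod_triangle (em_rem zeta Y s) (em_sum s Y - em_sum s X).
replace (em_rem zeta Y s + (em_sum s Y - em_sum s X))%C with (em_rem zeta X s); last by rewrite /em_rem; ring.
lra.
Qed.

(** A continuous real function of the angle attains its maximum on [0, 2 pi]. *)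
Lemma circle_bound h z r : 0 <= r -> (forall w, Cmod (w - z) <= r -> cdiff h w) ->
  exists M, forall th, 0 <= th <= 2 * PI -> Cmod (h (z + RtoC r * Cexp (Ci * RtoC th))%C) <= M.
Proof.
move=> Hr Hd; have HPI := PI_RGT_0.
have E th : Cexp (Ci * RtoC th) = (cos th, sin th).
  rewrite /Cexp /Re /Im /=.
  have -> : 0 * th - 1 * 0 = 0 by ring. have -> : 0 * 0 + 1 * th = th by ring.
  by rewrite exp_0; apply: injective_projections => /=; ring.
pose g th := (fst z + r * cos th, snd z + r * sin th) : C.
have Eg th : (z + RtoC r * Cexp (Ci * RtoC th))%C = g th.
  by rewrite E /g; apply: injective_projections => /=; ring.
have Hin th : Cmod (g th - z) <= r.
  rewrite -Eg; replace (z + RtoC r * Cexp (Ci * RtoC th) - z)%C with (RtoC r * Cexp (Ci * RtoC th))%C by ring.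
  rewrite Cmod_mult Cmod_R Rabs_pos_eq // Cmod_Cexp /Re /=.
  have -> : 0 * th - 1 * 0 = 0 by ring. rewrite exp_0; lra.
have Hcont th : continuity_pt (fun th => Re (h (g th)) * Re (h (g th)) + Im (h (g th)) * Im (h (g th))) th.
  have [H1 H2] : continuous (fun th => Re (h (g th))) th /\ continuous (fun th => Im (h (g th))) th.
    apply: ccont_Re; first exact/cdiff_ccont/Hd/Hin.
    move=> e He.
    have C1 : continuous (fun th => fst z + r * cos th) th.
      by apply: (ex_derive_continuous (V := R_NormedModule)); auto_derive.
    have C2 : continuous (fun th => snd z + r * sin th) th.
      by apply: (ex_derive_continuous (V := R_NormedModule)); auto_derive.
    have He2 : 0 < e / 2 by lra.
    have [d1 D1] := proj1 (filterlim_locally _ _) C1 (mkposreal _ He2).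
    have [d2 D2] := proj1 (filterlim_locally _ _) C2 (mkposreal _ He2).
    exists (Rmin d1 d2); split; first by apply: Rmin_glb_lt; exact: cond_pos.
    move=> y Hy.
    have A1 := D1 y (Rlt_le_trans _ _ _ Hy (Rmin_l _ _)).
    have A2 := D2 y (Rlt_le_trans _ _ _ Hy (Rmin_r _ _)).
    have -> : (g y - g th)%C = (RtoC (fst z + r * cos y - (fst z + r * cos th)) + Ci * RtoC (snd z + r * sin y - (snd z + r * sin th)))%C.
      by apply: injective_projections; rewrite /g /=; ring.
    apply: Rle_lt_trans (Cmod_triangle _ _) _; rewrite Cmod_mult Cmod_Ci !Cmod_R.
    move: A1 A2; rewrite /ball /= /AbsRing_ball /abs /minus /plus /opp /=.
    rewrite /Rminus; lra.
  apply: continuity_pt_plus; apply: continuity_pt_mult; by apply/continuity_pt_filterlim.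
have [x [Hx _]] := continuity_ab_maj _ 0 (2 * PI) ltac:(lra) (fun c _ => Hcont c).
eexists => th Hth.
rewrite Eg.
have -> : Cmod (h (g th)) = sqrt (Re (h (g th)) * Re (h (g th)) + Im (h (g th)) * Im (h (g th))).
  by rewrite /Cmod /Re /Im /= !Rmult_1_r.
apply: sqrt_le_1_alt; exact: (Hx th Hth).
Qed.

Lemma cdiff_em_rem zeta X s : is_riemann_zeta zeta -> s <> RtoC 1 -> cdiff (em_rem zeta X) s.
Proof.
move=> [Hz _] Hs; rewrite /em_rem; apply: cdiff_minus; last exact: cdiff_em_sum.
by apply: cdiff_plus; [exact/ex_derive_cdiff/Hz|exact: cdiff_inv1].
Qed.

Lemma Cmod_Cpow z n : Cmod (Cpow z n) = Cmod z ^ n.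
Proof. exact: Cmod_pow. Qed.

(* The holomorphic remainder is tiny on Re > a.  On the circle of radius 9/20 about z the weight
   exp((w-z) + 2(w-z)^2) is less than 1 in modulus wherever Re w <= a, so the maximum principle,
   applied with a high power of the weight, transports the smallness to z. *)
Lemma em_ok_step zeta a b : is_riemann_zeta zeta -> 1 / 2 <= a -> 0 <= b ->
  em_ok zeta a b -> em_ok zeta (a - 1 / 5) (b + 9 / 20).
Proof.
move=> Hzeta Ha Hb Hok s Hs1 Hs2 Him X HX.
have [Hsa|Hsa] := Rlt_dec a (Re s); first by apply: Hok => //; lra.
have Hne := Im_ne1 s ltac:(lra).
set r := 9 / 20.
have Hr : 0 < r by rewrite /r; lra.
have Hdisc w : Cmod (w - s) <= r -> Rabs (Re w - Re s) <= r /\ Rabs (Im w - Im s) <= r.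
  move=> Hw; split; [have := re_le_Cmod (w - s)|have := im_le_Cmod (w - s)%C]; rewrite /Re /Im /=;
   rewrite -/(Rminus _ _); lra.
have Hd1 w Y : Cmod (w - s) <= r -> cdiff (em_rem zeta Y) w.
  move=> /Hdisc [_ H]; apply: cdiff_em_rem => //; apply: Im_ne1.
  move: H; rewrite /Rabs; case: Rcase_abs; rewrite /r; lra.
have [M1 HM1] := circle_bound (em_rem zeta 1) s r ltac:(lra) (fun w Hw => Hd1 w 1%N Hw).
(* A bound on the circle independent of Y: the remainder at 1 is at most M1 there, and passing from
   1 to Y changes it by at most |w| / Re w, where Re w >= 1/2 - 9/20 = 1/20. *)
set M := Rmax 0 M1 + 20 * (Cmod s + 1).
have HCs := Cmod_ge_0 s.
have HM0 : 0 < M by have := Rmax_l 0 M1; rewrite /M; lra.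
pose phi w := Cexp ((w - s) + 2 * ((w - s) * (w - s)))%C.
have Hphi N w : cdiff (fun w => Cpow (phi w) N) w.
  apply: cdiff_pow; apply: (cdiff_comp Cexp (fun w => (w - s) + 2 * ((w - s) * (w - s)))%C); last exact: cdiff_Cexp.
  have H : cdiff (fun w => w - s)%C w by apply: cdiff_minus; [exact: cdiff_id|exact: cdiff_const].
  by apply: cdiff_plus => //; apply: cdiff_mult; [exact: cdiff_const|exact: cdiff_mult].
have key N Y : (0 < Y)%N ->
  Cmod (em_rem zeta Y s) <= exp 1 ^ N * (2 * (Cmod s + 1) * exp (- (1 / 2) * ln (INR Y))) + M * exp (- (9 / 200)) ^ N.
  move=> HY.
  have HlnY : 0 <= ln (INR Y) by rewrite -ln_1; apply: ln_le; [lra|apply: (le_INR 1); lia].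
  have P1 : 0 <= exp 1 ^ N * (2 * (Cmod s + 1) * exp (- (1 / 2) * ln (INR Y))).
    apply: Rmult_le_pos; first by apply/Rlt_le/pow_lt/exp_pos.
    apply: Rmult_le_pos; first lra. exact/Rlt_le/exp_pos.
  have P2 : 0 <= M * exp (- (9 / 200)) ^ N.
    apply: Rmult_le_pos; first lra. by apply/Rlt_le/pow_lt/exp_pos.
  have E0 : em_rem zeta Y s = (em_rem zeta Y s * Cpow (phi s) N)%C.
    have -> : phi s = 1%C by rewrite /phi -Cexp_0; congr Cexp; ring.
    by rewrite Cpow_1_l Cmult_1_r.
  rewrite E0.
  apply: (circle_max (fun w => em_rem zeta Y w * Cpow (phi w) N)%C s r) => //.
    by move=> w Hw; apply: cdiff_mult => //; exact: Hd1.
  move=> th Hth.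
  set w := (s + _)%C.
  have Ew : (w - s)%C = (r * cos th, r * sin th).
    rewrite /w /Cexp /Re /Im /=.
    have -> : 0 * th - 1 * 0 = 0 by ring. have -> : 0 * 0 + 1 * th = th by ring.
    by rewrite exp_0; apply: injective_projections => /=; ring.
  have Hw : Cmod (w - s) <= r.
    have -> : (w - s)%C = (RtoC r * Cexp (Ci * RtoC th))%C by rewrite /w; ring.
    rewrite Cmod_mult Cmod_R Rabs_pos_eq; last lra.
    rewrite Cmod_Cexp /Re /=; have -> : 0 * th - 1 * 0 = 0 by ring. rewrite exp_0; lra.
  have [D1 D2] := Hdisc w Hw.
  have {}D1 : Re s - r <= Re w <= Re s + r by move: D1; rewrite /Rabs; case: Rcase_abs; lra.
  have {}D2 : Im s - r <= Im w <= Im s + r by move: D2; rewrite /Rabs; case: Rcase_abs; lra.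
  have Hw1 : Cmod w <= Cmod s + 1.
    have := Cmod_triangle (w - s) s. replace (w - s + s)%C with w by ring. rewrite /r in Hw. lra.
  have Hwne : w <> RtoC 1 by apply: Im_ne1; rewrite /r in D2; lra.
  set v := r * cos th in Ew.
  have Ev : Re w = Re s + v.
    have : Re (w - s) = v by rewrite Ew.
    rewrite /Re /=; lra.
  have Ephi : Cmod (phi w) = exp (v + 4 * (v * v) - 2 * (r * r)).
    rewrite /phi Cmod_Cexp Ew /Re /=; congr exp.
    have Hsn : r * sin th * (r * sin th) = r * r - v * v.
      have := sin2_cos2 th; rewrite /Rsqr /v => H.
      have -> : r * r - r * cos th * (r * cos th) = r * r * (1 - cos th * cos th) by ring.
      by rewrite -H; ring.
    lra.
  rewrite Cmod_mult Cmod_Cpow Ephi.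
  have Hv2 : v * v <= r * r.
    have : cos th * cos th <= 1 by have := sin2_cos2 th; rewrite /Rsqr; nra.
    rewrite /v => H. have -> : r * cos th * (r * cos th) = r * r * (cos th * cos th) by ring.
    have : 0 <= r * r by nra. nra.
  have [Hwa|Hwa] := Rlt_dec a (Re w).
    have B := Hok w Hwa ltac:(lra) ltac:(rewrite /r in D2; lra) Y HY.
    have B1 : Cmod (em_rem zeta Y w) <= 2 * (Cmod s + 1) * exp (- (1 / 2) * ln (INR Y)).
      apply: Rle_trans B _; apply: Rmult_le_compat.
      - apply: Rmult_le_pos; [exact: Cmod_ge_0|apply/Rlt_le/Rinv_0_lt_compat; lra].
      - exact/Rlt_le/exp_pos.
      - rewrite /Rdiv (Rmult_comm (Cmod w)); apply: Rmult_le_compat => //.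
        + by apply/Rlt_le/Rinv_0_lt_compat; lra.
        + exact: Cmod_ge_0.
        + have -> : 2 = / (1 / 2) by field. apply: Rinv_le_contravar; lra.
      - apply: exp_le_compat; nra.
    have B2 : exp (v + 4 * (v * v) - 2 * (r * r)) ^ N <= exp 1 ^ N.
      apply: pow_incr; split; first exact/Rlt_le/exp_pos.
      apply: exp_le_compat; move: D1 Hv2; rewrite /r; lra.
    have := Rmult_le_compat _ _ _ _ (Cmod_ge_0 (em_rem zeta Y w)) (pow_le _ N (Rlt_le _ _ (exp_pos (v + 4 * (v * v) - 2 * (r * r))))) B1 B2.
    lra.
  have B2 : exp (v + 4 * (v * v) - 2 * (r * r)) ^ N <= exp (- (9 / 200)) ^ N.
    apply: pow_incr; split; first exact/Rlt_le/exp_pos.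
    apply: exp_le_compat; rewrite /r in D1 *.
    (* Here v = Re w - Re s lies in [-9/20, 1/5], so v + 4 v^2 <= 9/25, while 2 r^2 = 81/200; the
       difference of the two is -9/200. *)
    have : (v + 9 / 20) * (v - 1 / 5) <= 0 by nra.
    lra.
  have B1 : Cmod (em_rem zeta Y w) <= M.
    have T := em_sum_tail_le w 1 Y isT HY Hwne ltac:(rewrite /r in D1; lra).
    rewrite [INR 1]/= ln_1 Rmult_0_r exp_0 Rmult_1_r in T.
    have T2 : Cmod w / Re w <= 20 * (Cmod s + 1).
      rewrite /Rdiv (Rmult_comm (Cmod w)); apply: Rmult_le_compat => //.
      - by apply/Rlt_le/Rinv_0_lt_compat; rewrite /r in D1; lra.
      - exact: Cmod_ge_0.
      - have -> : 20 = / (1 / 20) by field. apply: Rinv_le_contravar; rewrite /r in D1; lra.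
    have := Cmod_triangle (em_rem zeta 1 w) (- (em_sum w Y - em_sum w 1)).
    rewrite Cmod_opp.
    replace (em_rem zeta 1 w + - (em_sum w Y - em_sum w 1))%C with (em_rem zeta Y w); last by rewrite /em_rem; ring.
    have := HM1 th Hth; rewrite -/w. have := Rmax_r 0 M1. rewrite /M; lra.
  have := Rmult_le_compat _ _ _ _ (Cmod_ge_0 (em_rem zeta Y w)) (pow_le _ N (Rlt_le _ _ (exp_pos (v + 4 * (v * v) - 2 * (r * r))))) B1 B2.
  lra.
(* The power N is fixed first, to make the arc with Re w <= a small; then Y is taken so large,
   depending on N, that the other arc is small as well. *)
apply: le_epsilon => e He.
have Hq : 0 < exp (- (9 / 200)) < 1.
  split; first exact: exp_pos. by rewrite -exp_0; apply: exp_increasing; lra.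
have [N HN] := pow_lt_1_zero (exp (- (9 / 200))) ltac:(rewrite Rabs_pos_eq; lra) (e / (2 * M)) ltac:(apply: Rdiv_lt_0_compat; lra).
have {}HN := HN N (le_n N).
rewrite Rabs_pos_eq in HN; last by apply/Rlt_le/pow_lt; lra.
set K := exp 1 ^ N * (2 * (Cmod s + 1)).
have HK : 0 < K by apply: Rmult_lt_0_compat; [apply: pow_lt; exact: exp_pos|lra].
have [Y [HXY HY]] := ex_ln_large (2 * ln (2 * K / e)) X.
have HKY : K * exp (- (1 / 2) * ln (INR Y)) <= e / 2.
  have -> : e / 2 = K * exp (- ln (2 * K / e)).
    rewrite exp_Ropp exp_ln; first by field; split; lra.
    by apply: Rdiv_lt_0_compat; lra.
  by apply: Rmult_le_compat_l; [lra|apply: exp_le_compat; lra].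
have HMN : M * exp (- (9 / 200)) ^ N <= e / 2.
  have -> : e / 2 = M * (e / (2 * M)) by field; lra.
  by apply: Rmult_le_compat_l; lra.
have := key N Y ltac:(lia).
rewrite -Rmult_assoc -/K => HkY.
have := em_sum_tail_le s X Y HX HXY Hne ltac:(lra).
have := Cmod_triangle (em_rem zeta Y s) (em_sum s Y - em_sum s X).
replace (em_rem zeta Y s + (em_sum s Y - em_sum s X))%C with (em_rem zeta X s); last by rewrite /em_rem; ring.
lra.
Qed.

(** Three steps of 1/5 lead from abscissa 1 to 2/5, past the critical line, while the height lost is
    27/20 < 2. *)
Lemma em_rem_half zeta t X : is_riemann_zeta zeta -> 2 <= t -> (0 < X)%N ->
  Cmod (em_rem zeta X (1 / 2, t)) <= 2 * (1 + t) * exp (- (1 / 2) * ln (INR X)).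
Proof.
move=> Hz Ht HX.
have H1 := em_ok_step zeta 1 0 Hz ltac:(lra) ltac:(lra) (em_ok_base zeta Hz).
have H2 := em_ok_step zeta (1 - 1 / 5) (0 + 9 / 20) Hz ltac:(lra) ltac:(lra) H1.
have H3 := em_ok_step zeta (1 - 1 / 5 - 1 / 5) (0 + 9 / 20 + 9 / 20) Hz ltac:(lra) ltac:(lra) H2.
have := H3 (1 / 2, t); rewrite /Re /Im /= => /(_ ltac:(lra) ltac:(lra) ltac:(lra) X HX) B.
apply: Rle_trans B _; apply: Rmult_le_compat_r; first exact/Rlt_le/exp_pos.
have : Cmod (1 / 2, t) <= 1 + t.
  have -> : ((1 / 2, t) : C) = (RtoC (1 / 2) + Ci * RtoC t)%C by apply: injective_projections => /=; ring.
  apply: Rle_trans (Cmod_triangle _ _) _; rewrite Cmod_mult Cmod_Ci !Cmod_R !Rabs_pos_eq; lra.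
lra.
Qed.

(** * Finite real sums as big operators, with Cauchy--Schwarz *)

HB.instance Definition _ := Monoid.isComLaw.Build R 0 Rplus
  (fun x y z => esym (Rplus_assoc x y z)) Rplus_comm Rplus_0_l.
HB.instance Definition _ := Monoid.isComLaw.Build R 1 Rmult
  (fun x y z => esym (Rmult_assoc x y z)) Rmult_comm Rmult_1_l.
HB.instance Definition _ := Monoid.isMulLaw.Build R 0 Rmult Rmult_0_l Rmult_0_r.
HB.instance Definition _ := Monoid.isAddLaw.Build R Rmult Rplus
  Rmult_plus_distr_r Rmult_plus_distr_l.

Notation "\rsum_ ( i <- r | P ) F" := (\big[Rplus/0]_(i <- r | P%B) F%R)
  (at level 41, F at level 41, i, r at level 50) : R_scope.
Notation "\rsum_ ( i <- r ) F" := (\big[Rplus/0]_(i <- r) F%R)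
  (at level 41, F at level 41, i, r at level 50) : R_scope.
Notation "\rsum_ ( i < n ) F" := (\big[Rplus/0]_(i < n) F%R)
  (at level 41, F at level 41, i, n at level 50) : R_scope.
Notation "\rsum_ ( m <= i < n ) F" := (\big[Rplus/0]_(m <= i < n) F%R)
  (at level 41, F at level 41, i, m, n at level 50) : R_scope.

Notation "\rsum_ ( m <= i < n | P ) F" := (\big[Rplus/0]_(m <= i < n | P%B) F%R)
  (at level 41, F at level 41, i, m, n at level 50) : R_scope.

Section RSum.
Context {I : Type}.
Implicit Types (r : seq I) (P : pred I) (F : I -> R).

Lemma rsum_ge0 r P F : (forall i, P i -> 0 <= F i) -> 0 <= \big[Rplus/0]_(i <- r | P i) F i.
Proof. by move=> H; elim/big_ind: _ => //; [lra|move=> x y; lra]. Qed.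

Lemma rsum_le r P F F' : (forall i, P i -> F i <= F' i) ->
  \big[Rplus/0]_(i <- r | P i) F i <= \big[Rplus/0]_(i <- r | P i) F' i.
Proof. by move=> H; elim/big_rec2: _ => [|i x y Hi]; [lra|have := H i Hi; lra]. Qed.

Lemma rsum_abs r P F : Rabs (\big[Rplus/0]_(i <- r | P i) F i) <= \big[Rplus/0]_(i <- r | P i) Rabs (F i).
Proof.
elim/big_rec2: _ => [|i x y Hi H]; first by rewrite Rabs_R0; lra.
have := Rabs_triang (F i) y; lra.
Qed.

Lemma rsum_mull r P F c : c * (\big[Rplus/0]_(i <- r | P i) F i) = \big[Rplus/0]_(i <- r | P i) (c * F i).
Proof. by rewrite big_distrr. Qed.

Lemma rsum_mulr r P F c : (\big[Rplus/0]_(i <- r | P i) F i) * c = \big[Rplus/0]_(i <- r | P i) (F i * c).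
Proof. by rewrite big_distrl. Qed.

Lemma rsum_minus r P F F' : \big[Rplus/0]_(i <- r | P i) (F i - F' i) =
  \big[Rplus/0]_(i <- r | P i) F i - \big[Rplus/0]_(i <- r | P i) F' i.
Proof.
rewrite /Rminus big_split /=; congr (_ + _).
rewrite -[RHS]Rmult_1_l Ropp_mult_distr_r_reverse -Ropp_mult_distr_l_reverse rsum_mull.
by apply: eq_bigr => i _; ring.
Qed.

Lemma rsum_const_seq r c : \big[Rplus/0]_(i <- r) c = INR (size r) * c.
Proof.
elim: r => [|x r IH]; first by rewrite big_nil /=; ring.
by rewrite big_cons IH -[size (x :: r)]/((size r).+1) S_INR; ring.
Qed.

Lemma rsum_filter_le r P F : (forall i, 0 <= F i) ->
  \big[Rplus/0]_(i <- r | P i) F i <= \big[Rplus/0]_(i <- r) F i.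
Proof.
move=> H; rewrite big_mkcond; apply: rsum_le => i _; case: ifP => _; first lra; exact: H.
Qed.

Lemma cauchy_schwarz r P F F' :
  (\big[Rplus/0]_(i <- r | P i) (F i * F' i)) * (\big[Rplus/0]_(i <- r | P i) (F i * F' i)) <=
  (\big[Rplus/0]_(i <- r | P i) (F i * F i)) * (\big[Rplus/0]_(i <- r | P i) (F' i * F' i)).
Proof.
set A := \big[_/_]_(_ <- _ | _) (F _ * F _); set B := \big[_/_]_(_ <- _ | _) (F _ * F' _).
set D := \big[_/_]_(_ <- _ | _) (F' _ * F' _).
have H x : 0 <= A * (x * x) - 2 * x * B + D.
  have -> : A * (x * x) - 2 * x * B + D =
     \big[Rplus/0]_(i <- r | P i) ((x * F i - F' i) * (x * F i - F' i)).
    rewrite Rmult_comm /A /B /D !rsum_mull -rsum_minus -big_split /=.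
    by apply: eq_bigr => i _; ring.
  by apply: rsum_ge0 => i _; exact: Rle_0_sqr.
have HA : 0 <= A by apply: rsum_ge0 => i _; exact: Rle_0_sqr.
have HD : 0 <= D by apply: rsum_ge0 => i _; exact: Rle_0_sqr.
have [E|E] := Req_dec A 0.
  have B0 : B = 0.
    have [//|Hb] := Req_dec B 0.
    have := H ((D + 1) / (2 * B)); rewrite E.
    have -> : 2 * ((D + 1) / (2 * B)) * B = D + 1 by field.
    lra.
  rewrite B0 E; lra.
have HA2 : 0 < A by lra.
have := H (B / A).
have -> : A * (B / A * (B / A)) - 2 * (B / A) * B + D = (A * D - B * B) / A by field.
move=> H2; have := Rmult_le_compat_r A _ _ HA H2.
have -> : (A * D - B * B) / A * A = A * D - B * B by field.
lra.
Qed.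
End RSum.

Lemma rsum_uniq_le (T : eqType) (s s' : seq T) (F : T -> R) : uniq s -> {subset s <= s'} ->
  (forall i, 0 <= F i) -> \rsum_(i <- s) F i <= \rsum_(i <- s') F i.
Proof.
elim: s s' => [|x s IH] s' /=; first by move=> _ _ H; rewrite big_nil; apply: rsum_ge0.
move=> /andP [Hx Hu] Hs HF.
have Hxs : x \in s' by apply: Hs; rewrite mem_head.
rewrite big_cons (big_rem x Hxs) /=.
apply: Rplus_le_compat_l; apply: IH => // y Hy.
have := Hs y; rewrite inE Hy orbT => /(_ isT) Hy'.
have : perm_eq s' (x :: rem x s') by exact: perm_to_rem.
move/perm_mem => /(_ y); rewrite Hy' inE; case: eqP => [E|_] //=.
by move: Hx; rewrite -E Hy.
Qed.

Lemma rsum_recr (F : nat -> R) m n : (m <= n)%N ->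
  \rsum_(m <= i < n.+1) F i = \rsum_(m <= i < n) F i + F n.
Proof. by move=> H; rewrite big_nat_recr. Qed.

(** * Gaussian cosine integrals, truncated at A *)

Definition gw (a t : R) := exp (- (a * (t * t) / 2)).
(** The truncation keeps every integral proper; A is taken large enough by [gw_small_error]. *)
Definition GG (a A xi : R) := RInt (fun t => gw a t * cos (t * xi)) 0 A.

Lemma gw_pos a t : 0 < gw a t. Proof. exact: exp_pos. Qed.

Lemma gw_cont a t : continuous (gw a) t.
Proof. by apply: (ex_derive_continuous (V := R_NormedModule)); rewrite /gw; auto_derive. Qed.

Lemma ex_RInt_gw a (f : R -> R) x y : (forall t, continuous f t) -> ex_RInt (fun t => gw a t * f t) x y.
Proof.
move=> Hf; apply: (ex_RInt_continuous (V := R_CompleteNormedModule)) => t _.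
by apply: (continuous_mult (K := R_AbsRing)); [exact: gw_cont|exact: Hf].
Qed.

Lemma cos_cont xi t : continuous (fun t => cos (t * xi)) t.
Proof. by apply: (ex_derive_continuous (V := R_NormedModule)); auto_derive. Qed.

Lemma continuity_2d_pt_of_1d (f : R -> R) (g : R -> R -> R) x y :
  (forall z, continuity_pt f z) -> continuity_2d_pt g x y -> continuity_2d_pt (fun u v => f (g u v)) x y.
Proof. by move=> Hf Hg; apply: continuity_1d_2d_pt_comp. Qed.

Lemma gw_continuity a t : continuity_pt (gw a) t.
Proof. by apply/continuity_pt_filterlim; exact: gw_cont. Qed.

Lemma GG_derive_raw a A xi : 0 <= A ->
  is_derive (fun xi => GG a A xi) xi (RInt (fun t => - (t * gw a t * sin (t * xi))) 0 A).
Proof.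
move=> HA.
have D t z : is_derive (fun u => gw a t * cos (t * u)) z (- (t * gw a t * sin (t * z))).
  by auto_derive => //; ring.
have := is_derive_RInt_param (fun z t => gw a t * cos (t * z)) 0 A xi.
rewrite (RInt_ext (fun t => Derive _ xi) (fun t => - (t * gw a t * sin (t * xi)))); last first.
  by move=> t _; apply: is_derive_unique; exact: D.
apply.
- by apply: filter_forall => z t _; eexists; exact: D.
- move=> t _; apply: (continuity_2d_pt_ext (fun u v => - (v * gw a v * sin (v * u)))).
    by move=> u v; apply: esym; apply: is_derive_unique; exact: D.
  apply: continuity_2d_pt_opp; apply: continuity_2d_pt_mult.
    apply: continuity_2d_pt_mult; first exact: continuity_2d_pt_id2.
    apply: continuity_2d_pt_of_1d; [exact: gw_continuity|exact: continuity_2d_pt_id2].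
  apply: continuity_2d_pt_of_1d; first exact: continuity_sin.
  by apply: continuity_2d_pt_mult; [exact: continuity_2d_pt_id2|exact: continuity_2d_pt_id1].
- by apply: filter_forall => z; apply: ex_RInt_gw => t; exact: cos_cont.
Qed.

(** Integration by parts yields the equation G' = -xi G / a satisfied by a Gaussian, up to a
    boundary term at A. *)
Lemma GG_derive a A xi : 0 < a -> 0 <= A ->
  is_derive (fun xi => GG a A xi) xi ((gw a A * sin (A * xi) - xi * GG a A xi) / a).
Proof.
move=> Ha HA.
have -> : (gw a A * sin (A * xi) - xi * GG a A xi) / a = RInt (fun t => - (t * gw a t * sin (t * xi))) 0 A.
  apply: esym; apply: is_RInt_unique.
  have H1 : is_RInt (fun t => - a * t * gw a t * sin (t * xi) + xi * (gw a t * cos (t * xi))) 0 A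
      (gw a A * sin (A * xi)).
    have -> : gw a A * sin (A * xi) = minus (gw a A * sin (A * xi)) (gw a 0 * sin (0 * xi)).
      by rewrite /minus /plus /opp /= Rmult_0_l sin_0; ring.
    apply: (is_RInt_derive (V := R_CompleteNormedModule) (fun t => gw a t * sin (t * xi))) => t _.
      by rewrite /gw /Rdiv; auto_derive => //; field.
    by apply: (ex_derive_continuous (V := R_NormedModule)); rewrite /gw; auto_derive.
  have H2 : is_RInt (fun t => gw a t * cos (t * xi)) 0 A (GG a A xi).
    by apply: RInt_correct; apply: ex_RInt_gw => t; exact: cos_cont.
  have H3 := is_RInt_scal (V := R_NormedModule) _ _ _ (/ a) _ (is_RInt_minus (V := R_NormedModule) _ _ _ _ _ _ H1
     (is_RInt_scal (V := R_NormedModule) _ _ _ xi _ H2)).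
  have -> : (gw a A * sin (A * xi) - xi * GG a A xi) / a = scal (/ a) (minus (gw a A * sin (A * xi)) (scal xi (GG a A xi))).
    by rewrite /scal /minus /plus /opp /= /mult /=; field; lra.
  apply: is_RInt_ext H3 => t _; rewrite /scal /minus /plus /opp /= /mult /=; field; lra.
exact: GG_derive_raw.
Qed.

Lemma GG_even a A xi : GG a A (- xi) = GG a A xi.
Proof.
apply: RInt_ext => t _; congr (_ * _).
by rewrite Ropp_mult_distr_r_reverse cos_neg.
Qed.

(** The integrating factor exp(xi^2/(2a)) leaves only the boundary term of [GG_derive], which is
    integrated from 0 to xi. *)
Lemma GG_gauss a A xi : 0 < a -> 0 <= A ->
  Rabs (GG a A xi - exp (- (xi * xi / (2 * a))) * GG a A 0) <= Rabs xi * gw a A / a.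
Proof.
move=> Ha HA.
have pos x : 0 <= x -> Rabs (GG a A x - exp (- (x * x / (2 * a))) * GG a A 0) <= x * gw a A / a.
  move=> Hx.
  set E := exp (x * x / (2 * a)).
  have HE : 0 < E by exact: exp_pos.
  have := cmvt (fun u => GG a A u * exp (u * u / (2 * a))) (fun _ => 0)
    (fun u => gw a A * sin (A * u) / a * exp (u * u / (2 * a))) (fun _ => 0) 0 x (gw a A / a * E) Hx.
  have -> : 0 * 0 / (2 * a) = 0 by field; lra.
  rewrite exp_0 Rmult_1_r -/E => H.
  have {}H : Rabs (GG a A x * E - GG a A 0) <= gw a A / a * E * (x - 0).
    have -> : Rabs (GG a A x * E - GG a A 0) = Cmod (GG a A x * E - GG a A 0, 0 - 0).
      by rewrite Rminus_0_r -Cmod_R.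
    apply: H.
    - move=> t Ht.
      have D1 := GG_derive a A t Ha HA.
      have D2 : is_derive (fun u => exp (u * u / (2 * a))) t (t / a * exp (t * t / (2 * a))).
        by rewrite /Rdiv; auto_derive => //; field; lra.
      have := is_derive_mult _ _ _ _ _ D1 D2 (fun n m => Rmult_comm n m).
      have -> // : plus (mult ((gw a A * sin (A * t) - t * GG a A t) / a) (exp (t * t / (2 * a))))
         (mult (GG a A t) (t / a * exp (t * t / (2 * a)))) = gw a A * sin (A * t) / a * exp (t * t / (2 * a)).
      by rewrite /plus /mult /=; field; lra.
    - by move=> t _; exact: is_derive_const.
    - move=> t Ht.
      have -> : Cmod (gw a A * sin (A * t) / a * exp (t * t / (2 * a)), 0) = Rabs (gw a A / a * exp (t * t / (2 * a)) * sin (A * t)).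
        rewrite -Cmod_R; congr Cmod; rewrite /RtoC; congr pair; field; lra.
      have HgA := gw_pos a A.
      have Hpos : 0 <= gw a A / a * exp (t * t / (2 * a)).
        apply: Rmult_le_pos; last exact/Rlt_le/exp_pos.
        by apply/Rlt_le/Rdiv_lt_0_compat.
      rewrite Rabs_mult Rabs_pos_eq //.
      have Hs : Rabs (sin (A * t)) <= 1 by apply: Rabs_le; exact: SIN_bound.
      apply: Rle_trans (_ : gw a A / a * exp (t * t / (2 * a)) * 1 <= _).
        exact: Rmult_le_compat_l.
      rewrite Rmult_1_r; apply: Rmult_le_compat_l; first by apply/Rlt_le/Rdiv_lt_0_compat.
      apply: exp_le_compat; apply: Rmult_le_compat_r; last nra.
      by apply/Rlt_le/Rinv_0_lt_compat; lra.
  have -> : GG a A x - exp (- (x * x / (2 * a))) * GG a A 0 = / E * (GG a A x * E - GG a A 0).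
    by rewrite exp_Ropp -/E; field; lra.
  rewrite Rabs_mult (Rabs_pos_eq (/ E)); last exact/Rlt_le/Rinv_0_lt_compat.
  have := Rmult_le_compat_l (/ E) _ _ (Rlt_le _ _ (Rinv_0_lt_compat _ HE)) H.
  have -> // : / E * (gw a A / a * E * (x - 0)) = x * gw a A / a by field; lra.
have [Hx|Hx] := Rle_dec 0 xi; first by rewrite (Rabs_pos_eq xi) //; exact: pos.
have := pos (- xi) ltac:(lra); rewrite GG_even (Rabs_left xi); last lra.
by have -> : - xi * - xi = xi * xi by ring.
Qed.

(** Compare with 1/(1 + a t^2/4), whose antiderivative is an arctangent, and use pi <= 4. *)
Lemma GG0_upper a A : 0 < a -> 0 <= A -> GG a A 0 <= 4 / sqrt a.
Proof.
move=> Ha HA.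
have Hs : 0 < sqrt a by exact: sqrt_lt_R0.
have Es : sqrt a * sqrt a = a by apply: sqrt_sqrt; lra.
set q := sqrt a in Hs Es *.
have D : is_RInt (fun t => / (1 + (q / 2 * t) * (q / 2 * t))) 0 A (2 / q * atan (q / 2 * A) - 2 / q * atan (q / 2 * 0)).
  apply: (is_RInt_derive (V := R_CompleteNormedModule) (fun t => 2 / q * atan (q / 2 * t))) => t _.
    have Hp : 0 < 1 + q / 2 * t * (q / 2 * t) by nra.
    auto_derive => //. rewrite /Rsqr; field; split; nra.
  have Hp : 0 < 1 + q / 2 * t * (q / 2 * t) by nra.
  by apply: (ex_derive_continuous (V := R_NormedModule)); auto_derive; lra.
have L := is_RInt_le _ _ _ _ _ _ HA (RInt_correct (V := R_CompleteNormedModule) _ _ _ (ex_RInt_gw a (fun t => cos (t * 0)) 0 A (cos_cont 0))) D.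
have {}L : GG a A 0 <= 2 / q * atan (q / 2 * A) - 2 / q * atan (q / 2 * 0).
  apply: L => t _; rewrite Rmult_0_r cos_0 Rmult_1_r /gw exp_Ropp.
  apply: Rinv_le_contravar; first by nra.
  have := exp_ineq1_le (a * (t * t) / 2); rewrite -Es; nra.
apply: Rle_trans L _.
rewrite Rmult_0_r atan_0 Rmult_0_r Rminus_0_r.
have [_ Hat] := atan_bound (q / 2 * A).
have P := PI_4.
have Hq : 0 < / q by exact: Rinv_0_lt_compat.
rewrite /Rdiv; nra.
Qed.

Lemma GG0_lower a A : 0 < a -> 1 / sqrt a <= A -> / (2 * sqrt a) <= GG a A 0.
Proof.
move=> Ha HA.
have Hs : 0 < sqrt a by exact: sqrt_lt_R0.
have Es : sqrt a * sqrt a = a by apply: sqrt_sqrt; lra.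
set q := sqrt a in Hs Es HA *.
have Hq : 0 < / q by exact: Rinv_0_lt_compat.
have E1 : 1 / q = / q by field; lra.
rewrite E1 in HA.
have X x y : ex_RInt (fun t => gw a t * cos (t * 0)) x y by apply: ex_RInt_gw; exact: cos_cont.
have Ef t : gw a t * cos (t * 0) = gw a t by rewrite Rmult_0_r cos_0 Rmult_1_r.
have -> : GG a A 0 = RInt (fun t => gw a t * cos (t * 0)) 0 (/ q) + RInt (fun t => gw a t * cos (t * 0)) (/ q) A.
  by rewrite /GG -(RInt_Chasles (V := R_CompleteNormedModule) _ 0 (/ q) A).
have B1 : 0 <= RInt (fun t => gw a t * cos (t * 0)) (/ q) A.
  apply: RInt_ge_0 => // t _; rewrite Ef; exact/Rlt_le/gw_pos.
have B2 : (/ q - 0) * (1 / 2) <= RInt (fun t => gw a t * cos (t * 0)) 0 (/ q).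
  have L := is_RInt_le _ _ _ _ _ _ (Rlt_le _ _ Hq) (is_RInt_const (V := R_NormedModule) 0 (/ q) (1 / 2))
     (RInt_correct (V := R_CompleteNormedModule) _ _ _ (X 0 (/ q))).
  apply: L => t Ht; rewrite Ef /gw.
  have Ht2 : (q * t) * (q * t) <= 1.
    have : q * t <= 1.
      have -> : 1 = q * / q by field; lra.
      apply: Rmult_le_compat_l; lra.
    have : 0 <= q * t by apply: Rmult_le_pos; lra.
    nra.
  have := exp_ineq1_le (- (a * (t * t) / 2)).
  have : a * (t * t) = q * t * (q * t) by rewrite -Es; ring.
  lra.
rewrite Rinv_mult; lra.
Qed.

(* [KK lam v t] is the real part of [e^(i lam t) u^(1-s) / (1-s)] at [s = 1/2 + it], [u = e^v]. *)
Definition KK (lam v t : R) :=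
  exp (v / 2) * (cos (t * (v - lam)) / 2 + t * sin (t * (v - lam))) / (1 / 4 + t * t).

Definition hl (t : R) : C := (1 / 2, t).

(** By [WWln_derive], u -> WW(ln u) is an antiderivative of GG(ln u - lam)/sqrt u; differences of
    [WW] are thus the integrals subtracted in Euler--Maclaurin. *)
Definition WW a A lam v := RInt (fun t => gw a t * KK lam v t) 0 A.

Lemma q4_pos t : 0 < 1 / 4 + t * t. Proof. nra. Qed.

Lemma KK_derive lam v t : is_derive (fun v => KK lam v t) v (exp (v / 2) * cos (t * (v - lam))).
Proof.
have Hq := q4_pos t.
rewrite /KK /Rdiv /Rminus; auto_derive; first by [].
field; lra.
Qed.

Lemma KK_cont lam v t : continuous (fun t => KK lam v t) t.
Proof.
have Hq := q4_pos t.
apply: (ex_derive_continuous (V := R_NormedModule)); rewrite /KK; auto_derive; lra.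
Qed.

Lemma WW_derive a A lam v : 0 <= A ->
  is_derive (WW a A lam) v (exp (v / 2) * GG a A (v - lam)).
Proof.
move=> HA.
have D t z : is_derive (fun v => gw a t * KK lam v t) z (gw a t * (exp (z / 2) * cos (t * (z - lam)))).
  by apply: is_derive_scal; exact: KK_derive.
have := is_derive_RInt_param (fun z t => gw a t * KK lam z t) 0 A v.
rewrite (RInt_ext (fun t => Derive _ v) (fun t => scal (exp (v / 2)) (gw a t * cos (t * (v - lam))))); last first.
  move=> t _; rewrite (is_derive_unique _ _ _ (D t v)) /scal /= /mult /=; ring.
rewrite RInt_scal; last by apply: ex_RInt_gw => t; exact: cos_cont.
apply.
- by apply: filter_forall => z t _; eexists; exact: D.
- move=> t _; apply: (continuity_2d_pt_ext (fun u w => gw a w * (exp (u / 2) * cos (w * (u + - lam))))).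
    by move=> u w; rewrite (is_derive_unique _ _ _ (D w u)).
  apply: continuity_2d_pt_mult.
    apply: continuity_2d_pt_of_1d; [exact: gw_continuity|exact: continuity_2d_pt_id2].
  apply: continuity_2d_pt_mult.
    apply: (continuity_2d_pt_of_1d (fun x => exp (x / 2))); last exact: continuity_2d_pt_id1.
    move=> z; apply/continuity_pt_filterlim.
    have H : continuous (fun x => exp (x / 2)) z.
      by apply: (ex_derive_continuous (V := R_NormedModule)); auto_derive.
    exact: H.
  apply: continuity_2d_pt_of_1d; first exact: continuity_cos.
  apply: continuity_2d_pt_mult; first exact: continuity_2d_pt_id2.
  by apply: continuity_2d_pt_plus; [exact: continuity_2d_pt_id1|exact: continuity_2d_pt_const].
- by apply: filter_forall => z; apply: ex_RInt_gw => t; exact: KK_cont.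
Qed.

Lemma WWln_derive a A lam u : 0 <= A -> 0 < u ->
  is_derive (fun u => WW a A lam (ln u)) u (GG a A (ln u - lam) / sqrt u).
Proof.
move=> HA Hu.
have Hs : 0 < sqrt u by exact: sqrt_lt_R0.
have Eu : exp (ln u / 2) = sqrt u.
  apply: esym; apply: sqrt_lem_1; [lra|exact/Rlt_le/exp_pos|].
  by rewrite -exp_plus -[RHS](exp_ln u) //; congr exp; field.
have Dl : is_derive ln u (/ u) by auto_derive; [|field; lra].
have := is_derive_comp (WW a A lam) ln u _ _ (WW_derive a A lam (ln u) HA) Dl.
congr is_derive; rewrite /scal /= /mult /= Eu.
have {1}-> : u = sqrt u * sqrt u by rewrite sqrt_sqrt; lra.
field; lra.
Qed.

(** * The kernel: Gaussian mean of the Euler--Maclaurin sum against e^(i lam t) *)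

Definition kern a A lam X := RInt (fun t => gw a t * Re (em_sum (hl t) X * (cos (t * lam), sin (t * lam)))) 0 A.

Lemma half_ne1 t : hl t <> RtoC 1.
Proof. by move=> H; have := f_equal fst H => /=; lra. Qed.

Lemma cpow_half u t : 0 < u -> cpow u (1 - (hl t))%C =
  (exp (ln u / 2) * cos (t * ln u), - (exp (ln u / 2) * sin (t * ln u))).
Proof.
move=> Hu; rewrite /hl /cpow /Cexp /Re /Im /=.
have -> : (1 + - (1 / 2)) * ln u - (0 + - t) * 0 = ln u / 2 by field.
have -> : (1 + - (1 / 2)) * 0 + (0 + - t) * ln u = - (t * ln u) by ring.
by rewrite cos_neg sin_neg; apply: injective_projections => /=; ring.
Qed.

Lemma em_term_re t lam n : (0 < n)%N ->
  Re (em_term (hl t) n * (cos (t * lam), sin (t * lam))) =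
  cos (t * (ln (INR n) - lam)) / sqrt (INR n) - (KK lam (ln (INR n.+1)) t - KK lam (ln (INR n)) t).
Proof.
move=> Hn.
have Hn0 : 0 < INR n by apply: lt_0_INR; lia.
have Hn1 : 0 < INR n.+1 by apply: lt_0_INR; lia.
have Hq := q4_pos t.
rewrite /em_term !cpow_half //.
have -> : dirichlet_term (hl t) n = (/ sqrt (INR n) * cos (t * ln (INR n)), - (/ sqrt (INR n) * sin (t * ln (INR n)))).
  rewrite dirichlet_cpow /cpow /Cexp /Re /Im /=.
  have -> : - (1 / 2) * ln (INR n) - - t * 0 = - (ln (INR n) / 2) by field.
  have -> : - (1 / 2) * 0 + - t * ln (INR n) = - (t * ln (INR n)) by ring.
  rewrite cos_neg sin_neg exp_Ropp.
  have -> : exp (ln (INR n) / 2) = sqrt (INR n).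
    apply: esym; apply: sqrt_lem_1; [lra|exact/Rlt_le/exp_pos|].
    by rewrite -exp_plus -[RHS](exp_ln (INR n)) //; congr exp; field.
  by apply: injective_projections => /=; ring.
rewrite /hl /KK !Rmult_minus_distr_l !cos_minus !sin_minus /Re /Cdiv /Cinv /=.
set c0 := cos (t * lam); set s0 := sin (t * lam).
set c1 := cos (t * ln (INR n)); set s1 := sin (t * ln (INR n)).
set c2 := cos (t * ln _); set s2 := sin (t * ln _).
have Hs : sqrt (INR n) <> 0 by have := sqrt_lt_R0 _ Hn0; lra.
set e1 := exp (_ / 2); set e2 := exp (_ / 2).
field; repeat split => //; nra.
Qed.

Lemma em_re_cont X lam t : continuous (fun t => Re (em_sum (hl t) X * (cos (t * lam), sin (t * lam)))) t.
Proof.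
elim: X => [|X IH].
  apply: (continuous_ext (fun _ => 0)); last exact: continuous_const.
  by move=> z /=; rewrite !Rmult_0_l Rminus_0_r.
apply: (continuous_ext (fun t => plus (Re (em_sum (hl t) X * (cos (t * lam), sin (t * lam))))
   (cos (t * (ln (INR X.+1) - lam)) / sqrt (INR X.+1) - (KK lam (ln (INR X.+2)) t - KK lam (ln (INR X.+1)) t)))).
  move=> z; rewrite -em_term_re // /plus /= /Re /=; ring.
apply: (continuous_plus (V := R_NormedModule)) => //.
apply: (continuous_minus (V := R_NormedModule)).
  apply: (continuous_mult (K := R_AbsRing)); [exact: cos_cont|exact: continuous_const].
by apply: (continuous_minus (V := R_NormedModule)); exact: KK_cont.
Qed.

(** Sum and integral are exchanged: what remains is the profile GG(ln u - lam)/sqrt u summed over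
    integers, minus its integral. All estimates of [kern] come from the shape of this profile, a
    bump near ln u = lam. *)
Lemma kern_eq a A lam X : kern a A lam X =
  \rsum_(1 <= n < X.+1) (GG a A (ln (INR n) - lam) / sqrt (INR n) -
     (WW a A lam (ln (INR n.+1)) - WW a A lam (ln (INR n)))).
Proof.
elim: X => [|X IH].
  rewrite big_geq // /kern (RInt_ext _ (fun _ => 0)).
    by rewrite RInt_const /scal /= /mult /= Rmult_0_r.
  by move=> t _ /=; rewrite /Re /=; ring.
rewrite big_nat_recr // -IH.
have I1 : is_RInt (fun t => gw a t * Re (em_sum (hl t) X * (cos (t * lam), sin (t * lam)))) 0 A (kern a A lam X).
  by apply: (RInt_correct (V := R_CompleteNormedModule)); apply: ex_RInt_gw => t; exact: em_re_cont.
have I2 := is_RInt_scal (V := R_NormedModule) _ _ _ (/ sqrt (INR X.+1)) _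
  (RInt_correct (V := R_CompleteNormedModule) _ _ _ (ex_RInt_gw a _ 0 A (cos_cont (ln (INR X.+1) - lam)))).
have I3 v := RInt_correct (V := R_CompleteNormedModule) _ _ _ (ex_RInt_gw a _ 0 A (KK_cont lam v)).
have H := is_RInt_plus (V := R_NormedModule) _ _ _ _ _ _ I1 (is_RInt_minus (V := R_NormedModule) _ _ _ _ _ _ I2
  (is_RInt_minus (V := R_NormedModule) _ _ _ _ _ _ (I3 (ln (INR X.+2))) (I3 (ln (INR X.+1))))).
rewrite [GG _ _ _ / _]Rmult_comm; apply: is_RInt_unique; apply: is_RInt_ext H => t _.
have -> : Re (em_sum (hl t) X.+1 * (cos (t * lam), sin (t * lam))) =
  Re (em_sum (hl t) X * (cos (t * lam), sin (t * lam))) + Re (em_term (hl t) X.+1 * (cos (t * lam), sin (t * lam))).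
  by rewrite [em_sum _ X.+1]/=; set p := em_sum _ _; set q := em_term _ _; rewrite /Re /=; ring.
by rewrite em_term_re // /plus /minus /opp /plus /scal /= /mult /= /Rdiv; ring.
Qed.

(** * Upper and lower bounds for the kernel *)

Definition gau (a v : R) := exp (- (v * v / (2 * a))).

Lemma gau_le1 a v : 0 < a -> 0 < gau a v <= 1.
Proof.
move=> Ha; split; first exact: exp_pos.
rewrite /gau -exp_0; apply: exp_le_compat.
have : 0 <= v * v / (2 * a) by apply: Rmult_le_pos; [nra|apply/Rlt_le/Rinv_0_lt_compat; lra].
lra.
Qed.

Lemma gau_mono a v w : 0 < a -> v * v <= w * w -> gau a w <= gau a v.
Proof.
move=> Ha H; apply: exp_le_compat; apply: Ropp_le_contravar.
by apply: Rmult_le_compat_r => //; apply/Rlt_le/Rinv_0_lt_compat; lra.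
Qed.

(** The variation of [gau] over (-infinity, v]: the Gaussian climbs to 1 at 0 and then descends. *)
Definition VV (a v : R) := if Rle_dec v 0 then gau a v else 2 - gau a v.

Lemma VV_var a v w : 0 < a -> v <= w -> Rabs (gau a v - gau a w) <= VV a w - VV a v.
Proof.
move=> Ha Hvw; have [P1 Q1] := gau_le1 a v Ha; have [P2 Q2] := gau_le1 a w Ha.
rewrite /VV; case: Rle_dec => Hw; case: Rle_dec => Hv /=; try lra; apply: Rabs_le.
- have := gau_mono a w v Ha ltac:(nra); lra.
- lra.
have := gau_mono a v w Ha ltac:(nra); lra.
Qed.

(** The ideal profile u^(-1/2) gau(ln u - lam), written in v = ln u. *)
Definition g0 a lam v := exp (- (v / 2)) * gau a (v - lam).

(** Completing the square: the factor u^(-1/2) shifts and rescales the Gaussian, so the profile is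
    unimodal. *)
Lemma g0E a lam v : 0 < a -> g0 a lam v = exp (- lam / 2 + a / 8) * gau a (v - (lam - a / 2)).
Proof. by move=> Ha; rewrite /g0 /gau -!exp_plus; congr exp; field; lra. Qed.

Lemma sqrt_exp_ln u : 0 < u -> / sqrt u = exp (- (ln u / 2)).
Proof.
move=> Hu; rewrite exp_Ropp; congr (/ _); apply: sqrt_lem_1; [lra|exact/Rlt_le/exp_pos|].
by rewrite -exp_plus -[RHS](exp_ln u) //; congr exp; field.
Qed.

Lemma GG0_ge0 a A : 0 <= A -> 0 <= GG a A 0.
Proof.
move=> HA; apply: RInt_ge_0 => //.
  by apply: ex_RInt_gw; exact: cos_cont.
move=> t _; rewrite Rmult_0_r cos_0 Rmult_1_r; exact/Rlt_le/gw_pos.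
Qed.

Section Kern.
Variables (a A lam : R) (Y : nat) (dl : R).
Hypotheses (Ha : 0 < a) (HA : 0 <= A).
Let G0 := GG a A 0.
(** The error of truncating at A, later made so small that it survives the summation over all n. *)
Hypothesis Hdl : forall u, 1 <= u <= INR Y.+1 -> Rabs (GG a A (ln u - lam) - gau a (ln u - lam) * G0) <= dl.

Lemma kern_density u : 1 <= u <= INR Y.+1 -> Rabs (GG a A (ln u - lam) / sqrt u - G0 * g0 a lam (ln u)) <= dl.
Proof.
move=> Hu.
have -> : GG a A (ln u - lam) / sqrt u - G0 * g0 a lam (ln u) = / sqrt u * (GG a A (ln u - lam) - gau a (ln u - lam) * G0).
  by rewrite /g0 -sqrt_exp_ln /Rdiv; [ring|lra].
have H1 : 1 <= sqrt u by rewrite -sqrt_1; apply: sqrt_le_1_alt; lra.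
have H2 : 0 < / sqrt u <= 1.
  split; first by apply: Rinv_0_lt_compat; lra.
  by rewrite -Rinv_1; apply: Rinv_le_contravar; lra.
rewrite Rabs_mult (Rabs_pos_eq (/ _)); last lra.
have := Hdl u Hu; have := Rabs_pos (GG a A (ln u - lam) - gau a (ln u - lam) * G0); nra.
Qed.

Lemma WW_mvt n : (0 < n <= Y)%N -> exists c, INR n <= c <= INR n.+1 /\
  WW a A lam (ln (INR n.+1)) - WW a A lam (ln (INR n)) = GG a A (ln c - lam) / sqrt c.
Proof.
move=> /andP [Hn _].
have Hn0 : 0 < INR n by apply: lt_0_INR; lia.
have El : Rmin (INR n) (INR n.+1) = INR n by rewrite Rmin_left // S_INR; lra.
have Er : Rmax (INR n) (INR n.+1) = INR n.+1 by rewrite Rmax_right // S_INR; lra.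
have [|x Hx|c [Hc E]] := MVT_gen (fun u => WW a A lam (ln u)) (INR n) (INR n.+1) (fun u => GG a A (ln u - lam) / sqrt u).
- by move=> x Hx; apply: WWln_derive => //; lra.
- apply/continuity_pt_filterlim.
  have H : continuous (fun u => WW a A lam (ln u)) x.
    apply: (ex_derive_continuous (V := R_NormedModule)); eexists; apply: WWln_derive => //; lra.
  exact: H.
exists c; split; first by rewrite El Er in Hc.
by rewrite E S_INR; ring.
Qed.

Lemma INR_range n : (0 < n <= Y)%N -> 1 <= INR n <= INR Y.+1 /\ 1 <= INR n.+1 <= INR Y.+1.
Proof.
by move=> /andP [H1 H2]; repeat split; (apply: (le_INR 1) || apply: le_INR); lia.
Qed.

(** Each term is the profile at n minus its value at a mean value point of [n, n+1]; the sum is at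
    most the variation of the profile, plus two truncation errors per term. *)
Lemma kern_abs_aux X : (X <= Y)%N -> Rabs (kern a A lam X) <=
  G0 * exp (- lam / 2 + a / 8) * (VV a (ln (INR X.+1) - (lam - a / 2)) - VV a (ln 1 - (lam - a / 2))) + INR X * (2 * dl).
Proof.
rewrite kern_eq.
have HG : 0 <= G0 by exact: GG0_ge0.
set c := exp (_ + a / 8); have Hc : 0 < c by exact: exp_pos.
set mu := lam - a / 2.
elim: X => [|X IH] HX.
  rewrite big_geq // Rabs_R0 [INR 1]/= [INR 0]/=. lra.
rewrite big_nat_recr //; set S := \big[_/_]_(_ <= _ < _) _.
have {}IH := IH (ltnW HX); rewrite -/S in IH.
have HX1 : (0 < X.+1 <= Y)%N by rewrite HX.
have [w [Hw ->]] := WW_mvt X.+1 HX1.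
have [R1 R2] := INR_range _ HX1.
have D1 := kern_density (INR X.+1) R1.
have D2 := kern_density w ltac:(lra).
have L1 : ln (INR X.+1) <= ln w by apply: ln_le; lra.
have L2 : ln w <= ln (INR X.+2) by apply: ln_le; lra.
have V1 := VV_var a (ln (INR X.+1) - mu) (ln w - mu) Ha ltac:(lra).
have V2 := VV_var a (ln w - mu) (ln (INR X.+2) - mu) Ha ltac:(lra).
have V2' := Rle_trans _ _ _ (Rabs_pos _) V2.
move: D1 D2; rewrite !g0E // -/c -/mu => D1 D2.
have T := Rabs_triang S (GG a A (ln (INR X.+1) - lam) / sqrt (INR X.+1) - GG a A (ln w - lam) / sqrt w).
apply: Rle_trans T _.
have E : GG a A (ln (INR X.+1) - lam) / sqrt (INR X.+1) - GG a A (ln w - lam) / sqrt w =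
  (GG a A (ln (INR X.+1) - lam) / sqrt (INR X.+1) - G0 * (c * gau a (ln (INR X.+1) - mu)))
  + (G0 * c * (gau a (ln (INR X.+1) - mu) - gau a (ln w - mu)) +
  - (GG a A (ln w - lam) / sqrt w - G0 * (c * gau a (ln w - mu)))) by ring.
rewrite E.
have T1 := Rabs_triang (GG a A (ln (INR X.+1) - lam) / sqrt (INR X.+1) - G0 * (c * gau a (ln (INR X.+1) - mu)))
  (G0 * c * (gau a (ln (INR X.+1) - mu) - gau a (ln w - mu)) + - (GG a A (ln w - lam) / sqrt w - G0 * (c * gau a (ln w - mu)))).
have T2 := Rabs_triang (G0 * c * (gau a (ln (INR X.+1) - mu) - gau a (ln w - mu))) (- (GG a A (ln w - lam) / sqrt w - G0 * (c * gau a (ln w - mu)))).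
rewrite Rabs_Ropp Rabs_mult (Rabs_pos_eq (G0 * c)) in T2; last nra.
have HGc : 0 <= G0 * c by nra.
have M1 := Rmult_le_compat_l _ _ _ HGc V1.
have M2 := Rmult_le_compat_l _ _ _ HGc V2'.
have -> : INR X.+1 * (2 * dl) = INR X * (2 * dl) + 2 * dl by rewrite S_INR; ring.
lra.
Qed.

(** The factor exp(-lam/2 + a/8) exceeds 1 only when the peak mu is left of ln 1 = 0; then just the
    descent from g0(0) <= 1 is seen. *)
Lemma VV_range X : VV a (ln (INR X.+1) - (lam - a / 2)) - VV a (ln 1 - (lam - a / 2)) <= 2 /\
  exp (- lam / 2 + a / 8) * (VV a (ln (INR X.+1) - (lam - a / 2)) - VV a (ln 1 - (lam - a / 2))) <= 2.
Proof.
set mu := lam - a / 2; set v := ln _ - mu.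
have B : VV a v <= 2.
  by have := gau_le1 a v Ha; rewrite /VV; case: Rle_dec => /= ?; lra.
have B0 : 0 <= VV a (ln 1 - mu).
  by have := gau_le1 a (ln 1 - mu) Ha; rewrite /VV; case: Rle_dec => /= ?; lra.
split; first lra.
rewrite ln_1 in B0 *.
have [Hm|Hm] := Rle_dec 0 mu.
  have : exp (- lam / 2 + a / 8) <= 1.
    by rewrite -exp_0; apply: exp_le_compat; rewrite /mu in Hm; lra.
  have := exp_pos (- lam / 2 + a / 8); nra.
have E : VV a (0 - mu) = 2 - gau a (0 - mu) by rewrite /VV; case: Rle_dec => /= ?; lra.
have E2 : exp (- lam / 2 + a / 8) * gau a (0 - mu) <= 1.
  rewrite -g0E // /g0 -exp_0; have [_ H] := gau_le1 a (0 - lam) Ha.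
  have -> : - (0 / 2) = 0 by field. by rewrite exp_0 Rmult_1_l.
have := exp_pos (- lam / 2 + a / 8); rewrite E; nra.
Qed.

(** The first bound is uniform in lam; the second gains exp(-lam/2) when lam is large. *)
Lemma kern_abs : Rabs (kern a A lam Y) <= 2 * G0 + INR Y * (2 * dl) /\
  Rabs (kern a A lam Y) <= 2 * G0 * exp (- lam / 2 + a / 8) + INR Y * (2 * dl).
Proof.
have := kern_abs_aux Y (leqnn _). have [V1 V2] := VV_range Y.
have HG : 0 <= G0 by exact: GG0_ge0.
have He := exp_pos (- lam / 2 + a / 8).
move=> H; split; apply: Rle_trans H _; apply: Rplus_le_compat_r.
  by rewrite Rmult_assoc; nra.
have : 0 <= G0 * exp (- lam / 2 + a / 8) by nra.
move: V1; set x := _ - _; nra.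
Qed.

(** The shape is chosen so that, after du = e^v dv, the majorant integrates to an arctangent. *)
Lemma g0_majorant v : a <= 1 -> g0 a lam v <=
  8 * exp (lam / 2) * (exp (- v) * / (1 + (v - lam) / sqrt a * ((v - lam) / sqrt a))).
Proof.
move=> Ha1.
have Hs : 0 < sqrt a by exact: sqrt_lt_R0.
have Es : sqrt a * sqrt a = a by apply: sqrt_sqrt; lra.
have Hs1 : sqrt a <= 1 by nra.
set x := (v - lam) / sqrt a.
have Ex : v - lam = sqrt a * x by rewrite /x; field; lra.
have Egau : gau a (v - lam) = exp (- (x * x / 2)).
  rewrite /gau; congr exp; rewrite Ex -{3}Es; field; lra.
rewrite /g0 Egau.
have -> : exp (- (v / 2)) = exp (lam / 2) * exp (- v) * exp (sqrt a * x / 2).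
  by rewrite -!exp_plus; congr exp; rewrite -Ex; field.
have K : exp (sqrt a * x / 2) * exp (- (x * x / 2)) <= 8 * / (1 + x * x).
  rewrite -exp_plus.
  have H1 : sqrt a * x / 2 + - (x * x / 2) <= 1 / 4 + - (x * x / 4).
    have : 0 <= (x - sqrt a) * (x - sqrt a) by exact: Rle_0_sqr.
    rewrite Rmult_minus_distr_l !Rmult_minus_distr_r Es; lra.
  apply: Rle_trans (exp_le_compat _ _ H1) _.
  rewrite exp_plus exp_Ropp.
  have H2 : exp (1 / 4) <= 2.
    have E4 : exp (1 / 4) * exp (1 / 4) <= 3.
      rewrite -exp_plus; apply: Rle_trans exp_le_3; apply: exp_le_compat; lra.
    have := exp_pos (1 / 4); nra.
  have H3 : / exp (x * x / 4) <= 4 * / (1 + x * x).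
    have H4 : (1 + x * x) / 4 <= exp (x * x / 4).
      have := exp_ineq1_le (x * x / 4); lra.
    have Hx : 0 < 1 + x * x by nra.
    have -> : 4 * / (1 + x * x) = / ((1 + x * x) / 4) by field; lra.
    by apply: Rinv_le_contravar => //; lra.
  have P1 : 0 < / exp (x * x / 4) by apply: Rinv_0_lt_compat; exact: exp_pos.
  have := exp_pos (1 / 4); nra.
have P := Rmult_lt_0_compat _ _ (exp_pos (lam / 2)) (exp_pos (- v)).
have := Rmult_le_compat_l _ _ _ (Rlt_le _ _ P) K; lra.
Qed.

(** The sum over n is kept whole and only the subtracted integral is estimated: by [g0_majorant] it
    is at most 8 pi exp(lam/2) sqrt a, and 8 pi <= 32. *)
Lemma kern_lower : a <= 1 ->
  G0 * (\rsum_(1 <= n < Y.+1) g0 a lam (ln (INR n))) - G0 * (32 * exp (lam / 2) * sqrt a) - INR Y * (2 * dl)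
  <= kern a A lam Y.
Proof.
move=> Ha1; rewrite kern_eq.
have HG : 0 <= G0 by exact: GG0_ge0.
have Hs : 0 < sqrt a by exact: sqrt_lt_R0.
have HPI := PI_4.
pose Psi v := 8 * exp (lam / 2) * sqrt a * atan ((v - lam) / sqrt a).
suff H X : (X <= Y)%N -> G0 * (\rsum_(1 <= n < X.+1) g0 a lam (ln (INR n)))
   - G0 * (Psi (ln (INR X.+1)) - Psi (ln 1)) - INR X * (2 * dl) <=
   \rsum_(1 <= n < X.+1) (GG a A (ln (INR n) - lam) / sqrt (INR n) -
     (WW a A lam (ln (INR n.+1)) - WW a A lam (ln (INR n)))).
  have := H Y (leqnn _).
  have Hr : Psi (ln (INR Y.+1)) - Psi (ln 1) <= 32 * exp (lam / 2) * sqrt a.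
    have [B1 B2] := atan_bound ((ln (INR Y.+1) - lam) / sqrt a).
    have [B3 B4] := atan_bound ((ln 1 - lam) / sqrt a).
    have HP : 0 <= exp (lam / 2) * sqrt a by apply: Rmult_le_pos; [exact/Rlt_le/exp_pos|lra].
    rewrite /Psi; nra.
  have := Rmult_le_compat_l _ _ _ HG Hr; lra.
elim: X => [|X IH] HX.
  rewrite !big_geq // [INR 1]/= [INR 0]/=; lra.
rewrite (rsum_recr _ 1 X.+1) // (rsum_recr _ 1 X.+1) //.
set S := \big[_/_]_(_ <= _ < _) g0 _ _ _; set S' := \big[_/_]_(_ <= _ < _) (_ - _).
have {}IH := IH (ltnW HX); rewrite -/S -/S' in IH.
have HX1 : (0 < X.+1 <= Y)%N by rewrite HX.
have [R1 R2] := INR_range _ HX1.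
have D1 := kern_density (INR X.+1) R1.
have Hn0 : 0 < INR X.+1 by lra.
have HS : INR X.+2 - INR X.+1 = 1 by rewrite !S_INR; ring.
have step : WW a A lam (ln (INR X.+2)) - WW a A lam (ln (INR X.+1)) <=
   G0 * (Psi (ln (INR X.+2)) - Psi (ln (INR X.+1))) + dl.
  have [w [Hw E]] := WW_mvt X.+1 HX1.
  have El : Rmin (INR X.+1) (INR X.+2) = INR X.+1 by rewrite Rmin_left //; lra.
  have Er : Rmax (INR X.+1) (INR X.+2) = INR X.+2 by rewrite Rmax_right //; lra.
  pose dpsi u := 8 * exp (lam / 2) * (exp (- ln u) * / (1 + (ln u - lam) / sqrt a * ((ln u - lam) / sqrt a))).
  have Dd u : 0 < u -> is_derive (fun u => WW a A lam (ln u) - G0 * Psi (ln u)) u (GG a A (ln u - lam) / sqrt u - G0 * dpsi u).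
    move=> Hu; apply: (is_derive_minus (V := R_NormedModule)); first exact: WWln_derive.
    apply: is_derive_scal; rewrite /Psi /dpsi.
    have Hp : 0 < 1 + (ln u - lam) / sqrt a * ((ln u - lam) / sqrt a).
      by have := Rle_0_sqr ((ln u - lam) / sqrt a); rewrite /Rsqr; lra.
    rewrite exp_Ropp exp_ln //.
    move: Hp; rewrite /Rdiv /Rminus => Hp; auto_derive; first by repeat split.
    rewrite /Rsqr; move: Hp; set q := _ * / sqrt a => Hp. field; repeat split; lra.
  have [|x Hx|c [Hc Ec]] := MVT_gen (fun u => WW a A lam (ln u) - G0 * Psi (ln u)) (INR X.+1) (INR X.+2)
     (fun u => GG a A (ln u - lam) / sqrt u - G0 * dpsi u).
  - by move=> x Hx; apply: Dd; lra.
  - apply/continuity_pt_filterlim.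
    have H : continuous (fun u => WW a A lam (ln u) - G0 * Psi (ln u)) x.
      apply: (ex_derive_continuous (V := R_NormedModule)); eexists; apply: Dd; lra.
    exact: H.
  rewrite El Er in Hc.
  have D2 := kern_density c ltac:(lra).
  have D3 := Rmult_le_compat_l _ _ _ HG (g0_majorant (ln c) Ha1).
  have D4 := Rle_abs (GG a A (ln c - lam) / sqrt c - G0 * g0 a lam (ln c)).
  rewrite HS Rmult_1_r in Ec.
  rewrite -/(dpsi c) in D3.
  lra.
have D5 := Rle_abs (- (GG a A (ln (INR X.+1) - lam) / sqrt (INR X.+1) - G0 * g0 a lam (ln (INR X.+1)))).
rewrite Rabs_Ropp in D5.
have -> : INR X.+1 * (2 * dl) = INR X * (2 * dl) + 2 * dl by rewrite S_INR; ring.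
rewrite Rmult_plus_distr_l. lra.
Qed.
End Kern.

(** * A weight vanishing at t = 0, to discard small ordinates *)

Lemma is_RInt_rsum (I : Type) (s : seq I) (f : I -> R -> R) (l : I -> R) a b :
  (forall i, is_RInt (f i) a b (l i)) ->
  is_RInt (fun x => \rsum_(i <- s) f i x) a b (\rsum_(i <- s) l i).
Proof.
move=> H; elim: s => [|x s IH].
  rewrite big_nil; apply: (is_RInt_ext (fun _ => 0)); first by move=> y _; rewrite big_nil.
  have := is_RInt_const (V := R_NormedModule) a b 0.
  by rewrite /scal /= /mult /= Rmult_0_r.
rewrite big_cons; apply: (is_RInt_ext (fun y => f x y + \rsum_(i <- s) f i y)).
  by move=> y _; rewrite big_cons.
exact: (is_RInt_plus (V := R_NormedModule) _ _ _ _ _ _ (H x) IH).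
Qed.

Section Weighted.
Variables (b A lam : R) (X : nat).

Definition emr t := Re (em_sum (hl t) X * (cos (t * lam), sin (t * lam)))%C.

(** The extra factor is small for t well below 1/sqrt b. Expanding it gives an alternating
    combination of the Gaussians [gw (a + j b)], hence of kernels already estimated. *)
Definition wkern k a := RInt (fun t => gw a t * ((1 - gw b t) ^ k * emr t)) 0 A.

Lemma pow_gw_cont k t : continuous (fun t => (1 - gw b t) ^ k) t.
Proof.
by apply: (ex_derive_continuous (V := R_NormedModule)); rewrite /gw; auto_derive.
Qed.

Lemma wkern_int k a : is_RInt (fun t => gw a t * ((1 - gw b t) ^ k * emr t)) 0 A (wkern k a).
Proof.
apply: (RInt_correct (V := R_CompleteNormedModule)); apply: ex_RInt_gw => t.
apply: (continuous_mult (K := R_AbsRing)); [exact: pow_gw_cont|exact: em_re_cont].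
Qed.

Lemma wkern_S k a : wkern k.+1 a = wkern k a - wkern k (a + b).
Proof.
apply: is_RInt_unique.
have := is_RInt_minus (V := R_NormedModule) _ _ _ _ _ _ (wkern_int k a) (wkern_int k (a + b)).
apply: is_RInt_ext => t _.
have -> : gw (a + b) t = gw a t * gw b t by rewrite /gw -exp_plus; congr exp; field.
rewrite /minus /plus /opp /=; ring.
Qed.

Lemma wkern_0 a : wkern 0 a = kern a A lam X.
Proof. by apply: RInt_ext => t _; rewrite /= Rmult_1_l. Qed.

Lemma wkern_bound k a Bd : 0 <= b -> (forall a', a <= a' -> Rabs (kern a' A lam X) <= Bd) ->
  Rabs (wkern k a) <= 2 ^ k * Bd.
Proof.
move=> Hb; elim: k a => [|k IH] a H; first by rewrite wkern_0 /= Rmult_1_l; apply: H; lra.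
rewrite wkern_S.
have H1 := IH a H.
have H2 := IH (a + b) (fun a' Ha' => H a' ltac:(lra)).
have := Rabs_triang (wkern k a) (- wkern k (a + b)); rewrite Rabs_Ropp /= /Rminus; lra.
Qed.

(** Only one term of the expansion keeps the wide Gaussian [gw a]; the 2^k - 1 others, counted with
    multiplicity, are each at most Bd. *)
Lemma wkern_lower k a Bd : 0 <= b -> (forall a', a + b <= a' -> Rabs (kern a' A lam X) <= Bd) ->
  kern a A lam X - (2 ^ k - 1) * Bd <= wkern k a.
Proof.
move=> Hb H; elim: k => [|k IH]; first by rewrite wkern_0 /=; lra.
rewrite wkern_S.
have H2 := wkern_bound k (a + b) Bd Hb H.
have := Rle_abs (wkern k (a + b)); rewrite /=; lra.
Qed.
End Weighted.

Lemma gw_small_error a0 L dl : 0 < a0 -> 0 < dl -> 0 <= L -> exists A0, 0 <= A0 /\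
  forall A, A0 <= A -> forall a xi, a0 <= a -> Rabs xi <= L ->
  Rabs (GG a A xi - gau a xi * GG a A 0) <= dl.
Proof.
move=> Ha0 Hdl HL.
set M := 2 * (L + 1) / (a0 * a0 * dl).
have HM : 0 < M.
  apply: Rdiv_lt_0_compat; first lra.
  by apply: Rmult_lt_0_compat => //; apply: Rmult_lt_0_compat.
exists (M + 1); split; first lra.
move=> A HA a xi Ha Hxi.
have HA0 : 0 <= A by lra.
apply: Rle_trans (GG_gauss a A xi ltac:(lra) HA0) _.
have Hg : gw a A <= 2 / (a0 * M).
  rewrite /gw exp_Ropp.
  have H1 : a0 * M / 2 <= exp (a * (A * A) / 2).
    apply: Rle_trans (exp_ineq1_le _).
    have : M <= A * A by nra.
    move=> H; have : a0 * M <= a * (A * A).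
      by apply: Rmult_le_compat; lra.
    lra.
  have Hp : 0 < a0 * M by apply: Rmult_lt_0_compat.
  have -> : 2 / (a0 * M) = / (a0 * M / 2) by field; lra.
  by apply: Rinv_le_contravar => //; lra.
have Hi : / a <= / a0 by apply: Rinv_le_contravar.
have Hg0 := gw_pos a A.
have Hi0 : 0 < / a by apply: Rinv_0_lt_compat; lra.
apply: Rle_trans (_ : L * (2 / (a0 * M)) * / a0 <= _).
  apply: Rmult_le_compat => //; [|lra|].
    by apply: Rmult_le_pos; [exact: Rabs_pos|lra].
  by apply: Rmult_le_compat => //; [exact: Rabs_pos|lra].
have -> : L * (2 / (a0 * M)) * / a0 = dl * (L / (L + 1)) by rewrite /M; field; lra.
have : L / (L + 1) <= 1.
  apply: (Rmult_le_reg_r (L + 1)); first lra.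
  have -> : L / (L + 1) * (L + 1) = L by field; lra.
  lra.
have : 0 <= L / (L + 1) by apply: Rmult_le_pos; [lra|apply/Rlt_le/Rinv_0_lt_compat; lra].
nra.
Qed.

(** * Resonator polynomials on a grid of frequencies *)

(** Since d <= d^2 for integers, each side of j is dominated by a geometric series of ratio
    exp(-1/2) <= 2/3, whose sum is at most 3. *)
Lemma gauss_row_sum K (j : nat) : \rsum_(i < K) exp (- ((INR j - INR i) * (INR j - INR i) / 2)) <= 6.
Proof.
set q := exp (- (1 / 2)).
have Hq0 : 0 < q by exact: exp_pos.
have Hq : q <= 2 / 3.
  rewrite /q exp_Ropp.
  have := exp_ineq1_le (1 / 2) => H.
  have -> : 2 / 3 = / (3 / 2) by field.
  by apply: Rinv_le_contravar; lra.
have geo n : \rsum_(0 <= i < n) q ^ i <= 3.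
  suff : \rsum_(0 <= i < n) q ^ i <= 3 - 3 * q ^ n by have := pow_lt q n Hq0; lra.
  elim: n => [|n IH]; first by rewrite big_geq //=; lra.
  rewrite rsum_recr // [q ^ n.+1]/=; have Hp := pow_lt q n Hq0.
  have : q * q ^ n <= 2 / 3 * q ^ n by apply: Rmult_le_compat_r; lra.
  lra.
have term (d : nat) x : x * x = INR d * INR d -> exp (- (x * x / 2)) <= q ^ d.
  move=> ->.
  have -> : q ^ d = exp (- (INR d / 2)).
    rewrite /q; elim: d => [|d IH]; first by rewrite /= /Rdiv Rmult_0_l Ropp_0 exp_0.
    rewrite [LHS]/= IH -exp_plus S_INR; congr exp; field.
  apply: exp_le_compat.
  have : INR d <= INR d * INR d.
    case: d => [|d]; first by rewrite /=; lra.
    have : 1 <= INR d.+1 by apply: (le_INR 1); lia.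
    nra.
  lra.
rewrite -(big_mkord predT (fun i => exp (- ((INR j - INR i) * (INR j - INR i) / 2)))).
have left n : (n <= j)%N -> \rsum_(0 <= i < n) exp (- ((INR j - INR i) * (INR j - INR i) / 2)) <= 3 * 1.
  move=> Hn; rewrite Rmult_1_r.
  apply: Rle_trans (_ : \rsum_(0 <= i < n) q ^ (j - i) <= _).
    rewrite !big_nat; apply: rsum_le => i /andP [_ Hi]; apply: term.
    by rewrite minus_INR; [ring|lia].
  rewrite big_nat_rev /= add0n.
  apply: Rle_trans (geo n).
  rewrite !big_nat; apply: rsum_le => i /andP [_ Hi].
  have -> : (j - (n - i.+1) = i + (j - n).+1)%N by lia.
  rewrite -[X in _ <= X]Rmult_1_r pow_add; apply: Rmult_le_compat_l; first exact/Rlt_le/pow_lt.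
  by rewrite -(pow1 (j - n).+1); apply: pow_incr; lra.
have right n : \rsum_(j <= i < j + n) exp (- ((INR j - INR i) * (INR j - INR i) / 2)) <= 3.
  apply: Rle_trans (geo n).
  rewrite -{1}[j]add0n (addnC j) big_addn addnK.
  apply: rsum_le => i _; apply: term; rewrite plus_INR; ring.
case: (leqP K j) => HK; first by apply: Rle_trans (left K HK) _; lra.
rewrite (big_cat_nat (n := j)) //=; last exact: ltnW.
have Hl := left j (leqnn _); have Hr := right (K - j)%N.
rewrite subnKC in Hr; last exact: ltnW.
lra.
Qed.

Section Poly.
Variables (K : nat) (tau : R).
Implicit Types r : 'I_K -> R.

(** The grid step 1/tau is the resolution of a Gaussian of width tau; an integer m will sit at the j
    just below tau ln m. *)
Definition ph (j : 'I_K) (t : R) := t * (INR j / tau).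
(** |R(t)|^2 for the polynomial R(t) = sum of r_j e^(i j t / tau). *)
Definition q2 r t :=
  (\rsum_(j <- index_enum 'I_K) (r j * cos (ph j t))) * (\rsum_(j <- index_enum 'I_K) (r j * cos (ph j t))) +
  (\rsum_(j <- index_enum 'I_K) (r j * sin (ph j t))) * (\rsum_(j <- index_enum 'I_K) (r j * sin (ph j t))).

Definition lamb (j j' : 'I_K) := (INR j' - INR j) / tau.

Lemma ph_cos j j' t : cos (t * lamb j j') = cos (ph j t) * cos (ph j' t) + sin (ph j t) * sin (ph j' t).
Proof.
have -> : t * lamb j j' = ph j' t - ph j t by rewrite /lamb /ph /Rdiv; ring.
rewrite cos_minus; ring.
Qed.

Lemma ph_sin j j' t : sin (t * lamb j j') = cos (ph j t) * sin (ph j' t) - sin (ph j t) * cos (ph j' t).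
Proof.
have -> : t * lamb j j' = ph j' t - ph j t by rewrite /lamb /ph /Rdiv; ring.
rewrite sin_minus; ring.
Qed.

Lemma rsum2 (f g : 'I_K -> R) : (\rsum_(j <- index_enum 'I_K) f j) * (\rsum_(j <- index_enum 'I_K) g j) =
  \rsum_(j <- index_enum 'I_K) \rsum_(j' <- index_enum 'I_K) (f j * g j').
Proof. by rewrite big_distrlr. Qed.

Lemma rsum2_plus (f g : 'I_K -> 'I_K -> R) :
  \rsum_(j <- index_enum 'I_K) \rsum_(j' <- index_enum 'I_K) (f j j' + g j j') =
  \rsum_(j <- index_enum 'I_K) \rsum_(j' <- index_enum 'I_K) f j j' + \rsum_(j <- index_enum 'I_K) \rsum_(j' <- index_enum 'I_K) g j j'.
Proof. by rewrite -big_split; apply: eq_bigr => j _; rewrite -big_split. Qed.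

Lemma rsum2_mull c (f : 'I_K -> 'I_K -> R) :
  c * (\rsum_(j <- index_enum 'I_K) \rsum_(j' <- index_enum 'I_K) f j j') =
  \rsum_(j <- index_enum 'I_K) \rsum_(j' <- index_enum 'I_K) (c * f j j').
Proof. by rewrite rsum_mull; apply: eq_bigr => j _; rewrite rsum_mull. Qed.

Lemma rsum2_le (f g : 'I_K -> 'I_K -> R) : (forall j j', f j j' <= g j j') ->
  \rsum_(j <- index_enum 'I_K) \rsum_(j' <- index_enum 'I_K) f j j' <=
  \rsum_(j <- index_enum 'I_K) \rsum_(j' <- index_enum 'I_K) g j j'.
Proof. by move=> H; apply: rsum_le => j _; apply: rsum_le => j' _. Qed.

Lemma eq_rsum2 (f g : 'I_K -> 'I_K -> R) : (forall j j', f j j' = g j j') ->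
  \rsum_(j <- index_enum 'I_K) \rsum_(j' <- index_enum 'I_K) f j j' =
  \rsum_(j <- index_enum 'I_K) \rsum_(j' <- index_enum 'I_K) g j j'.
Proof. by move=> H; apply: eq_bigr => j _; apply: eq_bigr => j' _. Qed.

Lemma q2_expand r t : q2 r t =
  \rsum_(j <- index_enum 'I_K) \rsum_(j' <- index_enum 'I_K) (r j * r j' * cos (t * lamb j j')).
Proof.
rewrite /q2 !rsum2 -rsum2_plus; apply: eq_rsum2 => j j'; rewrite ph_cos; ring.
Qed.

Lemma q2_le r t : (forall j, 0 <= r j) ->
  q2 r t <= (\rsum_(j <- index_enum 'I_K) r j) * (\rsum_(j <- index_enum 'I_K) r j).
Proof.
move=> Hr; rewrite q2_expand rsum2; apply: rsum2_le => j j'.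
have [_ H] := COS_bound (t * lamb j j').
have := Hr j; have := Hr j'; have := Rmult_le_pos _ _ (Hr j) (Hr j'); nra.
Qed.

Lemma q2_ge0 r t : 0 <= q2 r t.
Proof. by rewrite /q2; apply: Rplus_le_le_0_compat; exact: Rle_0_sqr. Qed.

(** The double sum is Re(z conj(R1) R2), and |R1 R2| <= (|R1|^2 + |R2|^2)/2. *)
Lemma cross_bound r1 r2 (z : C) t :
  \rsum_(j <- index_enum 'I_K) \rsum_(j' <- index_enum 'I_K)
     (r1 j * r2 j' * Re (z * (cos (t * lamb j j'), sin (t * lamb j j')))%C) <=
  Cmod z * ((q2 r1 t + q2 r2 t) / 2).
Proof.
set C1 := \rsum_(j <- index_enum 'I_K) (r1 j * cos (ph j t)).
set S1 := \rsum_(j <- index_enum 'I_K) (r1 j * sin (ph j t)).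
set C2 := \rsum_(j <- index_enum 'I_K) (r2 j * cos (ph j t)).
set S2 := \rsum_(j <- index_enum 'I_K) (r2 j * sin (ph j t)).
pose Z1 : C := (C1, - S1); pose Z2 : C := (C2, S2).
have -> : \rsum_(j <- index_enum 'I_K) \rsum_(j' <- index_enum 'I_K)
     (r1 j * r2 j' * Re (z * (cos (t * lamb j j'), sin (t * lamb j j')))%C) =
   Re (z * (Z1 * Z2))%C.
  have -> : Re (z * (Z1 * Z2))%C =
    Re z * (C1 * C2 + S1 * S2) + - Im z * (C1 * S2 + - (1) * (S1 * C2)) by rewrite /Re /Im /=; ring.
  rewrite /C1 /C2 /S1 /S2 !rsum2 !rsum2_mull -!rsum2_plus !rsum2_mull -!rsum2_plus.
  apply: eq_rsum2 => j j'; rewrite ph_cos ph_sin /Re /Im /=; ring.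
apply: Rle_trans (Rle_abs _) _; apply: Rle_trans (re_le_Cmod _) _.
rewrite !Cmod_mult; apply: Rmult_le_compat_l; first exact: Cmod_ge_0.
have E1 : Cmod Z1 * Cmod Z1 = q2 r1 t.
  have := Cmod2_alt Z1; rewrite /Re /Im /= !Rmult_1_r => ->; rewrite /q2 -/C1 -/S1; ring.
have E2 : Cmod Z2 * Cmod Z2 = q2 r2 t.
  have := Cmod2_alt Z2; rewrite /Re /Im /= !Rmult_1_r => ->; rewrite /q2 -/C2 -/S2; ring.
have := Rle_0_sqr (Cmod Z1 - Cmod Z2); rewrite /Rsqr; nra.
Qed.
End Poly.

Lemma gw_moment a A : 0 < a -> 0 <= A -> exists I, is_RInt (fun t => (1 + t) * gw a t) 0 A I /\ I <= 4 / sqrt a + / a.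
Proof.
move=> Ha HA.
have H1 := RInt_correct (V := R_CompleteNormedModule) _ _ _ (ex_RInt_gw a _ 0 A (cos_cont 0)).
have H2 : is_RInt (fun t => t * gw a t) 0 A (- / a * gw a A - - / a * gw a 0).
  apply: (is_RInt_derive (V := R_CompleteNormedModule) (fun t => - / a * gw a t)) => t _.
    by rewrite /gw /Rdiv; auto_derive => //; field; lra.
  by apply: (ex_derive_continuous (V := R_NormedModule)); rewrite /gw; auto_derive.
eexists; split.
  have := is_RInt_plus (V := R_NormedModule) _ _ _ _ _ _ H1 H2.
  apply: is_RInt_ext => t _; rewrite /plus /= Rmult_0_r cos_0; ring.
have := GG0_upper a A Ha HA; rewrite /GG => H; apply: Rplus_le_compat => //.
have -> : gw a 0 = 1 by rewrite /gw -exp_0; congr exp; field.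
have := gw_pos a A; have := Rinv_0_lt_compat _ Ha; nra.
Qed.

Lemma hl_bound X t : 0 <= t -> Cmod (em_sum (hl t) X) <= 3 * (1 + t).
Proof.
move=> Ht.
have := em_sum_bound (hl t) X (half_ne1 t) ltac:(rewrite /hl /Re /=; lra).
have -> : Re (hl t) = 1 / 2 by [].
have : Cmod (hl t) <= 1 + t.
  have -> : hl t = (RtoC (1 / 2) + Ci * RtoC t)%C by apply: injective_projections => /=; ring.
  apply: Rle_trans (Cmod_triangle _ _) _; rewrite Cmod_mult Cmod_Ci !Cmod_R !Rabs_pos_eq; lra.
have -> : 1 + / (1 / 2) = 3 by field.
lra.
Qed.

(** * The resonance inequality for coefficients on the grid *)

Section Resonance.
Variables (K X k : nat) (tau U T1 T Nn V : R) (r1 r2 : 'I_K -> R).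
Hypotheses (Htau : 1 <= tau) (HU : 0 < U) (HT1 : 0 <= T1) (HT : T1 <= T) (HN : 1 <= Nn) (HV0 : 0 <= V)
  (Hr1 : forall j, 0 <= r1 j) (Hr2 : forall j, 0 <= r2 j)
  (Hn1 : \rsum_(j <- index_enum 'I_K) (r1 j * r1 j) <= 1)
  (Hn2 : \rsum_(j <- index_enum 'I_K) (r2 j * r2 j) <= 1)
  (Hs1 : (\rsum_(j <- index_enum 'I_K) r1 j) * (\rsum_(j <- index_enum 'I_K) r1 j) <= Nn)
  (Hs2 : (\rsum_(j <- index_enum 'I_K) r2 j) * (\rsum_(j <- index_enum 'I_K) r2 j) <= Nn)
  (HV : forall t, T1 <= t <= T -> Cmod (em_sum (hl t) X) <= V).

(** The weight is [gw a0], of width tau, times (1 - gw b)^k with [gw b] of width U; [e1] and [e2]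
    measure what leaks below T1 and beyond T. *)
Let a0 := / (tau * tau).
Let b := / (U * U).
Let e1 := (T1 * T1 / (2 * (U * U))) ^ k.
Let e2 := exp (- (T * T / (4 * (tau * tau)))).

Lemma Htau2 : 0 < tau * tau. Proof. nra. Qed.
Lemma Ha0 : 0 < a0. Proof. exact: Rinv_0_lt_compat Htau2. Qed.
Lemma Hb0 : 0 < b. Proof. by apply: Rinv_0_lt_compat; nra. Qed.
Lemma Hsa0 : sqrt a0 = / tau.
Proof.
apply: sqrt_lem_1; [exact/Rlt_le/Ha0|apply/Rlt_le/Rinv_0_lt_compat; lra|].
by rewrite /a0 Rinv_mult.
Qed.
Lemma Ha01 : a0 <= 1.
Proof. rewrite /a0 -Rinv_1; apply: Rinv_le_contravar; nra. Qed.

(** Below T1 use 1 - exp(-x) <= x with x = b t^2/2. Beyond T spend half of the Gaussian exponent on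
    [e2]; the other half makes the growth 1 + t integrable. *)
Lemma weight_bound t : 0 <= t ->
  0 <= gw a0 t * (1 - gw b t) ^ k <= gw a0 t /\
  (~ (T1 <= t <= T) -> gw a0 t * (1 - gw b t) ^ k <= (e1 + e2) * gw (a0 / 2) t).
Proof.
move=> Ht.
have Hg := gw_pos a0 t.
have Hb1 : 0 <= 1 - gw b t <= b * (t * t) / 2.
  have Hb := Hb0; have Ht2 : 0 <= t * t by nra.
  have Hbt : 0 <= b * (t * t) / 2 by nra.
  split.
    have : gw b t <= 1 by rewrite /gw -exp_0; apply: exp_le_compat; lra.
    lra.
  have := exp_ineq1_le (- (b * (t * t) / 2)); rewrite /gw; lra.
have Hp : 0 <= (1 - gw b t) ^ k <= 1.
  split; first by apply: pow_le; lra.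
  have := pow_incr (1 - gw b t) 1 k; rewrite pow1; apply; have := gw_pos b t; lra.
split; first nra.
move=> Hout.
have Hg2 : gw a0 t <= gw (a0 / 2) t.
  apply: exp_le_compat; have := Ha0; have : 0 <= t * t by nra. nra.
have Hg3 := gw_pos (a0 / 2) t.
have He2 : 0 < e2 by exact: exp_pos.
have He1 : 0 <= e1.
  apply: pow_le; apply: Rmult_le_pos; first nra.
  by apply/Rlt_le/Rinv_0_lt_compat; nra.
have [Hlt|Hlt] := Rlt_dec t T1.
  have : (1 - gw b t) ^ k <= e1.
    apply: pow_incr; split; first lra.
    apply: Rle_trans (proj2 Hb1) _.
    have -> : T1 * T1 / (2 * (U * U)) = b * (T1 * T1) / 2 by rewrite /b; field; lra.
    have := Hb0; have : t * t <= T1 * T1 by nra. nra.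
  move=> H.
  apply: Rle_trans (_ : gw (a0 / 2) t * e1 <= _); last nra.
  by apply: Rmult_le_compat => //; lra.
have HtT : T < t by lra.
have : gw a0 t <= e2 * gw (a0 / 2) t.
  rewrite /gw /e2 -exp_plus; apply: exp_le_compat.
  have : T * T <= t * t by nra.
  move=> H; have := Rmult_le_compat_l _ _ _ (Rlt_le _ _ Ha0) H.
  have -> : T * T / (4 * (tau * tau)) = a0 * (T * T) / 4 by rewrite /a0; field; lra.
  lra.
nra.
Qed.

(** Schur's test: the Gaussian Gram matrix of the grid is symmetric with row sums at most 6, so the
    frequencies are almost orthogonal. *)
Lemma schur (r : 'I_K -> R) : (forall j, 0 <= r j) -> \rsum_(j <- index_enum 'I_K) (r j * r j) <= 1 ->
  \rsum_(j <- index_enum 'I_K) \rsum_(j' <- index_enum 'I_K) (r j * r j' * gau a0 (lamb K tau j j')) <= 6.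
Proof.
move=> Hr Hn.
have E j j' : gau a0 (lamb K tau j j') = exp (- ((INR j - INR j') * (INR j - INR j') / 2)).
  rewrite /gau /lamb /a0; congr exp; field; lra.
have Esym j j' : gau a0 (lamb K tau j j') = gau a0 (lamb K tau j' j).
  by rewrite !E; congr (exp (- (_ / 2))); ring.
have row (j : 'I_K) : \rsum_(j' <- index_enum 'I_K) gau a0 (lamb K tau j j') <= 6.
  apply: Rle_trans (gauss_row_sum K j); apply: rsum_le => i _; rewrite E; lra.
apply: Rle_trans (_ : \rsum_(j <- index_enum 'I_K) \rsum_(j' <- index_enum 'I_K)
   (r j * r j / 2 * gau a0 (lamb K tau j j') + r j' * r j' / 2 * gau a0 (lamb K tau j j')) <= _).
  apply: rsum2_le => j j'; have := exp_pos (- (lamb K tau j j' * lamb K tau j j' / (2 * a0))).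
  rewrite -/(gau _ _); have := Rle_0_sqr (r j - r j'); rewrite /Rsqr; nra.
rewrite rsum2_plus [X in _ + X]exchange_big /=.
have H : \rsum_(j <- index_enum 'I_K) \rsum_(j' <- index_enum 'I_K) (r j * r j / 2 * gau a0 (lamb K tau j j')) <= 3.
  apply: Rle_trans (_ : \rsum_(j <- index_enum 'I_K) (3 * (r j * r j)) <= _).
    apply: rsum_le => j _; rewrite -rsum_mull; have := row j; have := Rle_0_sqr (r j); rewrite /Rsqr; nra.
  rewrite -rsum_mull; lra.
have -> : \rsum_(j <- index_enum 'I_K) \rsum_(i <- index_enum 'I_K) (r j * r j / 2 * gau a0 (lamb K tau i j)) =
   \rsum_(j <- index_enum 'I_K) \rsum_(j' <- index_enum 'I_K) (r j * r j / 2 * gau a0 (lamb K tau j j')).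
  by apply: eq_rsum2 => j j'; rewrite Esym.
apply: (Rle_trans _ _ _ (Rplus_le_compat _ _ _ _ H H)); lra.
Qed.

(** The cut-off keeps the loss exp(lam/2) of [kern_lower] below 2 Nn; beyond it the kernel is merely
    shown to be small by [kern_abs], and the pair is credited with 0. *)
Definition res_pair (j j' : 'I_K) :=
  if Rle_dec (lamb K tau j j') (2 * ln (2 * Nn))
  then \rsum_(1 <= n < X.+1) g0 a0 (lamb K tau j j') (ln (INR n)) else 0.

Hypotheses (HC1 : Nn * Nn <= tau) (HC2 : 2 ^ k * (Nn * U) <= tau) (HC3 : Nn * (e1 + e2) * tau <= 1) (HX : (0 < X)%N).

(** The weighted integral J of Re(em_sum conj(R1) R2) is estimated twice. From below, the kernel
    bounds give G0 times the left side minus O(tau). From above, |em_sum| <= V on [T1, T] with mean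
    squares bounded by [schur], and [hl_bound] times the leakage elsewhere. Then divide by G0, which
    is of order tau. *)
Lemma resonance :
  \rsum_(j <- index_enum 'I_K) \rsum_(j' <- index_enum 'I_K) (r1 j * r2 j' * res_pair j j') <= 6 * V + 620.
Proof.
have Ha := Ha0. have Hb := Hb0. have Ht2 := Htau2.
have Hs1' := Hs1; have Hs2' := Hs2.
set s1 := \rsum_(j <- index_enum 'I_K) r1 j in Hs1'; set s2 := \rsum_(j <- index_enum 'I_K) r2 j in Hs2'.
have Hs1p : 0 <= s1 by apply: rsum_ge0 => j _; exact: Hr1.
have Hs2p : 0 <= s2 by apply: rsum_ge0 => j _; exact: Hr2.
have Hs12 : s1 * s2 <= Nn by have := Rle_0_sqr (s1 - s2); rewrite /Rsqr; nra.
have H2k : 1 <= 2 ^ k by apply: pow_R1_Rle; lra.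
(* Chosen so that both 2^k Nn (2 X dl) and dl Nn V are at most 1. *)
set dl := / (2 * INR X * Nn * 2 ^ k * (V + 1)).
have HXR : 1 <= INR X by apply: (le_INR 1); lia.
have HXN : 1 <= INR X * Nn by nra.
have HXNk : 1 <= INR X * Nn * 2 ^ k by nra.
have Hdl : 0 < dl by apply: Rinv_0_lt_compat; apply: Rmult_lt_0_compat; nra.
have Edl : 2 * INR X * Nn * 2 ^ k * (V + 1) * dl = 1 by rewrite /dl; field; lra.
set L := ln (INR X.+1) + INR K / tau.
have HlnX : 0 <= ln (INR X.+1).
  by rewrite -ln_1; apply: ln_le; [lra|apply: (le_INR 1); lia].
have HKt : 0 <= INR K / tau by apply: Rmult_le_pos; [exact: pos_INR|apply/Rlt_le/Rinv_0_lt_compat; lra].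
have HL : 0 <= L by rewrite /L; lra.
have Hlam j j' : Rabs (lamb K tau j j') <= INR K / tau.
  rewrite /lamb /Rdiv Rabs_mult (Rabs_pos_eq (/ tau)); last by apply/Rlt_le/Rinv_0_lt_compat; lra.
  apply: Rmult_le_compat_r; first by apply/Rlt_le/Rinv_0_lt_compat; lra.
  have B1 : INR j <= INR K by apply: le_INR; have := ltn_ord j; lia.
  have B2 : INR j' <= INR K by apply: le_INR; have := ltn_ord j'; lia.
  have P1 := pos_INR j; have P2 := pos_INR j'; apply: Rabs_le; lra.
have [A0 [HA0 HA]] := gw_small_error a0 L dl Ha Hdl HL.
set A := Rmax A0 (Rmax tau T).
have HAA0 : A0 <= A by exact: Rmax_l.
have HAtau : tau <= A by apply: Rle_trans (Rmax_r A0 _); exact: Rmax_l.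
have HAp : 0 <= A by lra.
have {}HA := HA A HAA0.
pose G0 := GG a0 A 0.
have HG0l : tau / 2 <= G0.
  have -> : tau / 2 = / (2 * sqrt a0) by rewrite Hsa0; field; lra.
  by apply: GG0_lower => //; rewrite Hsa0; have -> : 1 / / tau = tau by field; lra.
have HG0u : G0 <= 4 * tau.
  by have := GG0_upper a0 A Ha HAp; rewrite Hsa0; have -> : 4 / / tau = 4 * tau by field; lra.
have Herr a j j' : a0 <= a -> forall u, 1 <= u <= INR X.+1 ->
   Rabs (GG a A (ln u - lamb K tau j j') - gau a (ln u - lamb K tau j j') * GG a A 0) <= dl.
  move=> Haa u Hu; apply: HA => //.
  have T1' := Rabs_triang (ln u) (- lamb K tau j j'); rewrite Rabs_Ropp in T1'.
  have H1 : 0 <= ln u by rewrite -ln_1; apply: ln_le; lra.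
  have H2 : ln u <= ln (INR X.+1) by apply: ln_le; lra.
  rewrite (Rabs_pos_eq (ln u)) // in T1'; have := Hlam j j'; rewrite /L /Rminus; lra.
set er := INR X * (2 * dl).
have Her : 2 ^ k * (Nn * er) <= 1.
  rewrite -Edl /er; have : 0 <= 2 * INR X * Nn * 2 ^ k * dl by nra. nra.
have Her0 : 0 <= er by rewrite /er; nra.
have Hdl1 : dl * (Nn * V) <= 1.
  rewrite -Edl.
  have : 0 <= dl * Nn * V by apply: Rmult_le_pos; nra.
  have : 1 <= 2 * INR X * 2 ^ k by nra.
  have P : 0 <= 2 * INR X * Nn * 2 ^ k * dl by nra.
  move=> H H0; have := Rmult_le_compat_r _ _ _ H0 H; lra.
pose W j j' := wkern b A (lamb K tau j j') X k a0.
(* 256 = 32 * 2 * 4, from [kern_lower] with exp(lam/2) <= 2 Nn and G0 <= 4 tau; 8 U bounds the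
   kernels whose Gaussian has width at most U. *)
have Hlow j j' : G0 * res_pair j j' - 256 * Nn - 8 * (tau / Nn) - er - 2 ^ k * (8 * U + er) <= W j j'.
  set lam := lamb K tau j j'.
  have Hup a' : a0 + b <= a' -> Rabs (kern a' A lam X) <= 8 * U + er.
    move=> Ha'; have Ha'0 : 0 < a' by lra.
    have [H _] := kern_abs a' A lam X dl Ha'0 HAp (Herr a' j j' ltac:(lra)).
    have Hg := GG0_upper a' A Ha'0 HAp.
    have Hsq : / U <= sqrt a'.
      have -> : / U = sqrt (/ U * / U) by rewrite sqrt_square //; apply/Rlt_le/Rinv_0_lt_compat.
      by apply: sqrt_le_1_alt; rewrite -Rinv_mult -/b; lra.
    have HiU : 0 < / U by exact: Rinv_0_lt_compat.
    have : 4 / sqrt a' <= 4 * U.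
      apply: Rmult_le_compat_l; first lra.
      rewrite -[X in _ <= X]Rinv_inv; exact: Rinv_le_contravar.
    rewrite -/er in H; lra.
  have := wkern_lower b A lam X k a0 (8 * U + er) (Rlt_le _ _ Hb) Hup.
  rewrite -/(W j j').
  suff : G0 * res_pair j j' - 256 * Nn - 8 * (tau / Nn) - er <= kern a0 A lam X.
    have : 0 <= 8 * U + er by lra.
    lra.
  have HtN : 0 <= tau / Nn by apply: Rmult_le_pos; [lra|apply/Rlt_le/Rinv_0_lt_compat; lra].
  rewrite /res_pair; case: Rle_dec => /= Hl.
    have H := kern_lower a0 A lam X dl Ha HAp (Herr a0 j j' ltac:(lra)) Ha01.
    rewrite -/G0 -/er in H.
    have He : exp (lam / 2) <= 2 * Nn.
      rewrite -[2 * Nn]exp_ln; last lra. apply: exp_le_compat; rewrite /lam; lra.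
    have HGs : G0 * (32 * exp (lam / 2) * sqrt a0) <= 256 * Nn.
      rewrite Hsa0.
      have Hit : 0 < / tau by apply: Rinv_0_lt_compat; lra.
      have H1 : G0 * / tau <= 4.
        have -> : 4 = 4 * tau * / tau by field; lra.
        by apply: Rmult_le_compat_r; lra.
      have H0 : 0 <= G0 * / tau by apply: Rmult_le_pos; lra.
      have := exp_pos (lam / 2); nra.
    rewrite -/lam; lra.
  have [_ H] := kern_abs a0 A lam X dl Ha HAp (Herr a0 j j' ltac:(lra)).
  rewrite -/G0 -/er in H.
  (* Past the cut-off, lam/2 exceeds ln 2 + ln Nn, and ln 2 > 1/2 absorbs a0/8 <= 1/8. *)
  have He : exp (- lam / 2 + a0 / 8) <= / Nn.
    have -> : / Nn = exp (- ln Nn) by rewrite exp_Ropp exp_ln //; lra.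
    apply: exp_le_compat.
    have El : ln (2 * Nn) = ln 2 + ln Nn by rewrite ln_mult; lra.
    have := Ha01; have := ln_lt_2; rewrite /lam in Hl *; lra.
  have := Rabs_def2. move=> _.
  have := Rle_abs (- kern a0 A lam X); rewrite Rabs_Ropp.
  have : 2 * G0 * exp (- lam / 2 + a0 / 8) <= 8 * (tau / Nn).
    have := exp_pos (- lam / 2 + a0 / 8).
    have HiN : 0 < / Nn by apply: Rinv_0_lt_compat; lra.
    rewrite /Rdiv; nra.
  lra.
set J := \rsum_(j <- index_enum 'I_K) \rsum_(j' <- index_enum 'I_K) (r1 j * r2 j' * W j j').
set SS := \rsum_(j <- index_enum 'I_K) _.
set junk := 256 * Nn + 8 * (tau / Nn) + er + 2 ^ k * (8 * U + er).
have HtN0 : 0 <= tau / Nn by apply: Rmult_le_pos; [lra|apply/Rlt_le/Rinv_0_lt_compat; lra].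
have Hjunk0 : 0 <= junk by rewrite /junk; nra.
have J1 : G0 * SS - Nn * junk <= J.
  have -> : G0 * SS = \rsum_(j <- index_enum 'I_K) \rsum_(j' <- index_enum 'I_K) (r1 j * r2 j' * (G0 * res_pair j j')).
    by rewrite /SS rsum2_mull; apply: eq_rsum2 => j j'; ring.
  have HJ : \rsum_(j <- index_enum 'I_K) \rsum_(j' <- index_enum 'I_K) (r1 j * r2 j' * (G0 * res_pair j j')) <=
     \rsum_(j <- index_enum 'I_K) \rsum_(j' <- index_enum 'I_K) (r1 j * r2 j' * W j j' + junk * (r1 j * r2 j')).
    apply: rsum2_le => j j'.
    have Hrr := Rmult_le_pos _ _ (Hr1 j) (Hr2 j').
    have := Rmult_le_compat_l _ _ _ Hrr (Hlow j j'); rewrite /junk; lra.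
  rewrite rsum2_plus -rsum2_mull -rsum2 -/J -/s1 -/s2 in HJ.
  have := Rmult_le_compat_l _ _ _ Hjunk0 Hs12; lra.
have IJ : is_RInt (fun t => gw a0 t * (1 - gw b t) ^ k *
    (\rsum_(j <- index_enum 'I_K) \rsum_(j' <- index_enum 'I_K) (r1 j * r2 j' * Re (em_sum (hl t) X * (cos (t * lamb K tau j j'), sin (t * lamb K tau j j')))%C))) 0 A J.
  have := is_RInt_rsum _ (index_enum 'I_K) _ _ 0 A (fun j => is_RInt_rsum _ (index_enum 'I_K) _ _ 0 A
    (fun j' => is_RInt_scal (V := R_NormedModule) _ _ _ (r1 j * r2 j') _ (wkern_int b A (lamb K tau j j') X k a0))).
  apply: is_RInt_ext => t _; rewrite rsum2_mull; apply: eq_rsum2 => j j'.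
  set z := Re _; change (r1 j * r2 j' * (gw a0 t * ((1 - gw b t) ^ k * z)) = gw a0 t * (1 - gw b t) ^ k * (r1 j * r2 j' * z)).
  ring.
have Iq r : is_RInt (fun t => gw a0 t * q2 K tau r t) 0 A
   (\rsum_(j <- index_enum 'I_K) \rsum_(j' <- index_enum 'I_K) (r j * r j' * GG a0 A (lamb K tau j j'))).
  have := is_RInt_rsum _ (index_enum 'I_K) _ _ 0 A (fun j => is_RInt_rsum _ (index_enum 'I_K) _ _ 0 A
    (fun j' => is_RInt_scal (V := R_NormedModule) _ _ _ (r j * r j') _
      (RInt_correct (V := R_CompleteNormedModule) _ _ _ (ex_RInt_gw a0 _ 0 A (cos_cont (lamb K tau j j')))))).
  apply: is_RInt_ext => t _; rewrite q2_expand rsum2_mull; apply: eq_rsum2 => j j'.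
  rewrite /scal /= /mult /=; ring.
have Bq r (Hr : forall j, 0 <= r j) (Hn : \rsum_(j <- index_enum 'I_K) (r j * r j) <= 1)
   (Hs : (\rsum_(j <- index_enum 'I_K) r j) * (\rsum_(j <- index_enum 'I_K) r j) <= Nn) :
   \rsum_(j <- index_enum 'I_K) \rsum_(j' <- index_enum 'I_K) (r j * r j' * GG a0 A (lamb K tau j j')) <= 6 * G0 + dl * Nn.
  apply: Rle_trans (_ : \rsum_(j <- index_enum 'I_K) \rsum_(j' <- index_enum 'I_K)
     (G0 * (r j * r j' * gau a0 (lamb K tau j j')) + dl * (r j * r j')) <= _).
    apply: rsum2_le => j j'.
    have Hrr := Rmult_le_pos _ _ (Hr j) (Hr j').
    have H := HA a0 (lamb K tau j j') ltac:(lra) ltac:(have := Hlam j j'; rewrite /L; lra).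
    have H' := Rle_trans _ _ _ (Rle_abs _) H.
    have := Rmult_le_compat_l _ _ _ Hrr H'; rewrite -/G0; lra.
  rewrite rsum2_plus -!rsum2_mull -rsum2.
  have := schur r Hr Hn; nra.
have [IM [HIM BIM]] := gw_moment (a0 / 2) A ltac:(lra) HAp.
have BIM2 : IM <= 10 * (tau * tau).
  apply: Rle_trans BIM _.
  have Hs2a : / (2 * tau) <= sqrt (a0 / 2).
    have -> : / (2 * tau) = sqrt (/ (2 * tau) * / (2 * tau)).
      by rewrite sqrt_square //; apply/Rlt_le/Rinv_0_lt_compat; lra.
    apply: sqrt_le_1_alt; rewrite -Rinv_mult.
    have -> : / (2 * tau * (2 * tau)) = a0 / 4 by rewrite /a0; field; lra.
    lra.
  have H1 : 4 / sqrt (a0 / 2) <= 4 * (2 * tau).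
    apply: Rmult_le_compat_l; first lra.
    rewrite -[X in _ <= X]Rinv_inv; apply: Rinv_le_contravar => //.
    by apply: Rinv_0_lt_compat; lra.
  have H2 : / (a0 / 2) = 2 * (tau * tau) by rewrite /a0; field; lra.
  rewrite H2; nra.
have He0 : 0 <= e1 + e2.
  have : 0 <= e1.
    apply: pow_le; apply: Rmult_le_pos; first nra.
    by apply/Rlt_le/Rinv_0_lt_compat; nra.
  have : 0 < e2 by exact: exp_pos.
  lra.
have IR := is_RInt_plus (V := R_NormedModule) _ _ _ _ _ _
  (is_RInt_scal (V := R_NormedModule) _ _ _ (V / 2) _ (is_RInt_plus (V := R_NormedModule) _ _ _ _ _ _ (Iq r1) (Iq r2)))
  (is_RInt_scal (V := R_NormedModule) _ _ _ (3 * Nn * (e1 + e2)) _ HIM).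
have J2 := is_RInt_le _ _ _ _ _ _ HAp IJ IR.
have {}J2 : J <= V * (6 * G0 + dl * Nn) + 3 * Nn * (e1 + e2) * (10 * (tau * tau)).
  apply: Rle_trans (J2 _) _.
    move=> t Ht; rewrite /plus /scal /= /mult /=.
    have [[W1 W2] W3] := weight_bound t ltac:(lra).
    have HQ := cross_bound K tau r1 r2 (em_sum (hl t) X) t.
    set Q := \rsum_(j <- index_enum 'I_K) _ in HQ *.
    have Q1 := q2_ge0 K tau r1 t; have Q2 := q2_ge0 K tau r2 t.
    have Q1' := q2_le K tau r1 t Hr1; have Q2' := q2_le K tau r2 t Hr2.
    rewrite -/s1 in Q1'; rewrite -/s2 in Q2'.
    have Hgw := gw_pos (a0 / 2) t; have Hgw0 := gw_pos a0 t.
    set w := gw a0 t * (1 - gw b t) ^ k in W1 W2 W3 *.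
    have P1 : 0 <= V / 2 * (gw a0 t * q2 K tau r1 t + gw a0 t * q2 K tau r2 t).
      by apply: Rmult_le_pos; first lra; apply: Rplus_le_le_0_compat; apply: Rmult_le_pos; lra.
    have P2 : 0 <= 3 * Nn * (e1 + e2) * ((1 + t) * gw (a0 / 2) t).
      by apply: Rmult_le_pos; apply: Rmult_le_pos; lra.
    have [Hin|Hin] : T1 <= t <= T \/ ~ (T1 <= t <= T) by lra.
      have HQ2 : Q <= V * ((q2 K tau r1 t + q2 K tau r2 t) / 2).
        by apply: Rle_trans HQ _; apply: Rmult_le_compat_r; [lra|exact: HV].
      have P3 : 0 <= V * ((q2 K tau r1 t + q2 K tau r2 t) / 2) by apply: Rmult_le_pos; lra.
      have H1 := Rmult_le_compat_l _ _ _ W1 HQ2.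
      have H2 := Rmult_le_compat_r _ _ _ P3 W2.
      lra.
    have HQ2 : Q <= 3 * (1 + t) * Nn.
      apply: Rle_trans HQ _; apply: Rmult_le_compat; [exact: Cmod_ge_0|lra|apply: hl_bound; lra|lra].
    have P3 : 0 <= 3 * (1 + t) * Nn by apply: Rmult_le_pos; lra.
    have H1 := Rmult_le_compat_l _ _ _ W1 HQ2.
    have H2 := Rmult_le_compat_r _ _ _ P3 (W3 Hin).
    lra.
  rewrite /plus /scal /= /mult /=.
  have B1 := Bq r1 Hr1 Hn1 Hs1; have B2 := Bq r2 Hr2 Hn2 Hs2.
  have HNe : 0 <= 3 * Nn * (e1 + e2) by apply: Rmult_le_pos; lra.
  apply: Rplus_le_compat; last exact: Rmult_le_compat_l.
  have HV2 : 0 <= V / 2 by lra.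
  have H3 := Rmult_le_compat_l (V / 2) _ _ HV2 (Rplus_le_compat _ _ _ _ B1 B2).
  apply: Rle_trans H3 _; lra.
have E3 : 3 * Nn * (e1 + e2) * (10 * (tau * tau)) <= 30 * tau.
  have := Rmult_le_compat_l tau _ _ ltac:(lra) HC3; lra.
have E4 : Nn * junk <= 272 * tau + 2.
  rewrite /junk.
  have -> : Nn * (256 * Nn + 8 * (tau / Nn) + er + 2 ^ k * (8 * U + er)) =
     256 * (Nn * Nn) + 8 * tau + Nn * er + 8 * (2 ^ k * (Nn * U)) + 2 ^ k * (Nn * er) by field; lra.
  have : Nn * er <= 2 ^ k * (Nn * er).
    have : 0 <= Nn * er by apply: Rmult_le_pos; lra.
    nra.
  lra.
(* The accumulated errors 302 tau + 3 are below 620 G0, because tau <= 2 G0 and tau >= 1. *)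
apply: (Rmult_le_reg_l G0); first lra.
lra.
Qed.
End Resonance.

(** * From grid coefficients to divisibility links between two sets of integers *)

Lemma rsum_at_most_one (T : eqType) (s : seq T) (P : pred T) : uniq s ->
  (forall x y, P x -> P y -> x = y) ->
  (forall F : T -> R, \rsum_(x <- s | P x) F x = 0) \/
  (exists2 x, x \in s & P x /\ forall F : T -> R, \rsum_(x <- s | P x) F x = F x).
Proof.
move=> Hu HP; case: (boolP (has P s)) => [/hasP [x Hx Px]|/hasPn H].
  right; exists x => //; split=> // F.
  rewrite big_mkcond (bigD1_seq x) //= Px big1 ?Rplus_0_r // => y Hyx.
  by case: ifP => // Py; move: Hyx; rewrite (HP y x Py Px) eqxx.
left => F; rewrite big_seq_cond big1 // => y /andP [/H /negbTE ->] //.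
Qed.

Definition fl (x : R) : nat := Z.to_nat (Int_part x).

Lemma fl_bound x : 0 <= x -> INR (fl x) <= x < INR (fl x) + 1.
Proof.
move=> Hx; have [B1 B2] := base_Int_part x.
have H0 : (0 <= Int_part x)%Z.
  have : (-1 < Int_part x)%Z by apply: lt_IZR; lra.
  lia.
rewrite /fl INR_IZR_INZ Z2Nat.id //; lra.
Qed.

Lemma sq_sum_le (I : Type) (s : seq I) (P : pred I) (F : I -> R) : (forall i, 0 <= F i) ->
  \rsum_(i <- s | P i) (F i * F i) <= (\rsum_(i <- s | P i) F i) * (\rsum_(i <- s | P i) F i)
  /\ 0 <= \rsum_(i <- s | P i) F i.
Proof.
move=> HF; elim/big_rec2: _ => [|i x y _ [H1 H2]]; first by lra.
have := HF i => Hi; split; last lra.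
have := Rmult_le_pos _ _ Hi H2; lra.
Qed.

Lemma inv_INR_ge0 m : 0 <= / INR m.
Proof.
case: m => [|m]; first by rewrite Rinv_0; lra.
by apply/Rlt_le/Rinv_0_lt_compat; apply: lt_0_INR; lia.
Qed.

Section Sets.
Variables (M1 M2 : seq nat) (X k : nat) (tau U T1 T Nn V : R).
Hypotheses (Hu1 : uniq M1) (Hu2 : uniq M2) (Hp1 : forall m, m \in M1 -> (0 < m)%N)
  (Hp2 : forall m, m \in M2 -> (0 < m)%N) (Hsz1 : INR (size M1) <= Nn) (Hsz2 : INR (size M2) <= Nn).

Definition hsum (M : seq nat) := \rsum_(m <- M) / INR m.
(** With weights m^(-1/2), a link m2 = n m1 contributes n^(-1/2) (m1 m2)^(-1/2) = 1/m2. *)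
Definition linksum (N1 N2 : seq nat) := \rsum_(m1 <- N1) \rsum_(m2 <- N2 | (m1 %| m2)%N) / INR m2.

Definition cf (M : seq nat) m := sqrt (/ INR m / hsum M).
Definition bin m := fl (tau * ln (INR m)).
Definition nb := (\max_(m <- M1 ++ M2) bin m).+1.
(** The l2 norm of the bin rather than its sum: the coefficients stay normalised even when many
    integers share a bin. *)
Definition rr (M : seq nat) (j : nat) := sqrt (\rsum_(m <- M | bin m == j) (cf M m * cf M m)).

Hypotheses (HP1 : 0 < hsum M1) (HP2 : 0 < hsum M2) (Htau : 1 <= tau) (HN : 1 <= Nn).

Lemma cf_ge0 M m : 0 <= cf M m. Proof. exact: sqrt_pos. Qed.

Lemma cf_sq M m : 0 < hsum M -> cf M m * cf M m = / INR m / hsum M.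
Proof.
move=> H; rewrite /cf sqrt_sqrt //; apply: Rmult_le_pos; first exact: inv_INR_ge0.
exact/Rlt_le/Rinv_0_lt_compat.
Qed.

Lemma cf_norm M : 0 < hsum M -> \rsum_(m <- M) (cf M m * cf M m) = 1.
Proof.
move=> H; under eq_bigr => m _ do rewrite cf_sq //.
by rewrite -rsum_mulr -/(hsum M); field; lra.
Qed.

Lemma bin_lt (M : seq nat) (m : nat) : {subset M <= M1 ++ M2} -> m \in M -> (bin m < nb)%N.
Proof. by move=> Hs /Hs H; rewrite ltnS; apply: (leq_bigmax_seq _ H). Qed.

Lemma rr_ge0 M j : 0 <= rr M j. Proof. exact: sqrt_pos. Qed.

Lemma rr_sq M j : rr M j * rr M j = \rsum_(m <- M | bin m == j) (cf M m * cf M m).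
Proof. by rewrite /rr sqrt_sqrt //; apply: rsum_ge0 => m _; exact: Rle_0_sqr. Qed.

Lemma sum_bins (M : seq nat) (F : nat -> R) : {subset M <= M1 ++ M2} ->
  \rsum_(j <- index_enum 'I_nb) \rsum_(m <- M | bin m == j) F m = \rsum_(m <- M) F m.
Proof.
move=> Hs; rewrite (exchange_big_dep predT) //= [LHS]big_seq [RHS]big_seq.
apply: eq_bigr => m Hm.
by rewrite (big_pred1 (Ordinal (bin_lt M m Hs Hm))).
Qed.

Lemma rr_norm (M : seq nat) : {subset M <= M1 ++ M2} -> 0 < hsum M ->
  \rsum_(j <- index_enum 'I_nb) (rr M j * rr M j) <= 1.
Proof.
move=> Hs H; under eq_bigr => j _ do rewrite rr_sq.
by rewrite sum_bins // cf_norm //; lra.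
Qed.

(** In each bin the l2 norm is at most the l1 norm; then Cauchy--Schwarz over at most Nn
    elements. *)
Lemma rr_total (M : seq nat) : {subset M <= M1 ++ M2} -> 0 < hsum M -> INR (size M) <= Nn ->
  (\rsum_(j <- index_enum 'I_nb) rr M j) * (\rsum_(j <- index_enum 'I_nb) rr M j) <= Nn.
Proof.
move=> Hs H Hsz.
have L : \rsum_(j <- index_enum 'I_nb) rr M j <= \rsum_(m <- M) cf M m.
  rewrite -(sum_bins M) //; apply: rsum_le => j _.
  have [S1 S2] := sq_sum_le _ M (fun m => bin m == j) (cf M) (cf_ge0 M).
  by rewrite -[X in _ <= X]sqrt_square //; apply: sqrt_le_1_alt.
have L0 : 0 <= \rsum_(j <- index_enum 'I_nb) rr M j by apply: rsum_ge0 => j _; exact: rr_ge0.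
have CS := cauchy_schwarz M predT (cf M) (fun _ => 1).
rewrite cf_norm // rsum_const_seq in CS.
have E : \rsum_(m <- M) (cf M m * 1) = \rsum_(m <- M) cf M m by apply: eq_bigr => m _; ring.
rewrite E in CS; nra.
Qed.

(** For fixed n each of m1 and m2 = n m1 determines the other, so the links form a partial matching
    and Cauchy--Schwarz applies without loss of multiplicity. *)
Lemma inner_cs n j j' : (0 < n)%N ->
  \rsum_(m1 <- M1 | bin m1 == j) \rsum_(m2 <- M2 | (bin m2 == j') && (m2 == n * m1)%N) (cf M1 m1 * cf M2 m2)
  <= rr M1 j * rr M2 j'.
Proof.
move=> Hn.
pose h m1 := \rsum_(m2 <- M2 | (bin m2 == j') && (m2 == n * m1)%N) cf M2 m2.
have -> : \rsum_(m1 <- M1 | bin m1 == j) \rsum_(m2 <- M2 | (bin m2 == j') && (m2 == n * m1)%N) (cf M1 m1 * cf M2 m2) =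
   \rsum_(m1 <- M1 | bin m1 == j) (cf M1 m1 * h m1).
  by apply: eq_bigr => m1 _; rewrite /h rsum_mull.
have CS := cauchy_schwarz M1 (fun m1 => bin m1 == j) (cf M1) h.
have Hh : \rsum_(m1 <- M1 | bin m1 == j) (h m1 * h m1) <= rr M2 j' * rr M2 j'.
  have E m1 : h m1 * h m1 = \rsum_(m2 <- M2 | (bin m2 == j') && (m2 == n * m1)%N) (cf M2 m2 * cf M2 m2).
    rewrite /h; have HPu : forall x y, (bin x == j') && (x == n * m1)%N -> (bin y == j') && (y == n * m1)%N -> x = y.
      by move=> x y /andP [_ /eqP ->] /andP [_ /eqP ->].
    have [Z|[x _ [_ Z]]] := rsum_at_most_one _ M2 _ Hu2 HPu; rewrite !Z; ring.
  under eq_bigr => m1 _ do rewrite E.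
  rewrite rr_sq (exchange_big_dep (fun m2 => bin m2 == j')) /=; last by move=> ? ? _ /andP [].
  apply: rsum_le => m2 Hm2.
  have HPu : forall x y, (bin x == j) && ((bin m2 == j') && (m2 == n * x)%N) -> (bin y == j) && ((bin m2 == j') && (m2 == n * y)%N) -> x = y.
    move=> x y /andP [_ /andP [_ /eqP E1]] /andP [_ /andP [_ /eqP E2]].
    by apply/eqP; rewrite -(eqn_pmul2l Hn) -E1 -E2.
  have [Z|[x _ [_ Z]]] := rsum_at_most_one _ M1 _ Hu1 HPu; rewrite Z; last lra.
  exact: Rle_0_sqr.
have R1 := rr_ge0 M1 j; have R2 := rr_ge0 M2 j'.
rewrite -rr_sq in CS.
set B := \rsum_(m1 <- M1 | bin m1 == j) (cf M1 m1 * h m1) in CS *.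
have Hp : 0 <= rr M1 j * rr M2 j' by exact: Rmult_le_pos.
have H2 : B * B <= (rr M1 j * rr M2 j') * (rr M1 j * rr M2 j').
  apply: Rle_trans CS _.
  have := Rmult_le_compat_l _ _ _ (Rle_0_sqr (rr M1 j)) Hh; rewrite /Rsqr; lra.
have [//|Hlt] := Rle_dec B (rr M1 j * rr M2 j'); nra.
Qed.

Hypothesis HXN : Nn * Nn <= INR X.

Let a0 := / (tau * tau).

(** A link m2 = n m1 between the two bins forces |ln n - lam| <= 1/tau, by the two floors, and there
    [gau a0] is at least exp(-1/2) >= 1/2; this explains the factor 2. *)
Lemma link_pair (j j' : 'I_nb) :
  \rsum_(1 <= n < X.+1 | Rle_dec (INR n) (Nn * Nn)) (/ sqrt (INR n) *
    (\rsum_(m1 <- M1 | bin m1 == j) \rsum_(m2 <- M2 | (bin m2 == j') && (m2 == n * m1)%N) (cf M1 m1 * cf M2 m2)))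
  <= 2 * (rr M1 j * rr M2 j' * res_pair nb X tau Nn j j').
Proof.
have Hrr : 0 <= rr M1 j * rr M2 j' by apply: Rmult_le_pos; exact: rr_ge0.
have Hit : 0 < / tau by apply: Rinv_0_lt_compat; lra.
have Ett : tau * / tau = 1 by field; lra.
set lam := lamb nb tau j j'.
have Hlink n m1 m2 : (0 < n)%N -> m1 \in M1 -> m2 \in M2 -> bin m1 = j -> bin m2 = j' -> m2 = (n * m1)%N ->
   Rabs (ln (INR n) - lam) <= / tau.
  move=> Hn /Hp1 H1 /Hp2 H2 B1 B2 E.
  have Hn0 : 0 < INR n by apply: lt_0_INR; lia.
  have Hm0 : 0 < INR m1 by apply: lt_0_INR; lia.
  have lnpos m : (0 < m)%N -> 0 <= tau * ln (INR m).
    move=> Hm; apply: Rmult_le_pos; first lra.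
    rewrite -ln_1; apply: ln_le; [lra|apply: (le_INR 1); lia].
  have F1 := fl_bound _ (lnpos m1 H1); have F2 := fl_bound _ (lnpos m2 H2).
  rewrite -/(bin m1) B1 in F1; rewrite -/(bin m2) B2 E mult_INR ln_mult // in F2.
  have -> : ln (INR n) - lam = (tau * ln (INR n) - (INR j' - INR j)) * / tau by rewrite /lam /lamb; field; lra.
  rewrite Rabs_mult (Rabs_pos_eq (/ tau)); last lra.
  rewrite -[X in _ <= X]Rmult_1_l; apply: Rmult_le_compat_r; first lra.
  apply: Rabs_le; lra.
pose inner n := \rsum_(m1 <- M1 | bin m1 == j) \rsum_(m2 <- M2 | (bin m2 == j') && (m2 == n * m1)%N) (cf M1 m1 * cf M2 m2).
have Hin n : (0 < n)%N -> inner n = 0 \/ Rabs (ln (INR n) - lam) <= / tau.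
  move=> Hn.
  case: (boolP (has (fun m1 => (bin m1 == j) && has (fun m2 => (bin m2 == j') && (m2 == n * m1)%N) M2) M1)).
    move/hasP => [m1 H1 /andP [/eqP B1 /hasP [m2 H2 /andP [/eqP B2 /eqP E]]]].
    by right; apply: (Hlink n m1 m2).
  move/hasPn => H; left; rewrite /inner big_seq_cond big1 // => m1 /andP [H1 B1].
  have := H m1 H1; rewrite B1 /= => /hasPn H2.
  rewrite big_seq_cond big1 // => m2 /andP [H3 H4].
  by have := H2 m2 H3; rewrite H4.
have Hg n : (0 < n)%N -> 0 <= g0 a0 lam (ln (INR n)).
  by move=> _; apply: Rmult_le_pos; exact/Rlt_le/exp_pos.
rewrite /res_pair -/lam -/a0; case: Rle_dec => /= Hl.
  rewrite -Rmult_assoc rsum_mull.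
  rewrite [X in X <= _]big_mkcond !big_nat; apply: rsum_le => n /andP [Hn _].
  have Hn0 : 0 < INR n by apply: lt_0_INR; lia.
  have Hg1 := Hg n Hn.
  have P : 0 <= 2 * (rr M1 j * rr M2 j') * g0 a0 lam (ln (INR n)) by apply: Rmult_le_pos; lra.
  case: Rle_dec => /= _ //.
  have [Z|HL] := Hin n Hn; first by rewrite -/(inner n) Z Rmult_0_r.
  have HI := inner_cs n j j' Hn; rewrite -/(inner n) in HI *.
  have Hga : 1 / 2 <= gau a0 (ln (INR n) - lam).
    have : 1 / 2 <= exp (- (1 / 2)) by have := exp_ineq1_le (- (1 / 2)); lra.
    move=> H; apply: Rle_trans H _; apply: exp_le_compat; apply: Ropp_le_contravar.
    set x := ln (INR n) - lam in HL *.
    have -> : x * x / (2 * a0) = (tau * Rabs x) * (tau * Rabs x) / 2.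
      have -> : (tau * Rabs x) * (tau * Rabs x) = tau * tau * (Rabs x * Rabs x) by ring.
      rewrite -Rabs_mult Rabs_pos_eq; last exact: Rle_0_sqr.
      by rewrite /a0; field; lra.
    have Hx1 : tau * Rabs x <= 1 by rewrite -Ett; apply: Rmult_le_compat_l; lra.
    have Hx0 : 0 <= tau * Rabs x by apply: Rmult_le_pos; [lra|exact: Rabs_pos].
    nra.
  rewrite /g0 -sqrt_exp_ln //.
  have Hs : 0 < / sqrt (INR n) by apply: Rinv_0_lt_compat; exact: sqrt_lt_R0.
  have H1 := Rmult_le_compat_l _ _ _ (Rlt_le _ _ Hs) HI.
  have H2 : 0 <= / sqrt (INR n) * (rr M1 j * rr M2 j') by apply: Rmult_le_pos; lra.
  have := Rmult_le_compat_l _ _ _ H2 Hga; lra.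
(* Pairs beyond the cut-off of [res_pair] carry no link with n <= Nn^2: ln n <= 2 ln Nn and 1/tau <=
   1 < 2 ln 2. *)
rewrite !Rmult_0_r big_nat_cond big1; first lra.
move=> n /andP [/andP [Hn _]]; case: Rle_dec => // HnN _.
have [Z|HL] := Hin n Hn; first by rewrite -/(inner n) Z Rmult_0_r.
exfalso; apply: Hl; rewrite -/lam.
have Hn0 : 0 < INR n by apply: lt_0_INR; lia.
have L1 : ln (INR n) <= 2 * ln Nn.
  have -> : 2 * ln Nn = ln (Nn * Nn) by rewrite ln_mult; lra.
  exact: ln_le.
have : / tau <= 1 by rewrite -Rinv_1; apply: Rinv_le_contravar; lra.
have E2 : ln (2 * Nn) = ln 2 + ln Nn by rewrite ln_mult; lra.
have := ln_lt_2; have := Rabs_def2; move=> _.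
have := Rle_abs (- (ln (INR n) - lam)); rewrite Rabs_Ropp; lra.
Qed.

(** Links are regrouped by their quotient n <= Nn^2 <= X and by their pair of bins, and [link_pair]
    is summed. *)
Lemma near_links :
  \rsum_(m1 <- M1) \rsum_(m2 <- M2 | (m1 %| m2)%N && Rle_dec (INR (m2 %/ m1)) (Nn * Nn))
     (/ sqrt (INR (m2 %/ m1)) * (cf M1 m1 * cf M2 m2)) <=
  2 * (\rsum_(j <- index_enum 'I_nb) \rsum_(j' <- index_enum 'I_nb) (rr M1 j * rr M2 j' * res_pair nb X tau Nn j j')).
Proof.
rewrite rsum2_mull.
apply: Rle_trans (rsum2_le _ _ _ link_pair).
pose C n : bool := Rle_dec (INR n) (Nn * Nn).
pose G n m1 := \rsum_(m2 <- M2 | (m2 == n * m1)%N) (/ sqrt (INR n) * (cf M1 m1 * cf M2 m2)).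
have -> : \rsum_(j <- index_enum 'I_nb) \rsum_(j' <- index_enum 'I_nb)
    (\rsum_(1 <= n < X.+1 | C n) (/ sqrt (INR n) *
    (\rsum_(m1 <- M1 | bin m1 == j) \rsum_(m2 <- M2 | (bin m2 == j') && (m2 == n * m1)%N) (cf M1 m1 * cf M2 m2)))) =
  \rsum_(m1 <- M1) \rsum_(m2 <- M2) \rsum_(1 <= n < X.+1 | C n && (m2 == n * m1)%N) (/ sqrt (INR n) * (cf M1 m1 * cf M2 m2)).
  have S1 : {subset M1 <= M1 ++ M2} by move=> x Hx; rewrite mem_cat Hx.
  have S2 : {subset M2 <= M1 ++ M2} by move=> x Hx; rewrite mem_cat Hx orbT.
  rewrite -(sum_bins M1) //; apply: eq_bigr => j _.
  transitivity (\rsum_(j' <- index_enum 'I_nb) \rsum_(m1 <- M1 | bin m1 == j) \rsum_(1 <= n < X.+1 | C n)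
     (/ sqrt (INR n) * (\rsum_(m2 <- M2 | (bin m2 == j') && (m2 == n * m1)%N) (cf M1 m1 * cf M2 m2)))).
    apply: eq_bigr => j' _; rewrite [RHS]exchange_big /=; apply: eq_bigr => n _; by rewrite rsum_mull.
  rewrite exchange_big /=; apply: eq_bigr => m1 _.
  rewrite -(sum_bins M2) //; apply: eq_bigr => j' _.
  rewrite [RHS](exchange_big_dep C) /=; last by move=> ? ? _ /andP [].
  apply: eq_bigr => n Cn; rewrite rsum_mull; apply: eq_bigl => m2; by rewrite Cn.
rewrite [X in X <= _]big_seq [X in _ <= X]big_seq; apply: rsum_le => m1 Hm1.
rewrite [X in X <= _]big_mkcond /= [X in X <= _]big_seq [X in _ <= X]big_seq; apply: rsum_le => m2 Hm2.
have Hm1p := Hp1 m1 Hm1; have Hm2p := Hp2 m2 Hm2.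
have T0 n : 0 <= / sqrt (INR n) * (cf M1 m1 * cf M2 m2).
  apply: Rmult_le_pos; last by apply: Rmult_le_pos; exact: cf_ge0.
  have := sqrt_pos (INR n) => H.
  have [E|E] := Req_dec (sqrt (INR n)) 0; first by rewrite E Rinv_0; lra.
  by apply/Rlt_le/Rinv_0_lt_compat; lra.
case: ifP => [/andP [Hd HC]|_]; last by apply: rsum_ge0 => n _.
have Hn : (0 < m2 %/ m1)%N by rewrite divn_gt0 // dvdn_leq.
have HnX : (m2 %/ m1 < X.+1)%N.
  rewrite ltnS; move: HC; case: Rle_dec => // Hle _.
  apply/leP; apply: INR_le; lra.
rewrite big_mkcond (bigD1_seq (m2 %/ m1)%N) /=; last exact: iota_uniq.
  rewrite -/(C _) in HC; rewrite HC divnK // eqxx /=.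
  rewrite -[X in X <= _]Rplus_0_r; apply: Rplus_le_compat_l.
  by apply: rsum_ge0 => n _; case: ifP => _ //; lra.
by rewrite mem_index_iota Hn HnX.
Qed.

(** Here n^(-1/2) <= 1/Nn, and the product of the two l1 norms is at most Nn. *)
Lemma far_links :
  \rsum_(m1 <- M1) \rsum_(m2 <- M2 | (m1 %| m2)%N && ~~ Rle_dec (INR (m2 %/ m1)) (Nn * Nn))
     (/ sqrt (INR (m2 %/ m1)) * (cf M1 m1 * cf M2 m2)) <= 1.
Proof.
have tot M : 0 < hsum M -> INR (size M) <= Nn -> (\rsum_(m <- M) cf M m) * (\rsum_(m <- M) cf M m) <= Nn.
  move=> H Hsz; have CS := cauchy_schwarz M predT (cf M) (fun _ => 1).
  rewrite cf_norm // rsum_const_seq in CS.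
  have E : \rsum_(m <- M) (cf M m * 1) = \rsum_(m <- M) cf M m by apply: eq_bigr => m _; ring.
  by rewrite E in CS; lra.
have t1 := tot M1 HP1 Hsz1; have t2 := tot M2 HP2 Hsz2.
set s1 := \rsum_(m <- M1) cf M1 m in t1; set s2 := \rsum_(m <- M2) cf M2 m in t2.
have Hs : s1 * s2 <= Nn by have := Rle_0_sqr (s1 - s2); rewrite /Rsqr; nra.
apply: Rle_trans (_ : / Nn * (s1 * s2) <= _); last first.
  rewrite -(Rinv_l Nn); last lra.
  by apply: Rmult_le_compat_l => //; apply/Rlt_le/Rinv_0_lt_compat; lra.
rewrite -Rmult_assoc (rsum_mull M1) rsum_mulr; apply: rsum_le => m1 _.
rewrite rsum_mull [X in X <= _]big_mkcond; apply: rsum_le => m2 _.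
have C1 := cf_ge0 M1 m1; have C2 := cf_ge0 M2 m2.
have HiN : 0 < / Nn by apply: Rinv_0_lt_compat; lra.
have Hc := Rmult_le_pos _ _ C1 C2.
case: ifP => [/andP [_ H]|_]; last by rewrite Rmult_assoc; apply: Rmult_le_pos; lra.
rewrite Rmult_assoc; apply: Rmult_le_compat_r => //.
apply: Rinv_le_contravar; first lra.
move: H; case: Rle_dec => //= H _.
rewrite -(sqrt_square Nn); last lra.
apply: sqrt_le_1_alt; lra.
Qed.

Hypotheses (HU : 0 < U) (HT1 : 0 <= T1) (HT : T1 <= T) (HV0 : 0 <= V)
  (HV : forall t, T1 <= t <= T -> Cmod (em_sum (hl t) X) <= V)
  (HC1 : Nn * Nn <= tau) (HC2 : 2 ^ k * (Nn * U) <= tau)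
  (HC3 : Nn * ((T1 * T1 / (2 * (U * U))) ^ k + exp (- (T * T / (4 * (tau * tau))))) * tau <= 1).

(** Near links cost 2 (6 V + 620), far links 1; the square root undoes the normalisation in [cf]. *)
Lemma resonance_sets : linksum M1 M2 <= (12 * V + 1241) * sqrt (hsum M1 * hsum M2).
Proof.
have S1 : {subset M1 <= M1 ++ M2} by move=> x Hx; rewrite mem_cat Hx.
have S2 : {subset M2 <= M1 ++ M2} by move=> x Hx; rewrite mem_cat Hx orbT.
have HX0 : (0 < X)%N by case: X HXN => // H; rewrite /= in H; nra.
have R := resonance nb X k tau U T1 T Nn V (fun j => rr M1 j) (fun j => rr M2 j) Htau HU HT1 HT HN HV0
  (rr_ge0 M1) (rr_ge0 M2) (rr_norm M1 S1 HP1) (rr_norm M2 S2 HP2) (rr_total M1 S1 HP1 Hsz1) (rr_total M2 S2 HP2 Hsz2)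
  HV HC1 HC2 HC3 HX0.
have N := near_links; have F := far_links.
have Hsq : 0 < sqrt (hsum M1 * hsum M2) by apply: sqrt_lt_R0; exact: Rmult_lt_0_compat.
have E : linksum M1 M2 = sqrt (hsum M1 * hsum M2) *
  (\rsum_(m1 <- M1) \rsum_(m2 <- M2 | (m1 %| m2)%N && Rle_dec (INR (m2 %/ m1)) (Nn * Nn))
     (/ sqrt (INR (m2 %/ m1)) * (cf M1 m1 * cf M2 m2)) +
   \rsum_(m1 <- M1) \rsum_(m2 <- M2 | (m1 %| m2)%N && ~~ Rle_dec (INR (m2 %/ m1)) (Nn * Nn))
     (/ sqrt (INR (m2 %/ m1)) * (cf M1 m1 * cf M2 m2))).
  set sq := sqrt (hsum M1 * hsum M2).
  rewrite /linksum Rmult_plus_distr_l !rsum_mull -big_split /= big_seq [RHS]big_seq.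
  apply: eq_bigr => m1 Hm1.
  rewrite -Rmult_plus_distr_l -bigID rsum_mull big_seq_cond [RHS]big_seq_cond.
  apply: eq_bigr => m2 /andP [Hm2 Hd].
  have Hm1p := Hp1 m1 Hm1; have Hm2p := Hp2 m2 Hm2.
  have P1 : 0 < INR m1 by apply: lt_0_INR; lia.
  have P2 : 0 < INR m2 by apply: lt_0_INR; lia.
  have Ed : INR m2 = INR (m2 %/ m1) * INR m1 by rewrite -mult_INR; congr INR; apply: esym; exact: divnK.
  have Hn : (0 < m2 %/ m1)%N by rewrite divn_gt0 // dvdn_leq.
  have Pn : 0 < INR (m2 %/ m1) by apply: lt_0_INR; lia.
  have I1 := Rinv_0_lt_compat _ P1; have I2 := Rinv_0_lt_compat _ P2; have I3 := Rinv_0_lt_compat _ Pn.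
  have I4 := Rinv_0_lt_compat _ HP1; have I5 := Rinv_0_lt_compat _ HP2.
  rewrite /sq /cf -sqrt_inv -!sqrt_mult; try by repeat first [lra | apply: Rmult_le_pos].
  rewrite -[LHS]sqrt_square; last exact/Rlt_le/Rinv_0_lt_compat.
  congr sqrt; rewrite Ed; field; repeat split; lra.
rewrite E Rmult_comm; apply: Rmult_le_compat_r; first lra.
lra.
Qed.
End Sets.

(** * Chebyshev and Mertens estimates for primes *)

Lemma ln_prod (I : Type) (s : seq I) (P : pred I) (F : I -> nat) : (forall i, P i -> (0 < F i)%N) ->
  ln (INR (\prod_(i <- s | P i) F i)) = \rsum_(i <- s | P i) ln (INR (F i)).
Proof.
move=> H; suff [] : (0 < \prod_(i <- s | P i) F i)%N /\ ln (INR (\prod_(i <- s | P i) F i)) = \rsum_(i <- s | P i) ln (INR (F i)) by [].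
elim/big_rec2: _ => [|i x y Hi [H1 H2]]; first by rewrite ln_1.
have Hf := H i Hi; split; first by rewrite muln_gt0 Hf.
rewrite mult_INR ln_mult; try (by apply: lt_0_INR; lia).
by rewrite H2.
Qed.

Lemma ln_expn p k : (0 < p)%N -> ln (INR (p ^ k)) = INR k * ln (INR p).
Proof.
move=> Hp; have H0 : 0 < INR p by apply: lt_0_INR; lia.
elim: k => [|k IH]; first by rewrite expn0 /= ln_1; ring.
have Hk : (0 < p ^ k)%N by rewrite expn_gt0 Hp.
rewrite expnS mult_INR ln_mult //; last by apply: lt_0_INR; lia.
rewrite IH S_INR; ring.
Qed.

Lemma logn_0l m : logn 0 m = 0%N.
Proof. by rewrite lognE. Qed.

Lemma ln_factor m n : (0 < m)%N -> (forall p, prime p -> (p %| m)%N -> (p <= n)%N) ->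
  ln (INR m) = \rsum_(1 <= p < n.+1 | prime p) (INR (logn p m) * ln (INR p)).
Proof.
move=> Hm Hp.
have E : ln (INR m) = \rsum_(0 <= p < (m + n).+1 | p \in predT) (INR (logn p m) * ln (INR p)).
  rewrite -{1}(partnT Hm) (widen_partn _ (leq_addr n m)) ln_prod.
    apply: eq_bigr => -[|p] _; last by rewrite ln_expn.
    by rewrite logn_0l expn0 /= ln_1; ring.
  by move=> -[|p] _; rewrite ?logn_0l ?expn0 // expn_gt0.
rewrite E (big_cat_nat (n := n.+1)) //=; last by rewrite ltnS leq_addl.
rewrite [X in _ + X]big_nat_cond [X in _ + X]big1 ?Rplus_0_r; last first.
  move=> p /andP [/andP [Hnp _] _]; rewrite lognE; case: ifP => [/and3P [pp _ pd]|_]; last by rewrite /=; ring.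
  by have := Hp p pp pd; rewrite leqNgt Hnp.
rewrite big_ltn // logn_0l Rmult_0_l Rplus_0_l [RHS]big_mkcond /=; apply: eq_bigr => p _.
by case: ifP => // pp; rewrite lognE pp /=; ring.
Qed.

Definition mert n := \rsum_(1 <= p < n.+1 | prime p) (ln (INR p) / INR p).
Definition theta n := \rsum_(1 <= p < n.+1 | prime p) ln (INR p).

Lemma ln_ge0 p : (0 < p)%N -> 0 <= ln (INR p).
Proof. by move=> H; rewrite -ln_1; apply: ln_le; [lra|apply: (le_INR 1); lia]. Qed.

Lemma ln_fact_lower n : INR n * ln (INR n) - INR n <= ln (INR n`!).
Proof.
elim: n => [|n IH]; first by rewrite fact0 /= ln_1; lra.
have Hf := fact_gt0 n.
rewrite factS mult_INR ln_mult; try (by apply: lt_0_INR; lia).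
case: n IH Hf => [|n] IH Hf; first by rewrite fact0 /= ln_1; lra.
have H0 : 0 < INR n.+1 by apply: lt_0_INR; lia.
suff : INR n.+1 * (ln (INR n.+2) - ln (INR n.+1)) <= 1.
  rewrite (S_INR n.+1); lra.
have H1 := exp_ineq1_le (/ INR n.+1).
have E : INR n.+2 = INR n.+1 * (1 + / INR n.+1) by rewrite (S_INR n.+1); field; lra.
have Hi : 0 < / INR n.+1 by apply: Rinv_0_lt_compat.
rewrite E ln_mult //; last lra.
have : ln (1 + / INR n.+1) <= / INR n.+1.
  by rewrite -[X in _ <= X]ln_exp; apply: ln_le; lra.
move=> H; have := Rmult_le_compat_l _ _ _ (Rlt_le _ _ H0) H.
rewrite Rinv_r; lra.
Qed.

Lemma ln_fact_upper n : ln (INR n`!) <= INR n * ln (INR n).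
Proof.
elim: n => [|n IH]; first by rewrite fact0 /= ln_1; lra.
have Hf := fact_gt0 n.
rewrite factS mult_INR ln_mult; try (by apply: lt_0_INR; lia).
case: n IH Hf => [|n] IH Hf; first by rewrite fact0 /= ln_1; lra.
have H0 : 0 < INR n.+1 by apply: lt_0_INR; lia.
have : ln (INR n.+1) <= ln (INR n.+2) by apply: ln_le => //; rewrite (S_INR n.+1); lra.
move=> H; have := Rmult_le_compat_l _ _ _ (Rlt_le _ _ H0) H.
rewrite (S_INR n.+1); lra.
Qed.

Lemma prime_dvd_fact p n : prime p -> (p %| n`!)%N -> (p <= n)%N.
Proof.
move=> pp; elim: n => [|n IH]; first by rewrite fact0 dvdn1 => /eqP E; rewrite E in pp.
rewrite factS Euclid_dvdM // => /orP [H|/IH]; last by move=> H; apply: leq_trans H _.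
exact: dvdn_leq.
Qed.

(** Legendre's formula with floors dropped: a geometric series of total n/(p-1). *)
Lemma logn_fact_upper p n : prime p -> INR (logn p n`!) <= INR n / INR p + INR n / (INR p * (INR p - 1)).
Proof.
move=> pp; rewrite logn_fact //.
have Hp1 : 2 <= INR p by apply: (le_INR 2); have := prime_gt1 pp; lia.
have Hn := pos_INR n.
have div_le m d : (0 < d)%N -> INR (m %/ d) <= INR m / INR d.
  move=> Hd; have Hd0 : 0 < INR d by apply: lt_0_INR; lia.
  apply: (Rmult_le_reg_r (INR d)) => //.
  rewrite /Rdiv Rmult_assoc Rinv_l ?Rmult_1_r; last lra.
  by rewrite -mult_INR; apply: le_INR; have := leq_trunc_div m d; lia.
suff H K : INR (\sum_(1 <= k < K.+1) n %/ p ^ k) <= INR n / (INR p - 1) * (1 - / INR p ^ K).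
  apply: Rle_trans (H n) _.
  have -> : INR n / INR p + INR n / (INR p * (INR p - 1)) = INR n / (INR p - 1) * 1 by field; lra.
  apply: Rmult_le_compat_l.
    by apply: Rmult_le_pos => //; apply/Rlt_le/Rinv_0_lt_compat; lra.
  have : 0 < / INR p ^ n by apply: Rinv_0_lt_compat; apply: pow_lt; lra.
  lra.
elim: K => [|K IH].
  rewrite big_geq //= Rinv_1; lra.
rewrite big_nat_recr // plus_INR.
have pK : 0 < INR p ^ K by apply: pow_lt; lra.
have D := div_le n (p ^ K.+1)%N ltac:(rewrite expn_gt0; have := prime_gt0 pp; lia).
have E : INR (p ^ K.+1) = INR p * INR p ^ K.
  rewrite expnS mult_INR; congr (_ * _); elim: (K) => [|k IHk] //=.
  by rewrite expnS mult_INR IHk.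
rewrite E in D.
have -> : INR n / (INR p - 1) * (1 - / INR p ^ K.+1) = INR n / (INR p - 1) * (1 - / INR p ^ K) + INR n / (INR p * INR p ^ K).
  rewrite /=; field; repeat split; lra.
exact: Rplus_le_compat.
Qed.

(** Telescoping: ln m <= 2 sqrt m makes the term at m at most 6 (1/sqrt(m-1) - 1/sqrt m). *)
Lemma tail_sum n : \rsum_(1 <= p < n.+1 | prime p) (ln (INR p) / (INR p * (INR p - 1))) <= 6.
Proof.
case: n => [|n]; first by rewrite big_geq //; lra.
suff H : \rsum_(1 <= p < n.+2 | prime p) (ln (INR p) / (INR p * (INR p - 1))) <= 6 * (1 - / sqrt (INR n.+1)).
  have : 0 < / sqrt (INR n.+1) by apply: Rinv_0_lt_compat; apply: sqrt_lt_R0; apply: lt_0_INR; lia.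
  lra.
elim: n => [|n IH]; first by rewrite big_mkcond big_nat1 [INR 1]/= sqrt_1 Rinv_1 /=; lra.
rewrite big_mkcond rsum_recr // -big_mkcond; set S := (X in X + _).
have {}IH : S <= 6 * (1 - / sqrt (INR n.+1)) by exact: IH.
set a := sqrt (INR n.+1) in IH *; set b := sqrt (INR n.+2).
have Hn1 : 1 <= INR n.+1 by apply: (le_INR 1); lia.
have Ha : 1 <= a by rewrite -sqrt_1; apply: sqrt_le_1_alt.
have Ea : a * a = INR n.+1 by apply: sqrt_sqrt; lra.
have Eb : b * b = a * a + 1 by rewrite Ea -(S_INR n.+1); apply: sqrt_sqrt; exact: pos_INR.
have Hab : a <= b by apply: sqrt_le_1_alt; rewrite (S_INR n.+1); lra.
have Hi : / b <= / a by apply: Rinv_le_contravar; lra.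
case: ifP => pp; last lra.
have En : INR n.+2 = b * b by rewrite Eb Ea (S_INR n.+1).
rewrite En.
have Hln : ln (b * b) <= 2 * b.
  rewrite ln_mult; try lra.
  have : ln b <= b by rewrite -[X in _ <= X]ln_exp; apply: ln_le; [lra|have := exp_ineq1_le b; lra].
  lra.
have Hb2a : b <= 2 * a.
  have [//|Hlt] := Rle_dec b (2 * a).
  have : 4 * (a * a) <= b * b by have := Rmult_le_compat (2 * a) b (2 * a) b ltac:(lra) ltac:(lra) ltac:(lra) ltac:(lra); lra.
  have : 1 <= a * a by nra.
  lra.
have HT : ln (b * b) / (b * b * (b * b - 1)) <= 6 * (/ a - / b).
  have -> : b * b - 1 = a * a by lra.
  have -> : 6 * (/ a - / b) = 6 * (a * (b - a)) * b * / (b * b * (a * a)) by field; lra.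
  have -> : ln (b * b) / (b * b * (a * a)) = ln (b * b) * / (b * b * (a * a)) by [].
  have P : 0 < / (b * b * (a * a)) by apply: Rinv_0_lt_compat; nra.
  apply: Rmult_le_compat_r; first lra.
  apply: Rle_trans Hln _; apply: Rmult_le_compat_r; first lra.
  have : (b - a) * (b + a) = 1 by lra.
  nra.
lra.
Qed.

(** Mertens' argument: n ln n - n <= ln n! is compared with the prime factorisation of n!; 7 is 1
    plus the 6 of [tail_sum]. *)
Lemma mert_lower n : (0 < n)%N -> ln (INR n) - 7 <= mert n.
Proof.
move=> Hn; have Hn0 : 0 < INR n by apply: lt_0_INR; lia.
have H1 := ln_fact_lower n.
rewrite (ln_factor _ n (fact_gt0 n)) in H1; last by move=> p; exact: prime_dvd_fact.
have H2 : \rsum_(1 <= p < n.+1 | prime p) (INR (logn p n`!) * ln (INR p)) <=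
   INR n * mert n + INR n * 6.
  have := tail_sum n => HT.
  apply: Rle_trans (_ : INR n * mert n + INR n * \big[Rplus/0]_(1 <= p < n.+1 | prime p) (ln (INR p) / (INR p * (INR p - 1))) <= _); last first.
    by apply: Rplus_le_compat_l; apply: Rmult_le_compat_l; lra.
  rewrite /mert !rsum_mull -big_split /=; apply: rsum_le => p pp.
  have Hl := ln_ge0 p (prime_gt0 pp).
  have Hp1 : 2 <= INR p by apply: (le_INR 2); have := prime_gt1 pp; lia.
  have := Rmult_le_compat_r _ _ _ Hl (logn_fact_upper p n pp).
  have -> : (INR n / INR p + INR n / (INR p * (INR p - 1))) * ln (INR p) =
     INR n * (ln (INR p) / INR p) + INR n * (ln (INR p) / (INR p * (INR p - 1))) by field; lra.
  by [].
apply: (Rmult_le_reg_l (INR n)) => //; lra.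
Qed.

Lemma mert_upper_theta n : INR n * mert n <= INR n * ln (INR n) + theta n.
Proof.
have H1 := ln_fact_upper n.
rewrite (ln_factor _ n (fact_gt0 n)) in H1; last by move=> p; exact: prime_dvd_fact.
suff : INR n * mert n - theta n <= \rsum_(1 <= p < n.+1 | prime p) (INR (logn p n`!) * ln (INR p)) by lra.
rewrite /mert /theta rsum_mull -rsum_minus [X in X <= _]big_mkcond [X in _ <= X]big_mkcond /= !big_nat.
apply: rsum_le => p /andP [Hp0 Hpn]; case: ifP => pp; last lra.
have Hl := ln_ge0 p Hp0.
have Hp1 : 0 < INR p by apply: lt_0_INR; lia.
have -> : INR n * (ln (INR p) / INR p) - ln (INR p) = (INR n / INR p - 1) * ln (INR p) by field; lra.
apply: Rmult_le_compat_r => //.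
have H : (n %/ p <= logn p n`!)%N.
  rewrite logn_fact // big_ltn; last by lia.
  by rewrite expn1 leq_addr.
have H2 : INR (n %/ p) <= INR (logn p n`!) by apply: le_INR; lia.
have H3 : INR n < (INR (n %/ p) + 1) * INR p.
  rewrite -S_INR -mult_INR; apply: lt_INR; have := ltn_ceil n Hp0; lia.
have : INR n / INR p < INR (n %/ p) + 1.
  apply: (Rmult_lt_reg_r (INR p)) => //.
  by have -> : INR n / INR p * INR p = INR n by field; lra.
lra.
Qed.

Lemma bin_central_le n : ('C(n.*2, n) <= 2 ^ n.*2)%N.
Proof.
have H : (n < n.*2.+1)%N by rewrite -addnn; lia.
by rewrite (Pascal 1 1 n.*2) (bigD1 (Ordinal H)) //= !exp1n !muln1 leq_addr.
Qed.

(** Every prime in (n, 2n] divides the central binomial coefficient, which is at most 2^(2n). *)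
Lemma theta_double n : theta n.*2 <= theta n + INR n.*2 * ln 2.
Proof.
have Hc : (0 < 'C(n.*2, n))%N by rewrite bin_gt0 -addnn leq_addr.
have Hle : (n <= n.*2)%N by rewrite -addnn leq_addr.
have Hfac : ('C(n.*2, n) * (n`! * n`!) = n.*2`!)%N.
  by have := bin_fact Hle; have -> : (n.*2 - n = n)%N by rewrite -addnn addnK.
have H1 : ln (INR 'C(n.*2, n)) <= INR n.*2 * ln 2.
  have := ln_expn 2 n.*2 isT; rewrite [INR 2]/= => <-.
  apply: ln_le; first by apply: lt_0_INR; lia.
  by apply: le_INR; apply/leP; exact: bin_central_le.
rewrite (ln_factor _ n.*2 Hc) in H1; last first.
  by move=> p pp pd; apply: (prime_dvd_fact p _ pp); rewrite -Hfac dvdn_mulr.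
have E : theta n.*2 = theta n + \rsum_(n.+1 <= p < n.*2.+1 | prime p) ln (INR p).
  by rewrite /theta (big_cat_nat (n := n.+1)) //= ltnS.
have E2 : \rsum_(1 <= p < n.*2.+1 | prime p) (INR (logn p 'C(n.*2, n)) * ln (INR p)) =
   \rsum_(1 <= p < n.+1 | prime p) (INR (logn p 'C(n.*2, n)) * ln (INR p)) +
   \rsum_(n.+1 <= p < n.*2.+1 | prime p) (INR (logn p 'C(n.*2, n)) * ln (INR p)).
  by rewrite (big_cat_nat (n := n.+1)) //= ltnS.
rewrite E2 in H1.
have P : 0 <= \rsum_(1 <= p < n.+1 | prime p) (INR (logn p 'C(n.*2, n)) * ln (INR p)).
  by apply: rsum_ge0 => p pp; apply: Rmult_le_pos; [exact: pos_INR|exact: ln_ge0 (prime_gt0 pp)].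
have L : \rsum_(n.+1 <= p < n.*2.+1 | prime p) ln (INR p) <=
   \rsum_(n.+1 <= p < n.*2.+1 | prime p) (INR (logn p 'C(n.*2, n)) * ln (INR p)).
  rewrite [X in X <= _]big_mkcond [X in _ <= X]big_mkcond /= !big_nat.
  apply: rsum_le => p /andP [Hp0 Hpn]; case: ifP => pp; last lra.
  have Hl := ln_ge0 p (prime_gt0 pp).
  have pd : (p %| 'C(n.*2, n))%N.
    have : (p %| 'C(n.*2, n) * (n`! * n`!))%N by rewrite Hfac dvdn_fact // prime_gt0.
    rewrite !Euclid_dvdM // => /orP [//|]; rewrite orbb => /(prime_dvd_fact _ _ pp).
    by rewrite leqNgt Hp0.
  have : 1 <= INR (logn p 'C(n.*2, n)).
    by apply: (le_INR 1); have : (0 < logn p 'C(n.*2, n))%N; [rewrite logn_gt0 mem_primes pp Hc pd|lia].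
  nra.
lra.
Qed.

(** Induction by halving, with ln 2 <= 1; an odd n costs one further term ln n <= n. *)
Lemma theta_le n : theta n <= 4 * INR n.
Proof.
have L2 : 0 <= ln 2 <= 1.
  split; first by rewrite -ln_1; apply: ln_le; lra.
  by rewrite -(ln_exp 1); apply: ln_le; [lra|have := exp_ineq1_le 1; lra].
elim/ltn_ind: n => n IH.
have [Hn|Hn] := leqP n 0.
  by move: Hn; rewrite leqn0 => /eqP ->; rewrite /theta big_geq //=; lra.
have Dk k : (k < n)%N -> theta k.*2 <= 6 * INR k.
  move=> Hk; have := theta_double k; have := IH k Hk.
  rewrite -addnn plus_INR; have := pos_INR k; nra.
have Hk : (n./2 < n)%N by rewrite -divn2 ltn_Pdiv.
have D := Dk _ Hk.
have E := odd_double_half n.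
have P := pos_INR n./2.
have En : INR n = INR (odd n) + 2 * INR n./2.
  by rewrite -{1}E plus_INR -addnn plus_INR; ring.
case Ho: (odd n) E En => /= E En; last first.
  by rewrite add0n in E; rewrite E in D; lra.
rewrite -{1}E add1n /theta big_mkcond rsum_recr // -big_mkcond -/(theta _).
have -> : INR n./2.*2.+1 = INR n by rewrite -add1n E.
have Hln : ln (INR n) <= INR n.
  rewrite -[X in _ <= X]ln_exp; apply: ln_le; first by apply: lt_0_INR; lia.
  have := exp_ineq1_le (INR n); lra.
have Hl := ln_ge0 n Hn.
case: ifP => _; lra.
Qed.

Lemma mert_upper n : (0 < n)%N -> mert n <= ln (INR n) + 4.
Proof.
move=> Hn; have Hn0 : 0 < INR n by apply: lt_0_INR; lia.
apply: (Rmult_le_reg_l (INR n)) => //.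
have := mert_upper_theta n; have := theta_le n; lra.
Qed.

(** On the interval 1/p >= ln p / (p ln b), and the two Mertens bounds lose 7 + 4 = 11. *)
Lemma prime_inv_sum a b : (0 < a)%N -> (a <= b)%N -> (1 < b)%N ->
  (ln (INR b) - ln (INR a) - 11) / ln (INR b) <= \rsum_(a.+1 <= p < b.+1 | prime p) (/ INR p).
Proof.
move=> Ha Hab Hb.
have Hb0 : 0 < ln (INR b).
  by rewrite -ln_1; apply: ln_increasing; [lra|apply: (lt_INR 1); lia].
have E : mert b = mert a + \rsum_(a.+1 <= p < b.+1 | prime p) (ln (INR p) / INR p).
  by rewrite /mert (big_cat_nat (n := a.+1)) //= ltnS.
have L : \rsum_(a.+1 <= p < b.+1 | prime p) (ln (INR p) / INR p) <= ln (INR b) * \big[Rplus/0]_(a.+1 <= p < b.+1 | prime p) (/ INR p).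
  rewrite rsum_mull [X in X <= _]big_mkcond [X in _ <= X]big_mkcond /= !big_nat.
  apply: rsum_le => p /andP [Hp0 Hpn]; case: ifP => pp; last lra.
  have Hp1 : 0 < INR p by apply: lt_0_INR; lia.
  apply: Rmult_le_compat_r; first exact/Rlt_le/Rinv_0_lt_compat.
  by apply: ln_le => //; apply: le_INR; lia.
have := mert_upper a Ha; have := mert_lower b (ltn_trans (ltnSn 0) Hb).
move=> M1 M2.
apply: (Rmult_le_reg_l (ln (INR b))) => //.
have -> : ln (INR b) * ((ln (INR b) - ln (INR a) - 11) / ln (INR b)) = ln (INR b) - ln (INR a) - 11 by field; lra.
lra.
Qed.

(** * Products of a prescribed number of primes from one block *)

Section Block.
Variables (n : nat) (q : 'I_n -> nat) (lo : nat).
Hypotheses (Hinj : injective q) (Hpr : forall i, prime (q i)) (Hlo0 : (0 < lo)%N) (Hlo : forall i, (lo < q i)%N).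
Implicit Types S : {set 'I_n}.

Definition pr S := (\prod_(i in S) q i)%N.

Lemma pr_gt0 S : (0 < pr S)%N.
Proof. by apply: prodn_cond_gt0 => i _; exact: prime_gt0. Qed.

Lemma pr_U1 S x : x \notin S -> pr (x |: S) = (q x * pr S)%N.
Proof. by move=> H; rewrite /pr big_setU1. Qed.

Lemma prime_dvd_pr p S : prime p -> (p %| pr S)%N -> exists2 i, i \in S & p = q i.
Proof.
move=> pp; rewrite /pr; elim/big_rec: _ => [|i x Hi IH].
  by rewrite dvdn1 => /eqP E; rewrite E in pp.
rewrite Euclid_dvdM // => /orP [|//].
by rewrite dvdn_prime2 // => /eqP ->; exists i.
Qed.

Lemma dvd_pr i S : (q i %| pr S)%N = (i \in S).
Proof.
apply/idP/idP => [/(prime_dvd_pr _ _ (Hpr i)) [j Hj /Hinj ->] //|Hi].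
by rewrite /pr (bigD1 i) //= dvdn_mulr.
Qed.

Lemma pr_inj : injective pr.
Proof. by move=> S S' E; apply/setP => i; rewrite -!dvd_pr E. Qed.

Lemma pr_sub S S' : S \subset S' -> (pr S %| pr S')%N.
Proof. by move=> H; rewrite /pr [X in (_ %| X)%N](big_setID S) (setIidPr H); apply: dvdn_mulr. Qed.

Definition stot := \rsum_(i <- index_enum 'I_n) (/ INR (q i)).
Definition HH S i := \rsum_(S2 <- index_enum {set 'I_n} | (S \subset S2) && (#|S2| == #|S| + i)%N) (/ INR (pr S2)).

Lemma stot_compl S J : (#|S| <= J)%N -> stot - INR J / INR lo <= \rsum_(x <- index_enum 'I_n | x \notin S) (/ INR (q x)).
Proof.
move=> HS; rewrite /stot (bigID (fun x => x \in S)) /=.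
have Hl : 0 < INR lo by apply: lt_0_INR; lia.
set A := (X in X + _ - _); set B := (X in A + X - _).
change (A + B - INR J / INR lo <= B).
suff : A <= INR J / INR lo by lra.
apply: Rle_trans (_ : \rsum_(x <- index_enum 'I_n | x \in S) (/ INR lo) <= _).
  apply: rsum_le => i _; apply: Rinv_le_contravar => //; apply: le_INR; have := Hlo i; lia.
rewrite big_const; have -> : (#|S| = #|[pred x in S]|)%N by [].
have E k : iter k (Rplus (/ INR lo)) 0 = INR k * / INR lo.
  elim: k => [|k IH]; first by rewrite /=; ring.
  by rewrite iterS IH S_INR; ring.
rewrite E; apply: Rmult_le_compat_r; first exact/Rlt_le/Rinv_0_lt_compat.
by apply: le_INR; apply/leP.
Qed.

(** Double counting: a superset with i + 1 extra primes arises from i + 1 choices of the prime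
    adjoined first. *)
Lemma HH_step S i : INR i.+1 * HH S i.+1 = \rsum_(x <- index_enum 'I_n | x \notin S) HH (x |: S) i.
Proof.
transitivity (\rsum_(S2 <- index_enum {set 'I_n} | (S \subset S2) && (#|S2| == #|S| + i.+1)%N)
   \rsum_(x <- index_enum 'I_n | x \in S2 :\: S) (/ INR (pr S2))).
  rewrite /HH rsum_mull; apply: eq_bigr => S2 /andP [Hs /eqP Hc].
  rewrite big_const.
  have E k c : iter k (Rplus c) 0 = INR k * c.
    elim: k => [|k IH]; first by rewrite /=; ring.
    by rewrite iterS IH S_INR; ring.
  have -> : #|(fun x => x \in S2 :\: S)| = i.+1; last by rewrite E.
  transitivity #|S2 :\: S|; first by apply: eq_card => x.
  by rewrite cardsD (setIidPr Hs) Hc addKn.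
rewrite (exchange_big_dep (fun x => x \notin S)) /=; last by move=> S2 x _; rewrite inE => /andP [].
apply: eq_bigr => x Hx; apply: eq_bigl => S2.
rewrite subUset sub1set !inE Hx /= cardsU1 Hx addnS /= add1n addSn.
by case: (S \subset S2); case: (x \in S2); rewrite ?andbT ?andbF.
Qed.

(** Primes are adjoined one at a time; each step has reciprocal mass at least stot - J/lo available,
    and i! orders lead to the same set. *)
Lemma HH_lower J i S : (#|S| + i <= J)%N -> 0 <= stot - INR J / INR lo ->
  / INR (pr S) * ((stot - INR J / INR lo) ^ i / INR i`!) <= HH S i.
Proof.
set d := stot - _ => + Hd; elim: i S => [|i IH] S HJ.
  rewrite fact0 [_ ^ 0]/= [INR 1]/= Rdiv_1_r Rmult_1_r /HH (bigD1 S) /=; last by rewrite subxx addn0 eqxx.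
  rewrite -[X in X <= _]Rplus_0_r; apply: Rplus_le_compat_l; apply: rsum_ge0 => S2 _; exact: inv_INR_ge0.
have Hi : 0 < INR i.+1 by apply: lt_0_INR; lia.
have Hf : 0 < INR i`! by apply: lt_0_INR; have := fact_gt0 i; lia.
apply: (Rmult_le_reg_l (INR i.+1)) => //; rewrite HH_step.
have HP : 0 < / INR (pr S) by apply: Rinv_0_lt_compat; apply: lt_0_INR; have := pr_gt0 S; lia.
have Hdi : 0 <= d ^ i / INR i`!.
  by apply: Rmult_le_pos; [exact: pow_le|exact/Rlt_le/Rinv_0_lt_compat].
apply: Rle_trans (_ : (/ INR (pr S) * (d ^ i / INR i`!)) * (\rsum_(x <- index_enum 'I_n | x \notin S) (/ INR (q x))) <= _).
  have H := stot_compl S J ltac:(lia); rewrite -/d in H.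
  have -> : INR i.+1 * (/ INR (pr S) * (d ^ i.+1 / INR (i.+1)`!)) = / INR (pr S) * (d ^ i / INR i`!) * d.
    by rewrite factS mult_INR [d ^ i.+1]/=; field; repeat split; try lra; apply: Rgt_not_eq; apply: lt_0_INR; have := pr_gt0 S; lia.
  by apply: Rmult_le_compat_l => //; apply: Rmult_le_pos; lra.
rewrite rsum_mull; apply: rsum_le => x Hx.
apply: Rle_trans (IH (x |: S) _); last by rewrite cardsU1 Hx; lia.
rewrite pr_U1 // mult_INR Rinv_mult; apply: Req_le; ring.
Qed.

Definition lst j := [seq pr B | B <- enum [set B : {set 'I_n} | #|B| == j]].

Lemma lst_uniq j : uniq (lst j).
Proof. by rewrite map_inj_uniq ?enum_uniq //; exact: pr_inj. Qed.

Lemma size_lst j : size (lst j) = 'C(n, j).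
Proof. by rewrite size_map -cardE card_draws card_ord. Qed.

Lemma hsum_lst j : hsum (lst j) = \rsum_(S <- index_enum {set 'I_n} | #|S| == j) (/ INR (pr S)).
Proof. by rewrite /hsum /lst big_map big_enum /=; apply: eq_bigl => S; rewrite inE. Qed.

Lemma hsum_lst_gt0 j : (j <= n)%N -> 0 < hsum (lst j).
Proof.
move=> Hj; have : (0 < size (lst j))%N by rewrite size_lst bin_gt0.
case E : (lst j) => [|m l] // _.
have Hm : (0 < m)%N.
  have : m \in lst j by rewrite E mem_head.
  by move/mapP => [S _ ->]; exact: pr_gt0.
rewrite /hsum big_cons.
have : 0 < / INR m by apply: Rinv_0_lt_compat; apply: lt_0_INR; lia.
have : 0 <= \rsum_(m <- l) (/ INR m) by apply: rsum_ge0 => i _; exact: inv_INR_ge0.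
lra.
Qed.

Lemma linksum_lst j1 j2 :
  \rsum_(S1 <- index_enum {set 'I_n} | #|S1| == j1)
    \rsum_(S2 <- index_enum {set 'I_n} | (S1 \subset S2) && (#|S2| == j2)) (/ INR (pr S2)) <= linksum (lst j1) (lst j2).
Proof.
rewrite /linksum /lst big_map big_enum /= [X in X <= _]big_mkcond [X in _ <= X]big_mkcond.
apply: rsum_le => S1 _; rewrite inE; case: ifP => _; last lra.
rewrite big_map big_enum_cond /= [X in X <= _]big_mkcond [X in _ <= X]big_mkcond.
apply: rsum_le => S2 _; rewrite inE; have P := inv_INR_ge0 (pr S2).
case: (boolP (S1 \subset S2)) => [Hs|_] /=; last by case: ifP => _; lra.
by rewrite (pr_sub _ _ Hs) andbT; lra.
Qed.

(** The link sum is bounded below twice, by summing over supersets of the smaller set and over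
    subsets of the larger one. The geometric mean of the two bounds has both reciprocal sums under
    one square root, as needed for the ratio. *)
Lemma block_link J i : (i <= J)%N -> (J <= n)%N -> 0 <= stot - INR J / INR lo ->
  sqrt (((INR J - INR i) * (stot - INR J / INR lo)) ^ i) / INR i`! * sqrt (hsum (lst (J - i)%N) * hsum (lst J))
  <= linksum (lst (J - i)%N) (lst J).
Proof.
move=> HiJ HJn Hd; set d := stot - _ in Hd *.
have L := linksum_lst (J - i)%N J; set Sg := linksum _ _ in L *.
set Sm := \rsum_(S1 <- _ | _) _ in L.
have P1 := hsum_lst_gt0 (J - i)%N ltac:(lia). have P2 := hsum_lst_gt0 J HJn.
have Hf : 0 < INR i`! by apply: lt_0_INR; have := fact_gt0 i; lia.
have A1 : hsum (lst (J - i)%N) * (d ^ i / INR i`!) <= Sm.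
  rewrite hsum_lst rsum_mulr; apply: rsum_le => S1 /eqP Hc.
  have HJ : (#|S1| + i <= J)%N by lia.
  apply: Rle_trans (HH_lower J i S1 HJ Hd) _.
  apply: Req_le; rewrite /HH; apply: eq_bigl => S2; by rewrite Hc subnK.
have A2 : Sm = hsum (lst J) * INR 'C(J, i).
  rewrite /Sm (exchange_big_dep (fun S2 => #|S2| == J)) /=; last by move=> S1 S2 _ /andP [].
  rewrite hsum_lst rsum_mulr; apply: eq_bigr => S2 /eqP Hc.
  rewrite big_const.
  have E k c : iter k (Rplus c) 0 = INR k * c.
    elim: k => [|k IH]; first by rewrite /=; ring.
    by rewrite iterS IH S_INR; ring.
  rewrite E Rmult_comm; congr (_ * INR _).
  have -> : 'C(J, i) = #|[set S1 : {set 'I_n} | S1 \subset S2 & #|S1| == (J - i)%N]|.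
    by rewrite cards_draws Hc bin_sub.
  by apply: eq_card => S1; rewrite !inE unfold_in /= Hc eqxx andbT andbC.
(* C(J, i) i! is a product of i factors, each larger than J - i. *)
have A3 : (INR J - INR i) ^ i / INR i`! <= INR 'C(J, i).
  apply: (Rmult_le_reg_r (INR i`!)) => //.
  have -> : (INR J - INR i) ^ i / INR i`! * INR i`! = (INR J - INR i) ^ i by field; lra.
  rewrite -mult_INR; have -> : ('C(J, i) * i`!)%coq_nat = (J ^_ i)%N by exact: bin_ffact.
  rewrite -minus_INR; last by apply/leP.
  have : ((J - i) ^ i <= J ^_ i)%N.
    clear -HiJ; elim: i J HiJ => [|i IH] J HiJ; first by rewrite expn0 ffactn0.
    case: J HiJ => [//|J] HiJ; rewrite ffactSS expnS subSS; apply: leq_mul; first by lia.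
    exact: IH.
  have E m k : INR (m ^ k) = INR m ^ k.
    by elim: k => [|k IHk] //; rewrite expnS mult_INR IHk.
  by move=> H; rewrite -E; apply: le_INR; apply/leP.
set X1 := hsum (lst (J - i)%N) in P1 A1 *; set X2 := hsum (lst J) in P2 A2 *.
have HJi : 0 <= INR J - INR i.
  have : INR i <= INR J by apply: le_INR; lia.
  lra.
have Hdi : 0 <= d ^ i / INR i`! by apply: Rmult_le_pos; [exact: pow_le|exact/Rlt_le/Rinv_0_lt_compat].
have B1 : X1 * (d ^ i / INR i`!) <= Sg by lra.
have B2 : X2 * ((INR J - INR i) ^ i / INR i`!) <= Sg.
  by have := Rmult_le_compat_l _ _ _ (Rlt_le _ _ P2) A3; lra.
have Hji : 0 <= (INR J - INR i) ^ i / INR i`! by apply: Rmult_le_pos; [exact: pow_le|exact/Rlt_le/Rinv_0_lt_compat].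
have C1 : 0 <= X1 * (d ^ i / INR i`!) by apply: Rmult_le_pos; lra.
have C2 : 0 <= X2 * ((INR J - INR i) ^ i / INR i`!) by apply: Rmult_le_pos; lra.
have HSg : 0 <= Sg by lra.
have B3 := Rmult_le_compat _ _ _ _ C1 C2 B1 B2.
have Hx : 0 <= ((INR J - INR i) * d) ^ i by apply: pow_le; exact: Rmult_le_pos.
have -> : sqrt (((INR J - INR i) * d) ^ i) / INR i`! * sqrt (X1 * X2) =
   sqrt (X1 * (d ^ i / INR i`!) * (X2 * ((INR J - INR i) ^ i / INR i`!))).
  have Hif := Rinv_0_lt_compat _ Hf.
  have Hff : 0 <= / INR i`! * / INR i`! by apply: Rmult_le_pos; lra.
  have -> : sqrt (((INR J - INR i) * d) ^ i) / INR i`! = sqrt (((INR J - INR i) * d) ^ i * (/ INR i`! * / INR i`!)).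
    by rewrite sqrt_mult // sqrt_square //; lra.
  rewrite -sqrt_mult; [|by apply: Rmult_le_pos|by apply: Rmult_le_pos; lra].
  by congr sqrt; rewrite Rpow_mult_distr; field; lra.
by rewrite -[X in _ <= X]sqrt_square //; apply: sqrt_le_1_alt.
Qed.
End Block.

(** * Resonator pairs, their products, and the gain of one block *)

(** Q bounds the sizes and rho is the gain; the prime factors are confined to (lo, hi] so that pairs
    over adjacent intervals can be multiplied. *)
Definition resonator (N1 N2 : seq nat) (Q rho : R) (lo hi : nat) :=
  [/\ uniq N1 /\ uniq N2,
   (forall m, m \in N1 ++ N2 -> (0 < m)%N /\ forall p, prime p -> (p %| m)%N -> (lo < p <= hi)%N),
   (INR (size N1) <= Q /\ INR (size N2) <= Q), (0 < hsum N1 /\ 0 < hsum N2) &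
   rho * sqrt (hsum N1 * hsum N2) <= linksum N1 N2].

Lemma resonator1 a b : resonator [:: 1%N] [:: 1%N] 1 1 a b.
Proof.
split => //.
- move=> m; rewrite !inE orbb => /eqP ->; split => // p pp; rewrite dvdn1 => /eqP E; by rewrite E in pp.
- rewrite /=; lra.
- rewrite /hsum big_seq1 /= Rinv_1; lra.
by rewrite /linksum /hsum !big_seq1 big_mkcond big_seq1 /= Rinv_1 !Rmult_1_l sqrt_1; lra.
Qed.

Lemma resonator_weaken N1 N2 Q rho lo hi Q' rho' : resonator N1 N2 Q rho lo hi ->
  Q <= Q' -> rho' <= rho -> resonator N1 N2 Q' rho' lo hi.
Proof.
move=> [H1 H2 [H4 H4'] H5 H6] HQ Hr; split => //; first by split; lra.
apply: Rle_trans H6; apply: Rmult_le_compat_r => //; exact: sqrt_pos.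
Qed.

Definition prodl (s t : seq nat) := [seq (x * y)%N | x <- s, y <- t].

Lemma resonator_mul N1 N2 M1 M2 Q Q' rho rho' a b c : (a <= b)%N -> (b <= c)%N -> 0 <= rho -> 0 <= rho' ->
  resonator N1 N2 Q rho a b -> resonator M1 M2 Q' rho' b c ->
  resonator (prodl N1 M1) (prodl N2 M2) (Q * Q') (rho * rho') a c.
Proof.
move=> Hab Hbc Hr Hr' [[U1 U2] HN [S1 S2] [P1 P2] L] [[V1 V2] HM [T1 T2] [R1 R2] K].
have cop x y : x \in N1 ++ N2 -> y \in M1 ++ M2 -> coprime x y.
  move=> /HN [Hx Hx'] /HM [Hy Hy']; rewrite coprime_has_primes //; apply/hasPn => p.
  rewrite mem_primes => /and3P [pp _ /(Hy' p pp) /andP [H1 _]].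
  apply/negP => /=; rewrite mem_primes => /and3P [_ _ /(Hx' p pp) /andP [_ H2]].
  by move: H1; rewrite ltnNge H2.
have dv x y x' y' : x \in N1 ++ N2 -> x' \in N1 ++ N2 -> y \in M1 ++ M2 -> y' \in M1 ++ M2 ->
  (x * y)%N = (x' * y')%N -> (x, y) = (x', y').
  move=> Hx Hx' Hy Hy' E.
  have Exx : x = x'.
    apply/eqP; rewrite eqn_dvd; apply/andP; split.
      by rewrite -(Gauss_dvdl _ (cop x y' Hx Hy')) -E dvdn_mulr.
    by rewrite -(Gauss_dvdl _ (cop x' y Hx' Hy)) E dvdn_mulr.
  move: E; rewrite Exx => /eqP; rewrite eqn_pmul2l; last by have [] := HN x' Hx'.
  by move/eqP ->.
have i1 : {subset N1 <= N1 ++ N2} by move=> z Hz; rewrite mem_cat Hz.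
have i2 : {subset N2 <= N1 ++ N2} by move=> z Hz; rewrite mem_cat Hz orbT.
have j1 : {subset M1 <= M1 ++ M2} by move=> z Hz; rewrite mem_cat Hz.
have j2 : {subset M2 <= M1 ++ M2} by move=> z Hz; rewrite mem_cat Hz orbT.
have un s t : {subset s <= N1 ++ N2} -> {subset t <= M1 ++ M2} -> uniq s -> uniq t -> uniq (prodl s t).
  move=> Hs Ht us ut; apply: allpairs_uniq => // -[x y] [x' y'].
  move=> /allpairsP [[u v] /= [Hu Hv [-> ->]]] /allpairsP [[u' v'] /= [Hu' Hv' [-> ->]]] /= E.
  by apply: dv => //; [exact: Hs|exact: Hs|exact: Ht|exact: Ht].
have mem s t m : {subset s <= N1 ++ N2} -> {subset t <= M1 ++ M2} -> m \in prodl s t ->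
   (0 < m)%N /\ forall p, prime p -> (p %| m)%N -> (a < p <= c)%N.
  move=> Hs Ht /allpairsP [[u v] /= [/Hs /HN [Hu Hu'] /Ht /HM [Hv Hv'] ->]].
  split; first by rewrite muln_gt0 Hu.
  move=> p pp; rewrite Euclid_dvdM // => /orP [/(Hu' p pp)|/(Hv' p pp)] /andP [H1 H2].
    by rewrite H1 (leq_trans H2).
  by rewrite (leq_ltn_trans Hab H1).
have hm s t : hsum (prodl s t) = hsum s * hsum t.
  rewrite /hsum /prodl big_allpairs_dep /= big_distrlr /=.
  by apply: eq_bigr => x _; apply: eq_bigr => y _; rewrite mult_INR Rinv_mult.
have sz s t Q1 Q2 : INR (size s) <= Q1 -> INR (size t) <= Q2 -> INR (size (prodl s t)) <= Q1 * Q2.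
  move=> H1 H2; rewrite size_allpairs mult_INR; apply: Rmult_le_compat => //; exact: pos_INR.
split.
- by split; apply: un.
- by move=> m; rewrite mem_cat => /orP [H|H]; [apply: (mem N1 M1)|apply: (mem N2 M2)].
- by split; apply: sz.
- by rewrite !hm; split; apply: Rmult_lt_0_compat.
have LL : linksum N1 N2 * linksum M1 M2 <= linksum (prodl N1 M1) (prodl N2 M2).
  rewrite /linksum /prodl big_allpairs_dep big_distrlr /=.
  apply: rsum_le => x _; apply: rsum_le => y _.
  rewrite big_distrlr /= big_mkcond [X in _ <= X]big_mkcond big_allpairs_dep /=.
  apply: rsum_le => x' _; case: ifP => Hx; last first.
    apply: rsum_ge0 => y' _; case: ifP => _; [exact: inv_INR_ge0|lra].
  rewrite big_mkcond; apply: rsum_le => y' _; case: ifP => Hy.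
    by rewrite dvdn_mul // mult_INR Rinv_mult; lra.
  case: ifP => _; [exact: inv_INR_ge0|lra].
apply: Rle_trans LL; rewrite !hm.
have -> : rho * rho' * sqrt (hsum N1 * hsum M1 * (hsum N2 * hsum M2)) =
   (rho * sqrt (hsum N1 * hsum N2)) * (rho' * sqrt (hsum M1 * hsum M2)).
  have -> : hsum N1 * hsum M1 * (hsum N2 * hsum M2) = (hsum N1 * hsum N2) * (hsum M1 * hsum M2) by ring.
  rewrite sqrt_mult; try (by apply: Rmult_le_pos; lra). ring.
by apply: Rmult_le_compat => //; apply: Rmult_le_pos => //; exact: sqrt_pos.
Qed.

Lemma ln_fact_stirling i : (0 < i)%N -> ln (INR i`!) <= INR i * ln (INR i) - INR i + ln (INR i) + 1.
Proof.
case: i => // i _; elim: i => [|i IH]; first by rewrite /= ln_1; lra.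
have H0 : 0 < INR i.+1 by apply: lt_0_INR; lia.
have H1 : 0 < INR i.+2 by apply: lt_0_INR; lia.
have Hf := fact_gt0 i.+1.
rewrite factS mult_INR ln_mult //; last by apply: lt_0_INR; lia.
suff : 1 <= INR i.+2 * (ln (INR i.+2) - ln (INR i.+1)).
  have E : INR i.+2 = INR i.+1 + 1 by rewrite (S_INR i.+1).
  move=> H; rewrite E in H *; lra.
have L : ln (INR i.+1 / INR i.+2) <= - / INR i.+2.
  have E : INR i.+1 / INR i.+2 = 1 + - / INR i.+2 by rewrite (S_INR i.+1); field; rewrite -(S_INR i.+1); lra.
  rewrite -[X in _ <= X]ln_exp; apply: ln_le; first exact: Rdiv_lt_0_compat.
  rewrite E; exact: exp_ineq1_le.
have E : ln (INR i.+1 / INR i.+2) = ln (INR i.+1) - ln (INR i.+2).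
  by rewrite /Rdiv ln_mult // ?ln_Rinv //; exact: Rinv_0_lt_compat.
rewrite E in L.
have H2 : / INR i.+2 <= ln (INR i.+2) - ln (INR i.+1) by lra.
have := Rmult_le_compat_l _ _ _ (Rlt_le _ _ H1) H2; rewrite Rinv_r; lra.
Qed.

Lemma ln_bin_le n j b : (0 < j)%N -> (j <= n)%N -> (n <= b)%N ->
  ln (INR 'C(n, j)) <= INR j * (1 + ln (INR b) - ln (INR j)).
Proof.
move=> Hj Hjn Hnb.
have Hb0 : 0 < INR b by apply: lt_0_INR; lia.
have Hc : (0 < 'C(n, j))%N by rewrite bin_gt0.
have Hf := fact_gt0 j.
have H : ('C(n, j) * j`! <= b ^ j)%N.
  rewrite bin_ffact; apply: (@leq_trans (n ^ j)%N); last by rewrite leq_exp2r.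
  elim: j n Hjn {Hj Hnb Hc Hf} => [|j IH] n Hjn; first by rewrite ffactn0.
  rewrite ffactnS expnS leq_mul2l; apply/orP; right.
  have [Hn|Hn] := leqP j n.-1; last by rewrite ffact_small.
  apply: leq_trans (IH _ Hn) _; case: (j) => // k; rewrite leq_exp2r //; exact: leq_pred.
have L : ln (INR ('C(n, j) * j`!)) <= INR j * ln (INR b).
  rewrite -ln_expn; last by lia.
  apply: ln_le; first by apply: lt_0_INR; have : (0 < 'C(n, j) * j`!)%N by [rewrite muln_gt0 Hc Hf]; lia.
  by apply: le_INR; apply/leP.
rewrite mult_INR ln_mult in L; try (by apply: lt_0_INR; lia).
have := ln_fact_lower j; lra.
Qed.

Definition psum a b := \rsum_(a.+1 <= p < b.+1 | prime p) (/ INR p).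

(** The last hypothesis turns the gain of [block_link] into at least i^i / i!, roughly e^i. The
    condition 2 i <= J gives J - i >= J/2, so one binomial bound serves for both layers. *)
Lemma block_interval a b J i : (0 < a)%N -> (0 < i)%N -> (i.*2 <= J)%N ->
  INR J / INR a <= psum a b ->
  INR i * INR i <= (INR J - INR i) * (psum a b - INR J / INR a) ->
  exists N1 N2, resonator N1 N2 (exp (INR J * (2 + ln (INR b) - ln (INR J)))) (exp (INR i - 1 - ln (INR i))) a b.
Proof.
move=> Ha Hi HiJ Hs Hii.
pose ps := [seq p <- index_iota a.+1 b.+1 | prime p].
have Hups : uniq ps by rewrite filter_uniq // iota_uniq.
have Hps p : p \in ps -> prime p /\ (a < p <= b)%N.
  by rewrite mem_filter mem_index_iota ltnS => /andP [].
pose n := size ps; pose q (k : 'I_n) := nth 0%N ps k.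
have Hmem k : q k \in ps by rewrite mem_nth.
have Hinj : injective q.
  by move=> k k' /eqP; rewrite nth_uniq // => /eqP E; apply: val_inj.
have Hpr k : prime (q k) by have [] := Hps _ (Hmem k).
have Hlo k : (a < q k)%N by have [_ /andP []] := Hps _ (Hmem k).
have Est : stot n q = psum a b.
  have -> : psum a b = \rsum_(p <- ps) (/ INR p) by rewrite /ps big_filter.
  by rewrite [RHS](big_nth 0%N) big_mkord.
have Ha0 : 0 < INR a by apply: lt_0_INR; lia.
(* Each prime contributes at most 1/a, so J/a <= psum forces at least J primes in the interval. *)
have HnJ : (J <= n)%N.
  have H1 : psum a b <= INR n * / INR a.
    rewrite -Est /stot; apply: Rle_trans (_ : \rsum_(k <- index_enum 'I_n) (/ INR a) <= _).
      apply: rsum_le => k _; apply: Rinv_le_contravar => //; apply: le_INR; have := Hlo k; lia.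
    rewrite rsum_const_seq; apply: Req_le; congr (INR _ * _).
    by rewrite -[RHS]card_ord cardE enumT.
  apply/leP/INR_le.
  apply: (Rmult_le_reg_r (/ INR a)); first exact: Rinv_0_lt_compat.
  rewrite /Rdiv in Hs; lra.
have Hnb : (n <= b)%N.
  have : (size ps <= size (index_iota 1 b.+1))%N.
    apply: uniq_leq_size => // p /Hps [pp /andP [H1 H2]]; rewrite mem_index_iota ltnS H2 andbT; exact: prime_gt0.
  by rewrite size_iota subn1.
have HJ : (i <= J)%N by rewrite -addnn in HiJ; lia.
have Hi1 : 1 <= INR i by apply: (le_INR 1); lia.
have HJi : INR i + INR i <= INR J by rewrite -plus_INR; apply: le_INR; rewrite -addnn in HiJ; lia.
have HB := block_link n q a Hpr Ha Hlo J i HJ HnJ.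
rewrite Est in HB; have {}HB := HB ltac:(lra).
have HJ0 : 0 < INR J by lra.
have bound j : (J <= j.*2)%N -> (j <= J)%N -> INR 'C(n, j) <= exp (INR J * (2 + ln (INR b) - ln (INR J))).
  move=> H1 H2.
  have Hj0 : (0 < j)%N by rewrite -addnn in H1 HiJ; lia.
  have Hjn : (j <= n)%N by apply: leq_trans HnJ.
  have Hc : 0 < INR 'C(n, j) by apply: lt_0_INR; have : (0 < 'C(n, j))%N by [rewrite bin_gt0]; lia.
  rewrite -[X in X <= _]exp_ln //; apply: exp_le_compat.
  apply: Rle_trans (ln_bin_le n j b Hj0 Hjn Hnb) _.
  have Hj1 : 0 < INR j by apply: lt_0_INR; lia.
  have HjJ : INR j <= INR J by apply: le_INR; lia.
  have HJj : INR J <= 2 * INR j.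
    have -> : 2 * INR j = INR j.*2 by rewrite -addnn plus_INR; ring.
    by apply: le_INR; lia.
  have L1 : ln (INR J) <= ln 2 + ln (INR j) by rewrite -ln_mult; [apply: ln_le|lra|lra].
  have L2 : ln 2 <= 1 by rewrite -(ln_exp 1); apply: ln_le; [lra|have := exp_ineq1_le 1; lra].
  have L3 : ln (INR J) <= ln (INR b) by apply: ln_le => //; apply: le_INR; lia.
  apply: Rle_trans (_ : INR j * (2 + ln (INR b) - ln (INR J)) <= _).
    apply: Rmult_le_compat_l; lra.
  apply: Rmult_le_compat_r; lra.
exists (lst n q (J - i)%N), (lst n q J); split.
- by split; apply: lst_uniq.
- move=> m Hm.
  have [B ->] : exists B, m = pr n q B.
    by move: Hm; rewrite mem_cat => /orP [] /mapP [B _ ->]; exists B.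
  split; first exact: pr_gt0.
  move=> p pp /(prime_dvd_pr n q Hpr p B pp) [k _ ->].
  by have [_] := Hps _ (Hmem k).
- rewrite !size_lst //; split; apply: bound; rewrite -addnn in HiJ *; lia.
- by split; apply: (hsum_lst_gt0 n q a) => //; lia.
apply: Rle_trans HB; apply: Rmult_le_compat_r; first exact: sqrt_pos.
have Hf : 0 < INR i`! by apply: lt_0_INR; have := fact_gt0 i; lia.
have S1 : INR i ^ i <= sqrt (((INR J - INR i) * (psum a b - INR J / INR a)) ^ i).
  rewrite -[X in X <= _]sqrt_square; last by apply: pow_le; lra.
  apply: sqrt_le_1_alt; rewrite -Rpow_mult_distr; apply: pow_incr; split => //; nra.
apply: Rle_trans (_ : INR i ^ i / INR i`! <= _); last first.
  by apply: Rmult_le_compat_r => //; exact/Rlt_le/Rinv_0_lt_compat.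
have E : INR i ^ i = exp (INR i * ln (INR i)).
  have Em m k : INR (m ^ k) = INR m ^ k.
    by elim: k => [|k IHk] //; rewrite expnS mult_INR IHk.
  by rewrite -ln_expn // exp_ln ?Em //; apply: pow_lt; lra.
rewrite E -[X in _ / X]exp_ln // /Rdiv -exp_Ropp -exp_plus; apply: exp_le_compat.
have := ln_fact_stirling i Hi; lra.
Qed.

Lemma chain (a : nat -> nat) c r L : (forall l, (a l <= a l.+1)%N) -> 
  (forall l, (l < L)%N -> exists N1 N2, resonator N1 N2 (exp c) (exp r) (a l) (a l.+1)) ->
  exists N1 N2, resonator N1 N2 (exp (INR L * c)) (exp (INR L * r)) (a 0%N) (a L).
Proof.
move=> Ha; elim: L => [|L IH] H.
  by exists [:: 1%N], [:: 1%N]; rewrite [INR 0]/= !Rmult_0_l exp_0; exact: resonator1.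
have [N1 [N2 HN]] := IH (fun l Hl => H l (ltnW Hl)).
have [M1 [M2 HM]] := H L (ltnSn L).
exists (prodl N1 M1), (prodl N2 M2).
have E x : exp (INR L.+1 * x) = exp (INR L * x) * exp x by rewrite -exp_plus S_INR; congr exp; ring.
rewrite !E; apply: resonator_mul HN HM.
- elim: (L) => [|l Hl] //; exact: leq_trans Hl (Ha l).
- exact: Ha.
- exact/Rlt_le/exp_pos.
exact/Rlt_le/exp_pos.
Qed.

(** * Optimal parameters: the gain as a function of the log-size y *)

Lemma exp_ge_sq x : 0 <= x -> x * x / 4 <= exp x.
Proof.
move=> Hx; have H := exp_ineq1_le (x / 2).
have -> : exp x = exp (x / 2) * exp (x / 2) by rewrite -exp_plus; congr exp; field.
nra.
Qed.

(** Eventual inequalities used twice: at D = ln y in [gcd_resonator] and at D = T in [theorem1]. *)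
Lemma large_facts K d : 1 <= K -> 0 < d <= 1 -> exists D0, forall D, D0 <= D ->
  [/\ K <= ln D, K * (1 + ln D) <= exp (d * ln D), K * (D * D) <= exp D & ln D <= D].
Proof.
move=> HK Hd.
set w0 := 8 * K / (d * d) + 256 * K.
have Hdd : 0 < d * d by nra.
have H8 : 0 < 8 * K / (d * d) by apply: Rdiv_lt_0_compat; lra.
exists (exp w0) => D HD.
have HD0 : 0 < D by have := exp_pos w0; lra.
have Hw : w0 <= ln D by rewrite -[w0]ln_exp; apply: ln_le => //; exact: exp_pos.
have HwD : ln D <= D.
  by rewrite -[X in _ <= X]ln_exp; apply: ln_le => //; have := exp_ineq1_le D; lra.
set w := ln D in Hw HwD *.
have Hw1 : 1 <= w by rewrite /w0 in Hw; lra.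
split => //; first by rewrite /w0 in Hw; lra.
  have H := exp_ge_sq (d * w) ltac:(nra).
  have H2 : 8 * K <= d * d * w.
    have -> : 8 * K = d * d * (8 * K / (d * d)) by field; lra.
    apply: Rmult_le_compat_l; first lra. rewrite /w0 in Hw; lra.
  have H3 : 8 * K * w <= d * d * w * w by apply: Rmult_le_compat_r; lra.
  have : K * 1 <= K * w by apply: Rmult_le_compat_l; lra.
  lra.
have E : exp D = exp (D / 2) * exp (D / 2) by rewrite -exp_plus; congr exp; field.
have H := exp_ge_sq (D / 2) ltac:(lra).
have HD1 : 256 * K <= D by rewrite /w0 in Hw; lra.
have H4 : 16 * K <= D * D / 16 by nra.
have H5 : 0 <= D / 2 * (D / 2) / 4 by nra.
have H6 := Rmult_le_compat _ _ _ _ H5 H5 H H.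
rewrite E; apply: Rle_trans H6.
have -> : D / 2 * (D / 2) / 4 * (D / 2 * (D / 2) / 4) = D * D / 256 * (D * D) by field.
apply: Rmult_le_compat_r; nra.
Qed.

Lemma fl_mono x y : 0 <= x <= y -> (fl x <= fl y)%N.
Proof.
move=> H; have B1 := fl_bound x ltac:(lra); have B2 := fl_bound y ltac:(lra).
have : INR (fl x) < INR (fl y).+1 by rewrite S_INR; lra.
by move/INR_lt => ?; lia.
Qed.

Section Asym.
Variables (d y : R).
Hypotheses (Hd : 0 < d <= 1 / 20).
(** Since y is the logarithm of the allowed size, D and w are its second and third iterated
    logarithms, and g = D^d. *)
Let D := ln y.
Let w := ln D.
Let g := exp (d * w).
Let K := 1000 * (/ d) ^ 5.
Hypotheses (Hy0 : 0 < y) (Hw : K <= w) (Hg : K * (1 + w) <= g) (HyD : K * (D * D) <= y) (HwD : w <= D).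

Lemma Hinvd : 20 <= / d.
Proof. have -> : 20 = / (1 / 20) by field. by apply: Rinv_le_contravar; lra. Qed.

Lemma K_ge k : (k <= 5)%N -> 1000 * (/ d) ^ k <= K.
Proof.
move=> Hk; rewrite /K; apply: Rmult_le_compat_l; first lra.
by apply: Rle_pow; [have := Hinvd; lra|apply/leP].
Qed.

Lemma lnB_bounds : d / 2 <= ln (1 + d) <= d.
Proof.
split; last by rewrite -[X in _ <= X]ln_exp; apply: ln_le; [lra|exact: exp_ineq1_le].
rewrite -[X in X <= _]ln_exp; apply: ln_le; first exact: exp_pos.
have H := exp_ineq1_le (- (d / 2)); rewrite exp_Ropp in H.
have He := exp_pos (d / 2).
have H2 : exp (d / 2) * (1 - d / 2) <= 1.
  have := Rmult_le_compat_l _ _ _ (Rlt_le _ _ He) H; rewrite Rinv_r; lra.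
nra.
Qed.

(** Block l consists of the primes between y exp(v l) and y exp(v (l+1)), where v grows by the
    factor 1 + d from D^d to at most D^(1-d), in about w/d blocks. [AA] is governed by the share of
    the log-size y given to each block. The square of [x] is just below d AA / D, the approximate
    value of J times the sum of 1/p, which is the same for all blocks. *)
Let lB := ln (1 + d).
Let Lb := fl ((1 - 2 * d) * w / lB).
Let v (l : nat) := g * (1 + d) ^ l.
Let a l := fl (y * exp (v l)).
Let AA := (1 - d) * y / ((1 + d) * INR Lb).
Let x := sqrt ((1 - 4 * d) * d * (AA / D)).
Let i := fl x.

Lemma basic : [/\ 1000 <= w, 1000 <= g, 1000 <= D & 1000 * (/ d) ^ 1 <= w].
Proof.
have K0 := K_ge 0 isT; have K1 := K_ge 1 isT; rewrite [_ ^ 0]/= in K0.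
split; nra.
Qed.

Lemma Ddef : D = exp w. Proof. by have [? ? ? ?] := basic; rewrite /w exp_ln //; lra. Qed.
Lemma ydef : y = exp D. Proof. by rewrite /D exp_ln. Qed.

Lemma Lb_bounds : 1 <= INR Lb /\ INR Lb * lB <= (1 - 2 * d) * w /\ (1 - 3 * d) * w <= d * INR Lb /\ 4 * INR Lb <= D.
Proof.
have [W1 W2 W3 W4] := basic. have [B1 B2] := lnB_bounds. rewrite -/lB in B1 B2.
have HlB : 0 < lB by lra.
have H0 : 0 <= (1 - 2 * d) * w / lB by apply: Rmult_le_pos; [nra|apply/Rlt_le/Rinv_0_lt_compat].
have [F1 F2] := fl_bound _ H0; rewrite -/Lb in F1 F2.
have E : (1 - 2 * d) * w / lB * lB = (1 - 2 * d) * w by field; lra.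
have G1 := Rmult_le_compat_r lB _ _ ltac:(lra) F1.
have G2 := Rmult_lt_compat_r lB _ _ HlB F2.
rewrite E in G1 G2.
have HL0 := pos_INR Lb.
have H3 : (1 - 3 * d) * w <= d * INR Lb by nra.
split.
  have : 0 < INR Lb by nra.
  case: (Lb) => [|n] H; first by rewrite /= in H; lra.
  by apply: (le_INR 1); lia.
split => //; split => //.
have HgD : g <= D by rewrite Ddef /g; apply: exp_le_compat; nra.
have K1 := K_ge 1 isT; rewrite pow_1 in K1.
have Hid := Hinvd.
have H4 : INR Lb <= 2 * / d * w.
  have H5 : INR Lb * (d / 2) <= w by nra.
  have : INR Lb * (d / 2) * (2 * / d) <= w * (2 * / d) by apply: Rmult_le_compat_r; lra.
  have -> : INR Lb * (d / 2) * (2 * / d) = INR Lb by field; lra.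
  lra.
have : 1000 * / d * (1 + w) <= K * (1 + w) by apply: Rmult_le_compat_r; lra.
nra.
Qed.

Lemma AA_bounds : 0 < AA /\ AA <= y /\ K <= AA / D /\ D - w <= ln AA.
Proof.
have [W1 W2 W3 W4] := basic. have [L1 [L2 [L3 L4]]] := Lb_bounds.
have Hden : 0 < (1 + d) * INR Lb by nra.
have HA0 : 0 < AA by apply: Rdiv_lt_0_compat; nra.
split => //; split.
  apply: (Rmult_le_reg_r ((1 + d) * INR Lb)) => //.
  have -> : AA * ((1 + d) * INR Lb) = (1 - d) * y by rewrite /AA; field; lra.
  have H1 : 1 <= (1 + d) * INR Lb by nra.
  have H2 := Rmult_le_compat_l y _ _ ltac:(lra) H1.
  have H3 : 0 <= d * y by nra.
  lra.
have HAl : y * / D <= AA.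
  apply: (Rmult_le_reg_r ((1 + d) * INR Lb)) => //.
  have -> : AA * ((1 + d) * INR Lb) = (1 - d) * y by rewrite /AA; field; lra.
  have H : / D * ((1 + d) * INR Lb) <= 1 - d.
    apply: (Rmult_le_reg_l D); first lra.
    have -> : D * (/ D * ((1 + d) * INR Lb)) = (1 + d) * INR Lb by field; lra.
    nra.
  rewrite Rmult_assoc (Rmult_comm (1 - d)); apply: Rmult_le_compat_l; lra.
split.
  apply: (Rmult_le_reg_r (D * D)); first nra.
  have -> : AA / D * (D * D) = AA * D by field; lra.
  apply: Rle_trans HyD _.
  have := Rmult_le_compat_r D _ _ ltac:(lra) HAl.
  by have -> : y * / D * D = y by field; lra.
have -> : D - w = ln (y * / D).
  by rewrite ln_mult ?ln_Rinv //; [lra|apply: Rinv_0_lt_compat; lra].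
apply: ln_le => //; apply: Rmult_lt_0_compat => //; apply: Rinv_0_lt_compat; lra.
Qed.

Lemma v_range l : (l < Lb)%N -> g <= v l /\ v l.+1 = (1 + d) * v l /\ v l.+1 * g <= D.
Proof.
move=> Hl; have [W1 W2 W3 W4] := basic. have [L1 [L2 [L3 L4]]] := Lb_bounds.
have [B1 B2] := lnB_bounds. rewrite -/lB in B1 B2.
have Hp1 n : 1 <= (1 + d) ^ n by apply: pow_R1_Rle; lra.
split; first by rewrite /v; have := Hp1 l; nra.
split; first by rewrite /v /=; ring.
have E n : (1 + d) ^ n = exp (INR n * lB).
  elim: n => [|n IH]; first by rewrite /= Rmult_0_l exp_0.
  have -> : INR n.+1 * lB = lB + INR n * lB by rewrite S_INR; ring.
  by rewrite [_ ^ _]/= IH exp_plus {2}/lB exp_ln //; lra.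
rewrite /v E Ddef /g -!exp_plus; apply: exp_le_compat.
have : INR l.+1 <= INR Lb by apply: le_INR; lia.
nra.
Qed.

Lemma x_bounds : 1 <= x /\ x * x = (1 - 4 * d) * d * (AA / D) /\ 256 * (/ d) ^ 4 <= x * x /\ x <= AA / D /\ 1 <= AA / D.
Proof.
have [W1 W2 W3 W4] := basic. have [A1 [A2 [A3 A4]]] := AA_bounds.
have Hid := Hinvd. have K0 := K_ge 0 isT; rewrite [_ ^ 0]/= in K0.
have HK : K = 1000 * / d * (/ d) ^ 4 by rewrite /K /=; ring.
have P4 : 1 <= (/ d) ^ 4 by apply: pow_R1_Rle; lra.
set z := AA / D in A3 *.
have Hz : 1 <= z by lra.
have Exx : x * x = (1 - 4 * d) * d * z by rewrite /x -/z sqrt_sqrt //; apply: Rmult_le_pos; nra.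
have Hxx : 256 * (/ d) ^ 4 <= x * x.
  rewrite Exx.
  have : (1 - 4 * d) * d * K <= (1 - 4 * d) * d * z by apply: Rmult_le_compat_l; nra.
  have -> : (1 - 4 * d) * d * K = (1 - 4 * d) * (1000 * (/ d) ^ 4) by rewrite HK; field; lra.
  nra.
have Hx0 : 0 <= x by exact: sqrt_pos.
split; first nra.
split => //; split => //; split => //.
have : x * x <= z * z by rewrite Exx; nra.
nra.
Qed.

(** Take J = floor(AA / u) with u = v l. Choosing J primes of the block costs about u (1 + d) each,
    so the log-size is about AA. The sum of 1/p is about d u / D, so the factor u cancels in its
    product with J, and the same i serves every block. *)
Lemma one_block l : (l < Lb)%N -> exists N1 N2,
  resonator N1 N2 (exp (AA * ((1 + d) * (1 + d / 2)))) (exp (INR i - 1 - ln (INR i))) (a l) (a l.+1).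
Proof.
move=> Hl.
have [W1 W2 W3 W4] := basic. have [L1 [L2 [L3 L4]]] := Lb_bounds.
have [A1 [A2 [A3 A4]]] := AA_bounds. have [X1 [X2 [X3 [X4 X5]]]] := x_bounds.
have [V1 [V2 V3]] := v_range l Hl.
have Hid := Hinvd.
set u := v l in V1 V2 *. set ub := v l.+1 in V2 V3 *.
have Hu : 1000 <= u by lra.
have Hub0 : u <= ub by nra.
have HubD : ub <= D by nra.
have K2 := K_ge 2 isT. have K1 := K_ge 1 isT.
have Kg : K <= g by nra.
have Hdid : d * / d = 1 by field; lra.
have Hu12 : 12 <= d * d * u.
  have : 1000 * (/ d) ^ 2 <= u by lra.
  move=> H; have := Rmult_le_compat_l (d * d) _ _ ltac:(nra) H.
  have -> : d * d * (1000 * (/ d) ^ 2) = 1000 by rewrite /=; field; lra.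
  lra.
have HubdD : ub <= d * D.
  have H : 1 <= d * g.
    have := Rmult_le_compat_l d _ _ ltac:(lra) (Rle_trans _ _ _ K1 Kg); rewrite pow_1; lra.
  have H2 : ub * 1 <= ub * (d * g) by apply: Rmult_le_compat_l; lra.
  have H3 : d * (ub * g) <= d * D by apply: Rmult_le_compat_l; lra.
  lra.
have Heu : 1 + u <= exp u by exact: exp_ineq1_le.
have HeuD : D * D <= exp u.
  have K0 := K_ge 0 isT; rewrite [_ ^ 0]/= in K0.
  have H1 : 1000 * (1 + w) <= K * (1 + w) by apply: Rmult_le_compat_r; lra.
  rewrite Ddef -exp_plus; apply: exp_le_compat; lra.
have Hy1 : 1000 <= y.
  have K0 := K_ge 0 isT; rewrite [_ ^ 0]/= in K0.
  have H1 : 1 * 1 <= D * D by apply: Rmult_le_compat; lra.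
  have H2 : 1000 * 1 <= K * (D * D) by apply: Rmult_le_compat; lra.
  lra.
have Hye : 1000 <= y * exp u.
  have : 1000 * 1 <= y * exp u by apply: Rmult_le_compat; lra.
  lra.
have Hyeb : 1000 <= y * exp ub.
  have H1 := exp_ineq1_le ub.
  have : 1000 * 1 <= y * exp ub by apply: Rmult_le_compat; lra.
  lra.
have [F1 F2] := fl_bound (y * exp u) ltac:(lra).
have [F3 F4] := fl_bound (y * exp ub) ltac:(lra).
rewrite -/(a l) in F1 F2. rewrite -/(a l.+1) in F3 F4.
have Hal : y * exp u / 2 <= INR (a l) by lra.
have Hal1 : y * exp ub / 2 <= INR (a l.+1) by lra.
have Ha0 : (0 < a l)%N by case: (a l) Hal => [|n] // H; rewrite /= in H; lra.
have lnye t : ln (y * exp t) = D + t by rewrite ln_mult // ?ln_exp //; exact: exp_pos.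
have LA : ln (INR (a l)) <= D + u by rewrite -lnye; apply: ln_le; lra.
have LB1 : ln (INR (a l.+1)) <= D + ub by rewrite -lnye; apply: ln_le; lra.
have L2' : ln 2 <= 1 by rewrite -(ln_exp 1); apply: ln_le; [lra|have := exp_ineq1_le 1; lra].
have LB2 : D + ub - 1 <= ln (INR (a l.+1)).
  have : ln (y * exp ub / 2) <= ln (INR (a l.+1)) by apply: ln_le; lra.
  rewrite /Rdiv ln_mult; [|lra|lra]. rewrite lnye ln_Rinv; lra.
have Haa : (a l <= a l.+1)%N.
  apply: (fl_mono (y * exp u) (y * exp ub)); split; first lra.
  by apply: (Rmult_le_compat_l y _ _ (Rlt_le _ _ Hy0)); exact: exp_le_compat.
have Hb1 : (1 < a l.+1)%N by apply/leP/INR_lt; rewrite /=; lra.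
have PS := prime_inv_sum (a l) (a l.+1) Ha0 Haa Hb1; rewrite -/(psum _ _) in PS.
set s := psum _ _ in PS.
(* The logarithms of the end points differ by about ub - u = d u; rounding and the constant 11
   together cost 12 <= d^2 u. *)
have PS2 : d * u * (1 - d) / (D * (1 + d)) <= s.
  apply: Rle_trans PS.
  have Eub : ub = u + d * u by rewrite V2; ring.
  have H1 : d * u * (1 - d) <= ln (INR (a l.+1)) - ln (INR (a l)) - 11 by lra.
  have H2 : 0 <= d * u * (1 - d) by apply: Rmult_le_pos; [apply: Rmult_le_pos; lra|lra].
  apply: Rmult_le_compat => //.
    by apply/Rlt_le/Rinv_0_lt_compat; apply: Rmult_lt_0_compat; lra.
  apply: Rinv_le_contravar; lra.
have J0 : 0 <= AA / u by apply: Rmult_le_pos; [lra|apply/Rlt_le/Rinv_0_lt_compat; lra].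
pose J := fl (AA / u).
have [J1 J2] := fl_bound _ J0; rewrite -/J in J1 J2.
have Hzg : AA / D * g <= AA / u.
  rewrite /Rdiv Rmult_assoc; apply: Rmult_le_compat_l; first lra.
  apply: (Rmult_le_reg_r (D * u)); first by apply: Rmult_lt_0_compat; lra.
  have -> : / D * g * (D * u) = u * g by field; lra.
  have -> : / u * (D * u) = D by field; lra.
  have : u * g <= ub * g by apply: Rmult_le_compat_r; lra.
  lra.
set z := AA / D in X2 X4 X5 Hzg A3.
have [I1 I2] := fl_bound x ltac:(lra); rewrite -/i in I1 I2.
have Hi0 : (0 < i)%N.
  case: (i) I2 => [|n] // H; rewrite /= in H.
  have H1 : x * x <= 1 * 1 by apply: Rmult_le_compat; lra.
  have := pow_R1_Rle (/ d) 4 ltac:(lra); lra.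
have Hi1 : 1 <= INR i by apply: (le_INR 1); lia.
have Hdg : 1000 <= d * g.
  have := Rmult_le_compat_l d _ _ ltac:(lra) (Rle_trans _ _ _ K1 Kg); rewrite pow_1; lra.
have Hdz : 1000 * z <= d * (AA / u).
  have H1 : 1000 * z <= d * g * z by apply: Rmult_le_compat_r; lra.
  have H2 : d * (z * g) <= d * (AA / u) by apply: Rmult_le_compat_l; lra.
  lra.
have HJi : (1 - d) * (AA / u) <= INR J - INR i by lra.
have Hau : 0 < y * exp u / 2 by lra.
(* The lower end point is at least y exp(u) / 2 with exp u >= D^2, so the correction J/a is
   negligible against d u / D. *)
have HJa : INR J / INR (a l) <= d * d * u / (4 * D).
  apply: Rle_trans (_ : AA / u * / (y * exp u / 2) <= _).
    apply: Rmult_le_compat => //; [exact: pos_INR|apply/Rlt_le/Rinv_0_lt_compat; lra|].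
    exact: Rinv_le_contravar.
  have Heu0 := exp_pos u.
  have -> : AA / u * / (y * exp u / 2) = (AA / y) * (2 * / (u * exp u)) by field; lra.
  have HAy : AA / y <= 1.
    apply: (Rmult_le_reg_r y) => //. have -> : AA / y * y = AA by field; lra. lra.
  have HAy0 : 0 <= AA / y by apply: Rmult_le_pos; [lra|apply/Rlt_le/Rinv_0_lt_compat].
  have HDD : 0 < D * D by apply: Rmult_lt_0_compat; lra.
  have Hiu : / (u * exp u) <= / (D * D).
    apply: Rinv_le_contravar => //.
    have : 1 * (D * D) <= u * exp u by apply: Rmult_le_compat; lra.
    lra.
  have Hiu0 : 0 < / (u * exp u) by apply: Rinv_0_lt_compat; apply: Rmult_lt_0_compat; lra.
  apply: Rle_trans (_ : 1 * (2 * / (D * D)) <= _).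
    by apply: Rmult_le_compat; lra.
  rewrite Rmult_1_l.
  have -> : d * d * u / (4 * D) = (d * d * u * D / 4) * / (D * D) by field; lra.
  apply: Rmult_le_compat_r; first exact/Rlt_le/Rinv_0_lt_compat.
  have : 12 * D <= d * d * u * D by apply: Rmult_le_compat_r; lra.
  lra.
have Hsd : d * u / D * (1 - 3 * d) <= s - INR J / INR (a l).
  have E1 : d * u * (1 - d) / (D * (1 + d)) = d * u / D * ((1 - d) / (1 + d)) by field; lra.
  have E2 : d * d * u / (4 * D) = d * u / D * (d / 4) by field; lra.
  have H1 : 1 - 2 * d <= (1 - d) / (1 + d).
    apply: (Rmult_le_reg_r (1 + d)); first lra.
    have -> : (1 - d) / (1 + d) * (1 + d) = 1 - d by field; lra.
    have : 0 <= d * d by exact: Rle_0_sqr.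
    lra.
  have H2 : 0 <= d * u / D by apply: Rmult_le_pos; [apply: Rmult_le_pos; lra|apply/Rlt_le/Rinv_0_lt_compat; lra].
  rewrite E1 in PS2; rewrite E2 in HJa.
  have := Rmult_le_compat_l _ _ _ H2 H1.
  have : 0 <= d * u / D * d by apply: Rmult_le_pos; lra.
  lra.
have Hpos : 0 <= d * u / D * (1 - 3 * d).
  by apply: Rmult_le_pos; [apply: Rmult_le_pos; [apply: Rmult_le_pos; lra|apply/Rlt_le/Rinv_0_lt_compat; lra]|lra].
have HiJ : (i.*2 <= J)%N.
  apply/leP/INR_le; rewrite -addnn plus_INR.
  have H1 : z * 1000 <= z * g by apply: Rmult_le_compat_l; lra.
  have H2 : (19 / 20) * (AA / u) <= (1 - d) * (AA / u) by apply: Rmult_le_compat_r; lra.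
  lra.
have Hii : INR i * INR i <= (INR J - INR i) * (s - INR J / INR (a l)).
  apply: Rle_trans (_ : x * x <= _); first by apply: Rmult_le_compat; lra.
  have H0 : 0 <= (1 - d) * (AA / u) by apply: Rmult_le_pos; lra.
  apply: Rle_trans (Rmult_le_compat _ _ _ _ H0 Hpos HJi Hsd).
  have -> : (1 - d) * (AA / u) * (d * u / D * (1 - 3 * d)) = (1 - d) * (1 - 3 * d) * d * z by rewrite /z; field; lra.
  rewrite X2; apply: Rmult_le_compat_r; first lra.
  apply: Rmult_le_compat_r; first lra.
  have : 0 <= d * d by exact: Rle_0_sqr.
  lra.
have [N1 [N2 HR]] := block_interval (a l) (a l.+1) J i Ha0 Hi0 HiJ ltac:(rewrite -/s; lra) Hii.
exists N1, N2; apply: resonator_weaken HR _ _; last lra.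
apply: exp_le_compat.
have H1zg : 1 * 1000 <= z * g by apply: Rmult_le_compat; lra.
have HJ0 : 0 < INR J by lra.
have HJl : AA / (2 * u) <= INR J.
  have -> : AA / (2 * u) = AA / u / 2 by field; lra.
  lra.
have LJ : D - w - w - 1 <= ln (INR J).
  have : ln (AA / (2 * u)) <= ln (INR J) by apply: ln_le => //; apply: Rdiv_lt_0_compat; lra.
  rewrite /Rdiv ln_mult; [|lra|apply: Rinv_0_lt_compat; lra].
  rewrite ln_Rinv; last lra. rewrite ln_mult; try lra.
  have : ln u <= w by apply: ln_le; lra.
  lra.
(* The end point is about y exp(ub) and J is y up to powers of D, so the logarithms differ by ub +
   O(w), where w is small against d g <= d ub. *)
have HE : 2 + ln (INR (a l.+1)) - ln (INR J) <= ub * (1 + d / 2).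
  have : 3 + 2 * w <= d / 2 * ub.
    have H1 : 1000 * / d * (1 + w) <= g.
      apply: Rle_trans Hg; apply: Rmult_le_compat_r; [lra|rewrite pow_1 in K1; lra].
    have := Rmult_le_compat_l (d / 2) _ _ ltac:(lra) H1.
    have -> : d / 2 * (1000 * / d * (1 + w)) = 500 * (1 + w) by field; lra.
    have : d / 2 * g <= d / 2 * ub by apply: Rmult_le_compat_l; lra.
    lra.
  lra.
apply: Rle_trans (Rmult_le_compat_l _ _ _ (Rlt_le _ _ HJ0) HE) _.
have -> : AA * ((1 + d) * (1 + d / 2)) = AA / u * (ub * (1 + d / 2)) by rewrite V2; field; lra.
by apply: Rmult_le_compat_r => //; apply: Rmult_le_pos; lra.
Qed.

(** Lb blocks of gain about x give Lb sqrt(d AA / D), close to sqrt(d Lb y / D), and d Lb is close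
    to w. *)
Lemma total_gain : (1 - 10 * d) * sqrt (y * w / D) <= INR Lb * (INR i - 1 - ln (INR i)).
Proof.
have [W1 W2 W3 W4] := basic. have [L1 [L2 [L3 L4]]] := Lb_bounds.
have [A1 [A2 [A3 A4]]] := AA_bounds. have [X1 [X2 [X3 [X4 X5]]]] := x_bounds.
have Hid := Hinvd.
have [I1 I2] := fl_bound x ltac:(lra); rewrite -/i in I1 I2.
have Hx16 : 16 * (/ d) ^ 2 <= x.
  have E : (/ d) ^ 4 = (/ d) ^ 2 * (/ d) ^ 2 by rewrite /=; ring.
  rewrite E in X3; have P : 1 <= (/ d) ^ 2 by apply: pow_R1_Rle; lra.
  nra.
have Hdx : 16 * / d <= d * x.
  have := Rmult_le_compat_l d _ _ ltac:(lra) Hx16.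
  have -> : d * (16 * (/ d) ^ 2) = 16 * / d by rewrite /=; field; lra. lra.
have Hi0 : (0 < i)%N.
  by case: (i) I2 => [|n] // H; rewrite /= in H; nra.
have Hi1 : 1 <= INR i by apply: (le_INR 1); lia.
have Hln : ln x <= d / 2 * x.
  set q := sqrt x.
  have Hq : q * q = x by apply: sqrt_sqrt; lra.
  have Hq0 : 0 < q by apply: sqrt_lt_R0; lra.
  have H1 : ln x <= 2 * q.
    rewrite -Hq ln_mult //.
    have : ln q <= q by rewrite -[X in _ <= X]ln_exp; apply: ln_le => //; have := exp_ineq1_le q; lra.
    lra.
  have H2 : 4 * / d <= q.
    have Hsq : (4 * / d) * (4 * / d) <= q * q by rewrite Hq /= in Hx16 *; lra.
    have [//|Hlt] := Rle_dec (4 * / d) q; nra.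
  have H3 : 4 <= d * q.
    have := Rmult_le_compat_l d _ _ ltac:(lra) H2; have -> : d * (4 * / d) = 4 by field; lra. lra.
  rewrite -Hq in H1 *; nra.
have Hgain : (1 - d) * x <= INR i - 1 - ln (INR i).
  have : ln (INR i) <= ln x by apply: ln_le; lra.
  lra.
apply: Rle_trans (_ : INR Lb * ((1 - d) * x) <= _); last by apply: Rmult_le_compat_l; lra.
have HyD0 : 0 <= y * w / D by apply: Rmult_le_pos; [nra|apply/Rlt_le/Rinv_0_lt_compat; lra].
set q := sqrt (y * w / D).
have Hq : q * q = y * w / D by apply: sqrt_sqrt.
have Hq0 : 0 <= q by exact: sqrt_pos.
have Hsq : ((1 - 9 * d) * q) * ((1 - 9 * d) * q) <= (INR Lb * x) * (INR Lb * x).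
  have -> : (1 - 9 * d) * q * ((1 - 9 * d) * q) = (1 - 9 * d) * (1 - 9 * d) * (w * (y / D)).
    have -> : (1 - 9 * d) * q * ((1 - 9 * d) * q) = (1 - 9 * d) * (1 - 9 * d) * (q * q) by ring.
    rewrite Hq /Rdiv; ring.
  have -> : INR Lb * x * (INR Lb * x) = (1 - 4 * d) * ((1 - d) / (1 + d)) * (d * INR Lb) * (y / D).
    have -> : INR Lb * x * (INR Lb * x) = INR Lb * INR Lb * (x * x) by ring.
    rewrite X2 /AA; field; lra.
  have HyDp : 0 <= y / D by apply: Rmult_le_pos; [lra|apply/Rlt_le/Rinv_0_lt_compat; lra].
  rewrite -Rmult_assoc; apply: Rmult_le_compat_r => //.
  have H1 : 1 - 2 * d <= (1 - d) / (1 + d).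
    apply: (Rmult_le_reg_r (1 + d)); first lra.
    have -> : (1 - d) / (1 + d) * (1 + d) = 1 - d by field; lra. nra.
  have H2 : (1 - 4 * d) * (1 - 2 * d) <= (1 - 4 * d) * ((1 - d) / (1 + d)) by apply: Rmult_le_compat_l; lra.
  have H3 : 0 <= (1 - 4 * d) * (1 - 2 * d) by nra.
  have H4 : 0 <= (1 - 3 * d) * w by apply: Rmult_le_pos; lra.
  apply: Rle_trans (Rmult_le_compat _ _ _ _ H3 H4 H2 L3).
  have H5 : (1 - 9 * d) * (1 - 9 * d) <= (1 - 4 * d) * (1 - 2 * d) * (1 - 3 * d).
    have H6 : 0 <= d * (9 - 55 * d - 24 * (d * d)).
      apply: Rmult_le_pos; first lra.
      have : d * d <= 1 * 1 by apply: Rmult_le_compat; lra.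
      have : d * d <= d * 1 by apply: Rmult_le_compat_l; lra.
      lra.
    lra.
  have := Rmult_le_compat_r w _ _ ltac:(lra) H5; lra.
have HLx : 0 <= INR Lb * x by apply: Rmult_le_pos; lra.
have Hfin : (1 - 9 * d) * q <= INR Lb * x.
  have [//|Hlt] := Rle_dec ((1 - 9 * d) * q) (INR Lb * x).
  have H1 : INR Lb * x < (1 - 9 * d) * q by lra.
  have := Rmult_le_0_lt_compat _ _ _ _ HLx HLx H1 H1; lra.
have -> : INR Lb * ((1 - d) * x) = (1 - d) * (INR Lb * x) by ring.
have := Rmult_le_compat_l (1 - d) _ _ ltac:(lra) Hfin.
have : 0 <= d * d * q by apply: Rmult_le_pos => //; exact: Rle_0_sqr.
lra.
Qed.

Lemma asym_resonator : exists N1 N2 lo hi, resonator N1 N2 (exp y) (exp ((1 - 10 * d) * sqrt (y * w / D))) lo hi.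
Proof.
have [W1 W2 W3 W4] := basic. have [L1 [L2 [L3 L4]]] := Lb_bounds.
have Ha l : (a l <= a l.+1)%N.
  apply: fl_mono; split; first by apply: Rmult_le_pos; [lra|exact/Rlt_le/exp_pos].
  apply: Rmult_le_compat_l; first lra. apply: exp_le_compat; rewrite /v; apply: Rmult_le_compat_l; first lra.
  by apply: Rle_pow; [lra|lia].
have [N1 [N2 HR]] := chain a _ _ Lb Ha one_block.
exists N1, N2, (a 0%N), (a Lb); apply: resonator_weaken HR _ _; apply: exp_le_compat; last exact: total_gain.
(* The factor 1 - d built into [AA] pays for the entropy losses: (1 - d)(1 + d/2) <= 1. *)
have -> : INR Lb * (AA * ((1 + d) * (1 + d / 2))) = (1 - d) * (1 + d / 2) * y by rewrite /AA; field; lra.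
nra.
Qed.
End Asym.

Lemma gcd_resonator th : th < 1 -> exists y0, forall y, y0 <= y -> exists N1 N2 lo hi,
  resonator N1 N2 (exp y) (exp (th * sqrt (y * ln (ln y) / ln y))) lo hi.
Proof.
move=> Hth.
pose d := Rmin (1 / 20) ((1 - th) / 10).
have Hd : 0 < d <= 1 / 20 by split; [apply: Rmin_glb_lt; lra|exact: Rmin_l].
have Hd2 : th <= 1 - 10 * d by have := Rmin_r (1 / 20) ((1 - th) / 10); rewrite -/d; lra.
set K := 1000 * (/ d) ^ 5.
have HK : 1 <= K.
  have H : 20 <= / d by exact: Hinvd.
  have := pow_R1_Rle (/ d) 5 ltac:(lra); rewrite -/K /K; lra.
have [D0 HD] := large_facts K d HK ltac:(lra).
exists (exp D0) => y Hy.
have Hy0 : 0 < y by have := exp_pos D0; lra.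
have HlnD : D0 <= ln y by rewrite -[D0]ln_exp; apply: ln_le => //; exact: exp_pos.
have [H1 H2 H3 H4] := HD _ HlnD.
rewrite exp_ln // in H3.
have [N1 [N2 [lo [hi HR]]]] := asym_resonator d y Hd Hy0 H1 H2 H3 H4.
exists N1, N2, lo, hi; apply: resonator_weaken HR _ _; first lra.
apply: exp_le_compat; apply: Rmult_le_compat_r => //; exact: sqrt_pos.
Qed.

(** * Choice of exponents and the contradiction for zeta *)

(** Allows the iterated logarithms of y = ka ln T to be replaced by those of ln T. *)
Lemma ln_ratio_decr a b : exp 1 <= a <= b -> ln b / b <= ln a / a.
Proof.
move=> [Ha Hab].
have He := exp_pos 1.
have La : 1 <= ln a by rewrite -(ln_exp 1); apply: ln_le; lra.
have Hb : ln b <= ln a + (b / a - 1).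
  have -> : ln b = ln a + ln (b / a).
    by rewrite -ln_mult; [congr ln; field; lra|lra|apply: Rdiv_lt_0_compat; lra].
  apply: Rplus_le_compat_l; rewrite -[X in _ <= X]ln_exp; apply: ln_le.
    by apply: Rdiv_lt_0_compat; lra.
  have := exp_ineq1_le (b / a - 1); lra.
have Hba : 0 <= b / a - 1.
  have -> : b / a - 1 = (b - a) / a by field; lra.
  by apply: Rmult_le_pos; [lra|apply/Rlt_le/Rinv_0_lt_compat; lra].
have H2 : ln b <= ln a * (b / a) by nra.
apply: (Rmult_le_reg_r b); first lra.
have -> : ln b / b * b = ln b by field; lra.
by have -> : ln a / a * b = ln a * (b / a) by field; lra.
Qed.

(** The summand 2 bounds the pole term 1/(1-s), since Re(1 - s) = 1/2. *)
Lemma zeta_em zeta t X : is_riemann_zeta zeta -> 2 <= t -> (0 < X)%N ->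
  Cmod (em_sum (hl t) X) <= Cmod (zeta (hl t)) + 2 + 2 * (1 + t) * exp (- (1 / 2) * ln (INR X)).
Proof.
move=> Hz Ht HX.
have B := em_rem_half zeta t X Hz Ht HX; rewrite -/(hl t) in B.
have E : em_sum (hl t) X = (zeta (hl t) + (/ (1 - hl t) - em_rem zeta X (hl t)))%C by rewrite /em_rem; ring.
have T1 := Cmod_triangle (zeta (hl t)) (/ (1 - hl t) - em_rem zeta X (hl t)).
have T2 := Cmod_triangle (/ (1 - hl t)) (- em_rem zeta X (hl t)).
rewrite Cmod_opp in T2; rewrite -E in T1.
have N1 := ne1_sub (hl t) (half_ne1 t).
have H : Cmod (/ (1 - hl t)) <= 2.
  rewrite Cmod_inv //.
  have -> : 2 = / (1 / 2) by field.
  apply: Rinv_le_contravar; first lra.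
  have := re_le_Cmod (1 - hl t)%C.
  have -> : Re (1 - hl t)%C = 1 / 2 by rewrite /hl /Re /=; field.
  rewrite Rabs_pos_eq; lra.
rewrite /Cminus in T1 T2 H *; lra.
Qed.

Theorem theorem1 :
  forall (zeta : C -> C), is_riemann_zeta zeta ->
  forall (beta c : R),
    0 < beta < 1 ->
    0 < c < sqrt (Rmin (1 / 2) (1 - beta)) ->
    exists T0 : R, forall T : R, T0 <= T ->
      exists t : R,
        Rpower T beta <= t <= T /\
        Cmod (zeta (RtoC (1 / 2) + Ci * RtoC t)%C) >=
          exp (c * sqrt (ln T * ln (ln (ln T)) / ln (ln T))).
Proof.
move=> zeta Hz beta c Hb Hc.
set k0 := Rmin (1 / 2) (1 - beta) in Hc.
have Hk0 : 0 < k0 by apply: Rmin_glb_lt; lra.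
have Hk0a : k0 <= 1 / 2 by exact: Rmin_l.
have Hk0b : k0 <= 1 - beta by exact: Rmin_r.
have Hck : c * c < k0.
  have E : sqrt k0 * sqrt k0 = k0 by apply: sqrt_sqrt; lra.
  rewrite -E; apply: Rmult_le_0_lt_compat; lra.
(* The resonator sets have at most T^ka members. The gap between c^2 and ka leaves room for some c'
   > c, which will absorb constants. *)
set ka := (c * c + k0) / 2.
have Hcc : 0 < c * c by apply: Rmult_lt_0_compat; lra.
have Hka : c * c < ka < k0 by rewrite /ka; lra.
have Hcs : c < sqrt ka.
  rewrite -(sqrt_square c); last lra. apply: sqrt_lt_1_alt; lra.
set c' := (c + sqrt ka) / 2.
have Hc' : c < c' < sqrt ka by rewrite /c'; lra.
set th := c' / sqrt ka.
have Hth : th < 1.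
  apply: (Rmult_lt_reg_r (sqrt ka)); first lra.
  have -> : th * sqrt ka = c' by rewrite /th; field; lra. lra.
have Hth0 : 0 <= th by apply: Rmult_le_pos; [lra|apply/Rlt_le/Rinv_0_lt_compat; lra].
have [y0 Hy0] := gcd_resonator th Hth.
(* Half of the slack in beta + ka < 1 goes into U = T^(beta + ep), the other half absorbs 2^k ln
   T. *)
set ep := (1 - ka - beta) / 2.
have Hep : 0 < ep by rewrite /ep; lra.
(* Then (T1/U)^(2k) = T^(-2 ep k) is at most T^(-4). *)
have [k Hk] := INR_unbounded (2 / ep).
set d := Rmin ep (1 - 2 * ka).
have Hd : 0 < d <= 1.
  split; first by apply: Rmin_glb_lt; lra.
  have := Rmin_l ep (1 - 2 * ka); rewrite -/d /ep; lra.
have Hd1 : d <= ep by exact: Rmin_l.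
have Hd2 : d <= 1 - 2 * ka by exact: Rmin_r.
set K' := (2000 / (c' - c)) * (2000 / (c' - c)).
have HK' : 0 <= K' by exact: Rle_0_sqr.
set K := 1000 + 2 ^ k + Rabs y0 / ka + exp (exp 1) / ka + exp (4 * K') + exp (exp 1) + 2 / beta.
have P1 : 0 < 2 ^ k by apply: pow_lt; lra.
have P2 : 0 <= Rabs y0 / ka by apply: Rmult_le_pos; [exact: Rabs_pos|apply/Rlt_le/Rinv_0_lt_compat; lra].
have P3 : 0 < exp (exp 1) by exact: exp_pos.
have P4 : 0 < exp (exp 1) / ka by apply: Rdiv_lt_0_compat; lra.
have P5 := exp_pos (4 * K').
have P6 : 0 < 2 / beta by apply: Rdiv_lt_0_compat; lra.
have [D0 HD] := large_facts K d ltac:(rewrite /K; lra) Hd.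
exists (Rmax 1 D0) => T HT.
have HT1 : 1 <= T by have := Rmax_l 1 D0; lra.
have [F1 F2 _ F4] := HD T (Rle_trans _ _ _ (Rmax_r 1 D0) HT).
set l := ln T in F1 F2 F4 *.
have ET : T = exp l by rewrite /l exp_ln //; lra.
have Hl : 1000 <= l by rewrite /K in F1; lra.
set Sl := l * ln (ln l) / ln l.
have He1 := exp_pos 1.
have L2e : exp 1 <= ln l.
  rewrite -(ln_exp (exp 1)); apply: ln_le => //; rewrite /K in F1; lra.
have L3 : 1 <= ln (ln l) by rewrite -{1}(ln_exp 1); apply: ln_le.
have HSl : K' <= Sl.
  have H1 : 4 * K' <= ln l.
    rewrite -(ln_exp (4 * K')); apply: ln_le => //; rewrite /K in F1; lra.
  have H2 : ln l * ln l / 4 <= l by have := exp_ge_sq (ln l) ltac:(lra); rewrite exp_ln; lra.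
  apply: Rle_trans (_ : ln l / 4 <= _); first lra.
  apply: (Rmult_le_reg_r (ln l)); first lra.
  have -> : Sl * ln l = l * ln (ln l) by rewrite /Sl; field; lra.
  have : l * 1 <= l * ln (ln l) by apply: Rmult_le_compat_l; lra.
  lra.
set q := sqrt Sl.
have Hq : 2000 / (c' - c) <= q.
  rewrite -(sqrt_square (2000 / (c' - c))); first exact: sqrt_le_1_alt.
  by apply/Rlt_le/Rdiv_lt_0_compat; lra.
set V0 := exp (c * q).
have Hq0 : 0 <= q by exact: sqrt_pos.
have HV0 : 1 <= V0 by rewrite /V0 -exp_0; apply: exp_le_compat; apply: Rmult_le_pos; lra.
(* By contradiction: |zeta| may be assumed below V0 on the whole range. *)
have [//|Hno] := classic (exists t, Rpower T beta <= t <= T /\ Cmod (zeta (RtoC (1 / 2) + Ci * RtoC t)%C) >= V0).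
exfalso.
have Hzt t : Rpower T beta <= t <= T -> Cmod (zeta (hl t)) <= V0.
  move=> Ht; apply: Rnot_lt_le => Hlt; apply: Hno; exists t; split => //.
  have -> : (RtoC (1 / 2) + Ci * RtoC t)%C = hl t by apply: injective_projections => /=; ring.
  lra.
set y := ka * l.
have Hyy : y0 <= y.
  have := Rle_abs y0.
  have -> : Rabs y0 = ka * (Rabs y0 / ka) by field; lra.
  move=> H; apply: Rle_trans H _; apply: Rmult_le_compat_l; rewrite /K in F1; lra.
have Hye : exp (exp 1) <= y.
  have -> : exp (exp 1) = ka * (exp (exp 1) / ka) by field; lra.
  apply: Rmult_le_compat_l; rewrite /K in F1; lra.
have [N1 [N2 [lo [hi [[U1 U2] HN [S1 S2] [Q1 Q2] HL]]]]] := Hy0 y Hyy.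
set rho := exp (th * _) in HL.
have Hrho : exp (c' * q) <= rho.
  apply: exp_le_compat.
  have -> : c' = th * sqrt ka by rewrite /th; field; lra.
  rewrite Rmult_assoc; apply: Rmult_le_compat_l => //.
  rewrite -sqrt_mult; [|lra|lra].
  apply: sqrt_le_1_alt.
  have Hlny : exp 1 <= ln y <= ln l.
    split; first by rewrite -(ln_exp (exp 1)); apply: ln_le.
    by apply: ln_le; rewrite /y; nra.
  have R1 := ln_ratio_decr _ _ Hlny.
  have -> : ka * Sl = y * (ln (ln l) / ln l) by rewrite /Sl /y; field; lra.
  have -> : y * ln (ln y) / ln y = y * (ln (ln y) / ln y) by rewrite /Rdiv; ring.
  apply: Rmult_le_compat_l => //; lra.
(* Dividing T by ln T makes the Gaussian tail beyond T smaller than any power of T, at the cost of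
   one logarithm. *)
pose Nn := exp y; pose tau := T / l; pose U := exp ((beta + ep) * l); pose T1 := Rpower T beta.
have ET1 : T1 = exp (beta * l) by [].
have Hd0l : 1 + l <= exp (d * l).
  apply: Rle_trans F2; rewrite -{1}[1 + l]Rmult_1_l; apply: Rmult_le_compat_r; rewrite ?/K; lra.
have mono z : d <= z -> exp (d * l) <= exp (z * l).
  by move=> H; apply: exp_le_compat; apply: Rmult_le_compat_r; lra.
have HN1 : 1 <= Nn by rewrite /Nn -exp_0; apply: exp_le_compat; apply: Rmult_le_pos; lra.
(* Here ka < 1/2 enters: T^(1 - 2 ka) exceeds ln T. *)
have HC1 : Nn * Nn <= tau.
  rewrite /tau /Nn -exp_plus; apply: (Rmult_le_reg_r l); first lra.
  have -> : T / l * l = exp (y + y) * exp ((1 - 2 * ka) * l).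
    by rewrite -exp_plus /Rdiv Rmult_assoc Rinv_l ?Rmult_1_r ?ET; [congr exp; rewrite /y; ring|lra].
  apply: Rmult_le_compat_l; first exact/Rlt_le/exp_pos.
  have := mono _ Hd2; lra.
have Htau : 1 <= tau by have : 1 * 1 <= Nn * Nn by [apply: Rmult_le_compat; lra]; lra.
(* Here ka < 1 - beta enters, through T^ep >= 2^k ln T. *)
have HC2 : 2 ^ k * (Nn * U) <= tau.
  rewrite /tau /Nn /U; apply: (Rmult_le_reg_r l); first lra.
  have -> : T / l * l = exp (y + (beta + ep) * l) * exp (ep * l).
    by rewrite -exp_plus /Rdiv Rmult_assoc Rinv_l ?Rmult_1_r ?ET; [congr exp; rewrite /y /ep; field|lra].
  have -> : 2 ^ k * (exp y * exp ((beta + ep) * l)) * l = exp (y + (beta + ep) * l) * (2 ^ k * l) by rewrite exp_plus; ring.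
  apply: Rmult_le_compat_l; first exact/Rlt_le/exp_pos.
  apply: Rle_trans (mono _ Hd1); apply: Rle_trans F2.
  apply: Rmult_le_compat; rewrite ?/K; lra.
have HtT : tau <= T.
  rewrite /tau; apply: (Rmult_le_reg_r l); first lra.
  have -> : T / l * l = T by field; lra.
  have : T * 1 <= T * l by apply: Rmult_le_compat_l; lra. lra.
have exp1 : exp (- l) <= 1 / 2.
  rewrite exp_Ropp; have -> : 1 / 2 = / 2 by field.
  apply: Rinv_le_contravar; first lra. have := exp_ineq1_le l; lra.
have HNT x : 0 <= x -> Nn * x * tau <= exp (y + l) * x.
  move=> Hx; rewrite exp_plus -ET.
  have -> : exp y * T * x = Nn * x * T by rewrite /Nn; ring.
  apply: Rmult_le_compat_l => //; apply: Rmult_le_pos; lra.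
(* Both leakage terms are at most T^(-4), against Nn tau <= T^(ka + 1). *)
have HC3 : Nn * ((T1 * T1 / (2 * (U * U))) ^ k + exp (- (T * T / (4 * (tau * tau))))) * tau <= 1.
  have HU0 : 0 < U by exact: exp_pos.
  have HT10 : 0 < T1 by rewrite ET1; exact: exp_pos.
  have E1 : (T1 * T1 / (2 * (U * U))) ^ k <= exp (- (4 * l)).
    apply: Rle_trans (_ : (exp (- (2 * ep * l))) ^ k <= _).
      apply: pow_incr; split.
        by apply/Rlt_le/Rdiv_lt_0_compat; repeat apply: Rmult_lt_0_compat; lra.
      have -> : exp (- (2 * ep * l)) = T1 * T1 / (U * U).
        rewrite ET1 /U -!exp_plus /Rdiv -exp_Ropp -exp_plus; congr exp; ring.
      apply: Rmult_le_compat_l; first by apply: Rmult_le_pos; lra.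
      have HUU : 0 < U * U by apply: Rmult_lt_0_compat.
      apply: Rinv_le_contravar; lra.
    have -> : (exp (- (2 * ep * l))) ^ k = exp (INR k * (- (2 * ep * l))).
      elim: (k) => [|j IH]; first by rewrite /= Rmult_0_l exp_0.
      by rewrite [_ ^ _]/= IH -exp_plus S_INR; congr exp; ring.
    apply: exp_le_compat.
    have H1 : 2 <= INR k * ep.
      have -> : 2 = 2 / ep * ep by field; lra. apply: Rmult_le_compat_r; lra.
    have := Rmult_le_compat_r l _ _ ltac:(lra) H1; lra.
  have E2 : exp (- (T * T / (4 * (tau * tau)))) <= exp (- (4 * l)).
    apply: exp_le_compat; apply: Ropp_le_contravar.
    have -> : T * T / (4 * (tau * tau)) = l * l / 4 by rewrite /tau; field; lra.
    have : 16 * l <= l * l by apply: Rmult_le_compat_r; lra.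
    lra.
  have H1 := HNT (exp (- (4 * l)) + exp (- (4 * l))) ltac:(have := exp_pos (- (4 * l)); lra).
  apply: Rle_trans (_ : Nn * (exp (- (4 * l)) + exp (- (4 * l))) * tau <= _).
    apply: Rmult_le_compat_r; first lra. apply: Rmult_le_compat_l; lra.
  apply: Rle_trans H1 _.
  have -> : exp (y + l) * (exp (- (4 * l)) + exp (- (4 * l))) = 2 * exp (y + l + - (4 * l)).
    by rewrite (exp_plus (y + l)); ring.
  have : exp (y + l + - (4 * l)) <= exp (- l).
    apply: exp_le_compat; rewrite /y; have : ka * l <= 1 * l by apply: Rmult_le_compat_r; lra.
    lra.
  lra.
(* X is chosen after T: the Euler--Maclaurin error is at most 1 up to height T, and all quotients up
   to Nn^2 are covered. *)
have [X [HX1 HX2]] := ex_ln_large (Rmax (2 * ln (2 * (1 + T))) (ln (Nn * Nn))) 1.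
have HXR : 0 < INR X by apply: lt_0_INR; lia.
have HNN : 0 < Nn * Nn by apply: Rmult_lt_0_compat; lra.
have HXN : Nn * Nn <= INR X.
  rewrite -(exp_ln (Nn * Nn)) // -(exp_ln (INR X)) //; apply: exp_le_compat.
  by apply: Rle_trans HX2; exact: Rmax_r.
have HXT : 2 * (1 + T) * exp (- (1 / 2) * ln (INR X)) <= 1.
  have H1 : exp (- (1 / 2) * ln (INR X)) <= / (2 * (1 + T)).
    rewrite -[X in _ <= X]exp_ln; last by apply: Rinv_0_lt_compat; lra.
    rewrite ln_Rinv; last lra. apply: exp_le_compat.
    have := Rmax_l (2 * ln (2 * (1 + T))) (ln (Nn * Nn)); lra.
  have := Rmult_le_compat_l (2 * (1 + T)) _ _ ltac:(lra) H1; rewrite Rinv_r; lra.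
have HT1T : T1 <= T by rewrite ET1 ET; apply: exp_le_compat; nra.
have HT12 : 2 <= T1.
  rewrite ET1; have H1 := exp_ineq1_le (beta * l).
  have : beta * (2 / beta) <= beta * l by apply: Rmult_le_compat_l; rewrite /K in F1; lra.
  have -> : beta * (2 / beta) = 2 by field; lra. lra.
have Hpos1 m : m \in N1 -> (0 < m)%N by move=> Hm; have [] := HN m ltac:(by rewrite mem_cat Hm).
have Hpos2 m : m \in N2 -> (0 < m)%N by move=> Hm; have [] := HN m ltac:(by rewrite mem_cat Hm orbT).
have HV t : T1 <= t <= T -> Cmod (em_sum (hl t) X) <= V0 + 3.
  move=> Ht; have H1 := zeta_em zeta t X Hz ltac:(lra) HX1.
  have H2 := Hzt t Ht.
  have : 2 * (1 + t) * exp (- (1 / 2) * ln (INR X)) <= 2 * (1 + T) * exp (- (1 / 2) * ln (INR X)).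
    apply: Rmult_le_compat_r; first exact/Rlt_le/exp_pos. lra.
  lra.
have RS := resonance_sets N1 N2 X k tau U T1 T Nn (V0 + 3) U1 U2 Hpos1 Hpos2 S1 S2 Q1 Q2 Htau HN1 HXN
  (exp_pos _) ltac:(lra) HT1T ltac:(lra) HV HC1 HC2 HC3.
have Hsq : 0 < sqrt (hsum N1 * hsum N2) by apply: sqrt_lt_R0; exact: Rmult_lt_0_compat.
have Hfin : rho <= 12 * (V0 + 3) + 1241 by apply: (Rmult_le_reg_r (sqrt (hsum N1 * hsum N2))) => //; lra.
(* As V0 >= 1, the right side of [Hfin] is at most (12 + 36 + 1241) V0 = 1289 V0, so 2000
   suffices. *)
have Hbig : 2000 * V0 <= exp (c' * q).
  have -> : c' * q = (c' - c) * q + c * q by ring.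
  rewrite exp_plus -/V0; apply: Rmult_le_compat_r; first lra.
  have H1 := exp_ineq1_le ((c' - c) * q).
  have : (c' - c) * (2000 / (c' - c)) <= (c' - c) * q by apply: Rmult_le_compat_l; lra.
  have -> : (c' - c) * (2000 / (c' - c)) = 2000 by field; lra.
  lra.
lra.
Qed.
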